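(* Let $p,q\ge 1$ be integers, let $m>n\ge 0$ be integers, and let $\mathbf X_n=(P_n,Q_n)$ and $\mathbf X_m=(P_m,Q_m)$ be planar vector fields that are quasi-homogeneous with weight $(p,q)$ and of degree $n$ and $m$ respectively. Let $a_n,a_m,b_n,b_m$ be the associated functions defined in the context. If $$b_n(\theta)b_m(\theta)>0,\qquad \int_0^{2\pi}\frac{a_n(\theta)}{b_n(\theta)}\,d\theta\cdot\int_0^{2\pi}\frac{a_m(\theta)}{b_m(\theta)}\,d\theta<0,$$ where the first inequality is for all $\theta$, then the system $$\frac{d}{dt}(x,y)=\mathbf X_n(x,y)+\mathbf X_m(x,y)$$ has at least $1$ limit cycle surrounding the origin.
   Context: A vector field $\mathbf X=(P,Q):\mathbb R^2\to\mathbb R^2$ is quasi-homogeneous with weight $(p,q)$ ($p,q$ positive integers) and degree $s$ ($s$ a nonnegative integer) if $P(\lambda^p x,\lambda^q y)=\lambda^{p+s-1}P(x,y)$ and $Q(\lambda^p x,\lambda^q y)=\lambda^{q+s-1}Q(x,y)$ for all $\lambda\in\mathbb R$ and all $(x,y)$. For $i=n,m$ define $$a_i(\theta)=(m-n)\big(\cos\theta\, P_i(\cos\theta,\sin\theta)+\sin\theta\, Q_i(\cos\theta,\sin\theta)\big),$$ $$b_i(\theta)=p\cos\theta\, Q_i(\cos\theta,\sin\theta)-q\sin\theta\, P_i(\cos\theta,\sin\theta).$$ A limit cycle is an isolated (non-constant) periodic orbit. It surrounds the origin if the origin lies in the bounded component of its complement.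
   Formalization: The vector fields X_n and X_m are assumed continuous; the statement names no regularity, and for discontinuous quasi-homogeneous fields the system may have no periodic solution around the origin. *)

(* Defs.v *)
From mathcomp Require Import all_boot all_order all_algebra.
From mathcomp Require Import all_classical all_reals all_analysis.
Set Implicit Arguments.
Unset Strict Implicit.
Unset Printing Implicit Defensive.
Import Order.TTheory GRing.Theory Num.Theory.
Import numFieldNormedType.Exports.
Local Open Scope classical_set_scope.
Local Open Scope ring_scope.

(* For p, q >= 1 the natural-number exponents p + s - 1 and q + s - 1 are not
   truncated; x ^+ 0 = 1, also at x = 0. *)
Definition quasi_homogeneous (R : realType) (p q s : nat)
    (X : R * R -> R * R) : Prop :=
  forall l x y : R,
    (X (l ^+ p * x, l ^+ q * y)).1 = l ^+ (p + s - 1) * (X (x, y)).1 /\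
    (X (l ^+ p * x, l ^+ q * y)).2 = l ^+ (q + s - 1) * (X (x, y)).2.

(* The functions a_i and b_i attached to X = X_i. *)
Definition afun (R : realType) (m n : nat) (X : R * R -> R * R) (t : R) : R :=
  (m%:R - n%:R) *
  (cos t * (X (cos t, sin t)).1 + sin t * (X (cos t, sin t)).2).

Definition bfun (R : realType) (p q : nat) (X : R * R -> R * R) (t : R) : R :=
  p%:R * cos t * (X (cos t, sin t)).2 - q%:R * sin t * (X (cos t, sin t)).1.

Definition solution (R : realType) (X : R * R -> R * R) (g : R -> R * R) : Prop :=
  forall t : R,
    is_derive t (1 : R) (fun u => (g u).1) (X (g t)).1 /\
    is_derive t (1 : R) (fun u => (g u).2) (X (g t)).2.

Definition periodic_orbit (R : realType) (X : R * R -> R * R)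
    (G : set (R * R)) : Prop :=
  exists g : R -> R * R,
    [/\ solution X g,
        exists2 T : R, 0 < T & forall t, g (t + T) = g t,
        exists t, g t <> g 0
      & G = range g].

(* Isolated: no other periodic orbit even meets some neighbourhood of G. *)
Definition limit_cycle (R : realType) (X : R * R -> R * R)
    (G : set (R * R)) : Prop :=
  periodic_orbit X G /\
  exists U : set (R * R),
    [/\ open U, G `<=` U
      & forall G' : set (R * R), periodic_orbit X G' -> G' `&` U !=set0 -> G' = G].

(* The origin lies off G and its component in the complement is bounded.
   (connected_component A x is empty when x is not in A.) *)
Definition surrounds_origin (R : realType) (G : set (R * R)) : Prop :=
  ~ G (0, 0) /\ bounded_set (connected_component (~` G) ((0, 0) : R * R)).

(* Main.v *)
(* In weighted polar coordinates x = r^p cos t, y = r^q sin t the orbits away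
   from the origin are the graphs of the solutions of one scalar equation: with
   w = (m - n) ln r it reads
     dw/dt = Am + (An - Am) k / (k + e^w),
   where Ai = a_i / b_i and k = b_n / b_m > 0. The right-hand side is bounded,
   2 pi-periodic in t and Lipschitz in w. The displacement of w over one period
   tends to the integral of An as w -> -oo and to that of Am as w -> +oo; these
   have opposite signs, so a smallest 2 pi-periodic solution W exists. With
   u = e^(w - W) - 1 the equation becomes u' = - c u (1 + u) / (1 + d u), so the
   displacement is given near W by a convergent power series in u(0): either W
   is isolated among the periodic solutions or all nearby solutions are
   periodic, and the latter contradicts the minimality of W. *)
Require Import Defs.
From mathcomp Require Import all_boot all_order all_algebra.
From mathcomp Require Import all_classical all_reals all_analysis.
From mathcomp Require Import ring lra.
Import Order.TTheory GRing.Theory Num.Theory.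
Import numFieldNormedType.Exports.
Local Open Scope classical_set_scope.
Local Open Scope ring_scope.

(** * Calculus on the line *)

(** The fields are only continuous, so the planar system offers no uniqueness theorem, and a
    solution could a priori run into the origin or close up after several turns. Both questions are
    decided on the scalar equation: with the logarithm of the radius it is defined and Lipschitz on
    the whole line, and every planar solution is lifted and compared with its solutions. Scalar
    solutions cannot cross; this rules out multiple winding and, for periodic solutions, passage
    through the origin. Isolation needs analyticity in the initial value, although the coefficients
    are only continuous in the angle. Dividing u by e = u(0) and by the linearised flow m turns its
    equation into x' = e h x^2 / (1 + e d m x), x(0) = 1, whose coefficients in powers of e arise by
    successive integration. Polynomials with remainders of order (D |e|)^(N+1), with constants
    uniform in N, take the place of the power series. *)

Section calculus.
Context {R : realType}.
Implicit Types (f g : R -> R) (x a b df dg c : R).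

Lemma der_eq f x df df' : is_derive x (1:R) f df -> df = df' ->
  is_derive x (1:R) f df'.
Proof. by move=> ? <-. Qed.

Lemma der_cst c x : is_derive x (1:R) (fun _ => c) 0.
Proof. exact: is_derive_cst. Qed.

Lemma der_id x : is_derive x (1:R) (fun t => t) 1.
Proof. exact: is_derive_id. Qed.

Lemma der_add f g x df dg : is_derive x (1:R) f df -> is_derive x (1:R) g dg ->
  is_derive x (1:R) (fun t => f t + g t) (df + dg).
Proof. move=> hf hg; exact: (@is_deriveD _ _ _ f g). Qed.

Lemma der_opp f x df : is_derive x (1:R) f df ->
  is_derive x (1:R) (fun t => - f t) (- df).
Proof. move=> hf; exact: (@is_deriveN _ _ _ f). Qed.

Lemma der_mul f g x df dg : is_derive x (1:R) f df -> is_derive x (1:R) g dg ->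
  is_derive x (1:R) (fun t => f t * g t) (df * g x + f x * dg).
Proof.
move=> hf hg; have H : is_derive x (1:R) (f * g) (f x *: dg + g x *: df).
  exact: is_deriveM.
by rewrite addrC [df * _]mulrC; exact: H.
Qed.

Lemma der_comp f g x df dg : is_derive (g x) (1:R) f df ->
  is_derive x (1:R) g dg -> is_derive x (1:R) (fun t => f (g t)) (df * dg).
Proof. by move=> hf hg; exact: (is_derive1_comp hf hg). Qed.

Lemma der_exp g x dg : is_derive x (1:R) g dg ->
  is_derive x (1:R) (fun t => expR (g t)) (expR (g x) * dg).
Proof. by move=> hg; apply: (der_comp expR g). Qed.

Lemma der_cos g x dg : is_derive x (1:R) g dg ->
  is_derive x (1:R) (fun t => cos (g t)) (- sin (g x) * dg).
Proof. by move=> hg; apply: (der_comp cos g). Qed.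

Lemma der_sin g x dg : is_derive x (1:R) g dg ->
  is_derive x (1:R) (fun t => sin (g t)) (cos (g x) * dg).
Proof. by move=> hg; apply: (der_comp sin g). Qed.

Lemma der_flip f x df : is_derive (- x) (1:R) f df ->
  is_derive x (1:R) (fun t => f (- t)) (df * -1).
Proof.
by move=> hf; apply: (der_comp f (fun t => - t)) => //; exact/der_opp/der_id.
Qed.

Lemma der_shift f x c df : is_derive (x + c) (1:R) f df ->
  is_derive x (1:R) (fun t => f (t + c)) df.
Proof.
move=> hf; rewrite -[df]mulr1; apply: (der_comp f (fun t => t + c)) => //.
by rewrite -[X in is_derive _ _ _ X]addr0; exact: (der_add _ _ _ _ _ (der_id _) (der_cst _ _)).
Qed.

Lemma der_inv g x dg : g x != 0 -> is_derive x (1:R) g dg ->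
  is_derive x (1:R) (fun t => (g t)^-1) (- dg / (g x) ^+ 2).
Proof.
move=> g0 hg; have H := is_deriveV g0 hg.
by rewrite mulrC mulrN -mulNr; exact: H.
Qed.

Lemma der_exprn f x df n : is_derive x (1:R) f df ->
  is_derive x (1:R) (fun t => f t ^+ n) (n%:R * f x ^+ n.-1 * df).
Proof.
move=> hf; elim: n => [|n ih]; first by rewrite !mul0r; exact: der_cst.
have -> : (fun t => f t ^+ n.+1) = fun t => f t * f t ^+ n.
  by apply/funext => t; rewrite exprS.
apply: der_eq (der_mul f (fun t => f t ^+ n) _ _ _ hf ih) _.
case: n {ih} => [|n] /=; first by rewrite expr0; ring.
by rewrite -[n.+2%:R]natr1 exprS; ring.
Qed.

Lemma der_continuous f x df : is_derive x (1:R) f df -> {for x, continuous f}.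
Proof.
move=> [h _]; apply: differentiable_continuous.
by apply/derivable1_diffP.
Qed.

End calculus.

Ltac der_step := lazymatch goal with
| |- is_derive _ _ (fun _ => ?c) _ => notypeclasses refine (der_cst c _)
| |- is_derive _ _ (fun t => t) _ => notypeclasses refine (der_id _)
| |- is_derive _ _ (fun t => @?f t + @?g t) _ => notypeclasses refine (der_add f g _ _ _ _ _)
| |- is_derive _ _ (fun t => @?f t * @?g t) _ => notypeclasses refine (der_mul f g _ _ _ _ _)
| |- is_derive _ _ (fun t => - @?f t) _ => notypeclasses refine (der_opp f _ _ _)
| |- is_derive _ _ (fun t => (@?f t)^-1) _ => notypeclasses refine (der_inv f _ _ _ _)
| |- is_derive _ _ (fun t => (@?f t) ^+ ?n) _ => notypeclasses refine (der_exprn f _ _ n _)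
| |- is_derive _ _ (fun t => expR (@?f t)) _ => notypeclasses refine (der_exp f _ _ _)
| |- is_derive _ _ (fun t => cos (@?f t)) _ => notypeclasses refine (der_cos f _ _ _)
| |- is_derive _ _ (fun t => sin (@?f t)) _ => notypeclasses refine (der_sin f _ _ _)
end.

(* Generates the derivative of an expression and leaves first the derivatives
   of its atoms (and nonvanishing conditions), then the equation between the
   computed derivative and the expected one. *)
Ltac der := notypeclasses refine (der_eq _ _ _ _ _ _); cbv beta;
  [repeat (der_step; cbv beta)..|cbv beta].

(** * Continuity of explicit expressions *)

Section continuity.
Context {T : topologicalType} {R : realType}.
Implicit Types (f g : T -> R) (x : T).

Lemma cont_cst (c : R) x : {for x, continuous (fun _ : T => c)}.
Proof. exact: cvg_cst. Qed.

Lemma cont_add f g x : {for x, continuous f} -> {for x, continuous g} ->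
  {for x, continuous (fun t => f t + g t)}.
Proof. by move=> hf hg; exact: cvgD hf hg. Qed.

Lemma cont_opp f x : {for x, continuous f} -> {for x, continuous (fun t => - f t)}.
Proof. by move=> hf; exact: cvgN hf. Qed.

Lemma cont_mul f g x : {for x, continuous f} -> {for x, continuous g} ->
  {for x, continuous (fun t => f t * g t)}.
Proof. by move=> hf hg; exact: cvgM hf hg. Qed.

Lemma cont_inv f x : f x != 0 -> {for x, continuous f} ->
  {for x, continuous (fun t => (f t)^-1)}.
Proof. by move=> f0 hf; exact: cvgV f0 hf. Qed.

Lemma cont_exprn f x n : {for x, continuous f} -> {for x, continuous (fun t => f t ^+ n)}.
Proof.
move=> hf; elim: n => [|n ih]; first exact: cont_cst.
rewrite (_ : (fun t => _) = fun t => f t * f t ^+ n); first exact: cont_mul.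
by apply/funext => t; rewrite exprS.
Qed.

Lemma cont_exp f x : {for x, continuous f} -> {for x, continuous (fun t => expR (f t))}.
Proof. by move=> hf; exact: (continuous_comp hf (@continuous_expR R (f x))). Qed.

Lemma cont_cos f x : {for x, continuous f} -> {for x, continuous (fun t => cos (f t))}.
Proof. by move=> hf; exact: (continuous_comp hf (@continuous_cos R (f x))). Qed.

Lemma cont_sin f x : {for x, continuous f} -> {for x, continuous (fun t => sin (f t))}.
Proof. by move=> hf; exact: (continuous_comp hf (@continuous_sin R (f x))). Qed.

Lemma cont_norm f x : {for x, continuous f} -> {for x, continuous (fun t => `|f t|)}.
Proof. by move=> hf; exact: (continuous_comp hf (@norm_continuous _ R^o (f x))). Qed.

End continuity.

Lemma cont_id {T : topologicalType} (x : T) : {for x, continuous (fun t : T => t)}.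
Proof. exact: cvg_id. Qed.

Ltac cont_step := lazymatch goal with
| |- {for _, continuous (fun _ => ?c)} => refine (cont_cst c _)
| |- {for _, continuous (fun t => t)} => refine (cont_id _)
| |- {for _, continuous (fun t => @?f t + @?g t)} => refine (cont_add f g _ _ _)
| |- {for _, continuous (fun t => @?f t * @?g t)} => refine (cont_mul f g _ _ _)
| |- {for _, continuous (fun t => - @?f t)} => refine (cont_opp f _ _)
| |- {for _, continuous (fun t => (@?f t)^-1)} => refine (cont_inv f _ _ _)
| |- {for _, continuous (fun t => (@?f t) ^+ ?n)} => refine (cont_exprn f _ n _)
| |- {for _, continuous (fun t => expR (@?f t))} => refine (cont_exp f _ _)
| |- {for _, continuous (fun t => cos (@?f t))} => refine (cont_cos f _ _)
| |- {for _, continuous (fun t => sin (@?f t))} => refine (cont_sin f _ _)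
| |- {for _, continuous (fun t => `|@?f t|)} => refine (cont_norm f _ _)
end.

Ltac cont := cbv beta; repeat (cont_step; cbv beta).

(** * Monotonicity, Gronwall estimates and primitives *)

Section calculus_continued.
Context {R : realType}.
Implicit Types (f g : R -> R) (x a b df dg c : R).

Lemma der_nondecreasing f f' a b : a <= b ->
  (forall x, a <= x <= b -> is_derive x (1:R) f (f' x)) ->
  (forall x, a <= x <= b -> 0 <= f' x) -> f a <= f b.
Proof.
move=> ab hd h0; have [c cab ->] : exists2 c, c \in `[a, b] & f b = f a + f' c * (b - a).
  have [|||c h1 h2] := @MVT_segment _ f f' a b => //.
  - by move=> x; rewrite in_itv /= => /andP[/ltW h1 /ltW h2]; apply: hd; rewrite h1.
  - apply: continuous_in_subspaceT => x; rewrite inE /= in_itv /= => hx.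
    exact: (der_continuous _ _ _ (hd x hx)).
  - by exists c => //; rewrite -h2 addrC subrK.
by rewrite lerDl mulr_ge0 ?subr_ge0// h0//; move: cab; rewrite in_itv.
Qed.

Lemma der_increasing f f' a b : a < b ->
  (forall x, a <= x <= b -> is_derive x (1:R) f (f' x)) ->
  (forall x, a <= x <= b -> 0 < f' x) -> f a < f b.
Proof.
move=> ab hd h0; have [c cab ->] : exists2 c, c \in `[a, b] & f b = f a + f' c * (b - a).
  have [|||c h1 h2] := @MVT_segment _ f f' a b => //.
  - exact: ltW.
  - by move=> x; rewrite in_itv /= => /andP[/ltW h1 /ltW h2]; apply: hd; rewrite h1.
  - apply: continuous_in_subspaceT => x; rewrite inE /= in_itv /= => hx.
    exact: (der_continuous _ _ _ (hd x hx)).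
  - by exists c => //; rewrite -h2 addrC subrK.
by rewrite ltrDl mulr_gt0 ?subr_gt0// h0//; move: cab; rewrite in_itv.
Qed.

Lemma der_nonincreasing f f' a b : a <= b ->
  (forall x, a <= x <= b -> is_derive x (1:R) f (f' x)) ->
  (forall x, a <= x <= b -> f' x <= 0) -> f b <= f a.
Proof.
move=> ab hd h0; rewrite -lerN2.
apply: (der_nondecreasing (fun t => - f t) (fun t => - f' t)) => // x hx.
- exact/der_opp/hd.
- by rewrite oppr_ge0 h0.
Qed.

Lemma der_eq0_cst f a b : a <= b ->
  (forall x, a <= x <= b -> is_derive x (1:R) f 0) -> f a = f b.
Proof.
move=> ab hd; apply/le_anti/andP; split.
  exact: (der_nondecreasing f (fun _ => 0)).
exact: (der_nonincreasing f (fun _ => 0)).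
Qed.

Lemma der_le f g f' g' a b : a <= b ->
  (forall x, a <= x <= b -> is_derive x (1:R) f (f' x)) ->
  (forall x, a <= x <= b -> is_derive x (1:R) g (g' x)) ->
  (forall x, a <= x <= b -> f' x <= g' x) -> f b - f a <= g b - g a.
Proof.
move=> ab hf hg h.
suff: g a + - f a <= g b + - f b by lra.
apply: (der_nondecreasing (fun t => g t + - f t) (fun t => g' t + - f' t)) => // x hx.
  by der; [exact: hg|exact: hf|].
by rewrite subr_ge0 h.
Qed.

(* Squares are used because the absolute value is not differentiable. *)
Lemma gronwall_fwd f f' g g' (L e : R) a b : a <= b -> 0 <= L -> 0 <= e ->
  (forall x, a <= x <= b -> is_derive x (1:R) f (f' x)) ->
  (forall x, a <= x <= b -> is_derive x (1:R) g (g' x)) ->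
  (forall x, a <= x <= b -> 0 <= g' x) ->
  (forall x, a <= x <= b -> `|f' x| <= g' x * (L * `|f x| + e)) ->
  f b ^+ 2 + e ^+ 2 <= (f a ^+ 2 + e ^+ 2) * expR ((2 * L + 1) * (g b - g a)).
Proof.
(* The function [g] serves as a clock: the identity for the scalar equation, the angle along a
   planar orbit. Multiplied by exp(-K g), the energy f^2 + e^2 does not increase. *)
move=> ab L0 e0 hf hg g0 hfg; set K := 2 * L + 1.
pose E t := (f t * f t + e ^+ 2) * expR (- K * g t).
have : E b <= E a.
  apply: (der_nonincreasing E (fun t => (f' t * f t + f t * f' t + 0) * expR (- K * g t)
    + (f t * f t + e ^+ 2) * (expR (- K * g t) * (0 * g t + - K * g' t)))) => //.
    by move=> x hx; rewrite /E; der; [exact: hf|exact: hf|exact: hg|].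
  move=> x hx.
  rewrite (_ : _ + _ = (f' x * f x *+ 2 - K * g' x * (f x ^+ 2 + e ^+ 2)) * expR (- K * g x));
    last by ring.
  rewrite pmulr_lle0 ?expR_gt0// subr_le0.
  apply: (@le_trans _ _ (`|f' x| * `|f x| *+ 2)).
    by rewrite lerMn2r/= -normrM ler_norm.
  apply: (@le_trans _ _ ((g' x * (L * `|f x| + e)) * `|f x| *+ 2)).
    by rewrite lerMn2r/= ler_wpM2r// hfg.
  rewrite (_ : f x ^+ 2 = `|f x| ^+ 2); last by rewrite real_normK// num_real.
  have := g0 x hx; move: (g' x) (normr_ge0 (f x)) => u; move: `|f x| => v v0 u0.
  (* The bracket equals K (v^2 + e^2) - 2 v (L v + e), which explains the choice of [K]. *)
  have : 0 <= u * ((v - e) ^+ 2 + 2 * L * e ^+ 2).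
    by rewrite mulr_ge0// addr_ge0 ?sqr_ge0 ?mulr_ge0 ?sqr_ge0.
  by rewrite /K; move=> h; rewrite -subr_ge0; apply: le_trans h _; rewrite le_eqVlt; apply/orP; left; apply/eqP; ring.
rewrite /E -!expr2 => h.
rewrite (_ : K * (g b - g a) = (- K * g a) + K * g b); last by ring.
rewrite expRD mulrA; apply: (@le_trans _ _ ((f b ^+ 2 + e ^+ 2) * expR (- K * g b) * expR (K * g b))).
  by rewrite -mulrA -expRD mulNr addNr expR0 mulr1.
by rewrite ler_wpM2r ?expR_ge0.
Qed.

(** Time reversal of the forward estimate: the clock becomes -g(-t), which is again
    nondecreasing. *)
Lemma gronwall_bwd f f' g g' (L e : R) a b : a <= b -> 0 <= L -> 0 <= e ->
  (forall x, a <= x <= b -> is_derive x (1:R) f (f' x)) ->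
  (forall x, a <= x <= b -> is_derive x (1:R) g (g' x)) ->
  (forall x, a <= x <= b -> 0 <= g' x) ->
  (forall x, a <= x <= b -> `|f' x| <= g' x * (L * `|f x| + e)) ->
  f a ^+ 2 + e ^+ 2 <= (f b ^+ 2 + e ^+ 2) * expR ((2 * L + 1) * (g b - g a)).
Proof.
move=> ab L0 e0 hf hg g0 hfg.
have hN x : - b <= x <= - a -> a <= - x <= b by lra.
have := @gronwall_fwd (fun t => f (- t)) (fun t => f' (- t) * -1)
  (fun t => - g (- t)) (fun t => - (g' (- t) * -1)) L e (- b) (- a).
rewrite !opprK [- g a + _]addrC; apply => //; first by rewrite lerN2.
- by move=> x /hN hx; apply: der_flip; exact: hf.
- by move=> x /hN hx; apply: der_opp; apply: der_flip; exact: hg.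
- by move=> x /hN hx; rewrite mulrN1 opprK g0.
- by move=> x /hN hx; rewrite !mulrN1 opprK normrN hfg.
Qed.

Let primitive_right f : continuous f -> forall a,
  exists F, forall x, a < x -> is_derive x (1:R) F (f x).
Proof.
move=> cf a; exists (fun x => \int[lebesgue_measure]_(t in `[a, x]) f t) => x ax.
have xu : x < x + 1 by rewrite ltrDl.
have [|h1 h2] := @continuous_FTC1_closed R f a x (x + 1) xu _ ax (cf x).
  apply: continuous_compact_integrable; first exact: segment_compact.
  exact: continuous_subspaceT.
by apply: DeriveDef => //; rewrite -derive1E.
Qed.

(** An integral with fixed lower end is differentiated only to the right of that end. Two such
    primitives, one for f and one for the reflected function -f(-t), are glued at 0; on the overlap
    (-1, 1) they differ by a constant. *)
Lemma primitive f : continuous f ->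
  exists F, F 0 = 0 /\ forall x, is_derive x (1:R) F (f x).
Proof.
move=> cf; have [F hF] := primitive_right f cf (- 1).
have [|G hG] := primitive_right (fun t => - f (- t)) _ (- 1).
  move=> t; apply: continuousN; apply: continuous_comp; last exact: cf.
  exact/continuousN/cvg_id.
pose H x := if 0 <= x then F x - F 0 else G (- x) - G 0.
have hG' x : x < 1 -> is_derive x (1:R) (fun t => G (- t)) (f x).
  move=> x1; have := der_flip G x _ (hG (- x) _).
  by rewrite opprK mulrN1 opprK; apply; rewrite ltrN2.
have FG x : -1 < x < 1 -> F x - F 0 = G (- x) - G 0.
  move=> /andP[x1 x2].
  have h a b : -1 < a -> a <= b -> b < 1 -> F a + - G (- a) = F b + - G (- b).
    move=> a1 ab b1; apply: (der_eq0_cst (fun t => F t + - G (- t))) => // t /andP[t1 t2].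
    by der; [apply: hF; lra|apply: hG'; lra|rewrite subrr].
  have [x0|x0] := leP 0 x.
    by have := h 0 x ltac:(lra) ltac:(lra) ltac:(lra); rewrite oppr0; lra.
  by have := h x 0 ltac:(lra) ltac:(lra) ltac:(lra); rewrite oppr0; lra.
exists H; split; first by rewrite /H lexx subrr.
move=> x; have [x0|x0] := ltP (-1) x.
  apply: (@near_eq_is_derive _ _ _ (fun t => F t + - F 0)).
  - near=> t; rewrite /H; case: ifPn => //; rewrite -ltNge => t0; apply: FG.
    apply/andP; split; last lra.
    near: t; exact: lt_nbhsr.
  - by der; [exact: hF|rewrite addr0].
apply: (@near_eq_is_derive _ _ _ (fun t => G (- t) + - G 0)).
- near=> t; rewrite /H ifN// -ltNge.
  by near: t; apply: lt_nbhsl; lra.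
- by der; [apply: hG'; lra|rewrite addr0].
Unshelve. all: by end_near. Qed.

Lemma itv_clampP a b x : a <= b -> a <= Num.max a (Num.min b x) <= b.
Proof. by move=> ab; rewrite le_max lexx/= ge_max ab ge_min lexx. Qed.

Lemma itv_clamp_id a b x : a <= x <= b -> Num.max a (Num.min b x) = x.
Proof. by move=> /andP[ax xb]; rewrite (min_idPr xb) (max_idPr ax). Qed.

Lemma itv_clamp_continuous a b : continuous (fun x => Num.max a (Num.min b x)).
Proof.
move=> x; apply: (@continuous_max _ _ (fun=> a) (fun t => Num.min b t)); first exact: cvg_cst.
by apply: (@continuous_min _ _ (fun=> b) id); [exact: cvg_cst|exact: cvg_id].
Qed.

(** Composing with the clamp onto [a, b] makes f continuous everywhere and leaves it unchanged on
    the interval. The angular speed of a curve needs this: it is continuous only away from the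
    origin. *)
Lemma primitive_itv f a b : a <= b ->
  (forall x, a <= x <= b -> {for x, continuous f}) ->
  exists F, forall x, a <= x <= b -> is_derive x (1:R) F (f x).
Proof.
move=> ab cf.
have [|F [_ hF]] := primitive (fun x => f (Num.max a (Num.min b x))).
  move=> x; apply: continuous_comp; first exact: itv_clamp_continuous.
  exact/cf/itv_clampP.
by exists F => x hx; have := hF x; rewrite itv_clamp_id.
Qed.

Lemma Rintegral_FTC f F a b : a < b -> continuous f ->
  (forall x, is_derive x (1:R) F (f x)) ->
  \int[lebesgue_measure]_(t in `[a, b]) f t = F b - F a.
Proof.
move=> ab cf hF; rewrite /Rintegral (@continuous_FTC2 _ f F)//.
- exact: continuous_subspaceT.
- split.
  + by move=> x _; case: (hF x).
  + by apply: cvg_at_right_filter; exact: der_continuous (hF a).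
  + by apply: cvg_at_left_filter; exact: der_continuous (hF b).
- by move=> x _; rewrite derive1E; apply: derive_val.
Qed.

Lemma IVT_le f a b v : a <= b -> (forall x, a <= x <= b -> {for x, continuous f}) ->
  f a <= v <= f b -> exists2 c, a <= c <= b & f c = v.
Proof.
move=> ab cf hv; have [||c hc <-] := @IVT _ f a b v ab.
- by apply: continuous_in_subspaceT => x; rewrite inE/= in_itv/= => /cf.
- case/andP: hv => h1 h2; have h3 := le_trans h1 h2.
  by rewrite (min_idPl h3) (max_idPr h3) h1.
- by exists c => //; move: hc; rewrite in_itv.
Qed.

Lemma IVT_ge f a b v : a <= b -> (forall x, a <= x <= b -> {for x, continuous f}) ->
  f b <= v <= f a -> exists2 c, a <= c <= b & f c = v.
Proof.
move=> ab cf hv; have [||c hc <-] := @IVT _ f a b v ab.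
- by apply: continuous_in_subspaceT => x; rewrite inE/= in_itv/= => /cf.
- case/andP: hv => h1 h2; have h3 := le_trans h1 h2.
  by rewrite (min_idPr h3) (max_idPl h3) h1.
- by exists c => //; move: hc; rewrite in_itv.
Qed.

Lemma bounded_on_itv f a b : a <= b ->
  (forall x, a <= x <= b -> {for x, continuous f}) ->
  exists2 M, 0 < M & forall x, a <= x <= b -> `|f x| <= M.
Proof.
move=> ab cf.
have cn : {within `[a, b], continuous (fun x => `|f x|)}.
  apply: continuous_in_subspaceT => x; rewrite inE/= in_itv/= => hx.
  exact: (continuous_comp (cf x hx) (@norm_continuous _ R^o (f x))).
have [c hc hM] := EVT_max ab cn.
exists (`|f c| + 1); first by rewrite ltr_wpDl.
by move=> x hx; apply: le_trans (hM x _) _; rewrite ?in_itv//= lerDl.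
Qed.

End calculus_continued.

(** * Scalar differential equations *)

Section sequences.
Context {R : realType}.

(** Replaces passage to the limit in the estimates below. *)
Lemma le_of_geometric (x y z : R) : (forall k, x <= y + z / 2 ^+ k) -> x <= y.
Proof.
move=> h; apply/ler_addgt0Pr => e e0.
have [z0|z0] := leP z 0.
  by apply: le_trans (h 0%N) _; rewrite expr0 divr1; lra.
have [k hk] : exists k, z / e < 2 ^+ k :> R.
  exists (Num.bound `|z / e|); apply: le_lt_trans (ler_norm _) _.
  apply: lt_le_trans (archi_boundP (normr_ge0 _)) _.
  by rewrite -natrX ler_nat; apply: ltnW; exact: ltn_expl.
apply: le_trans (h k) _; rewrite lerD2l ler_pdivrMr ?exprn_gt0//.
by rewrite -ler_pdivrMl// mulrC ltW.
Qed.

(** The intervals of radius 2 B / 2^k around u_k are nested; the supremum of their left ends lies in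
    all of them, which also gives the rate. *)
Lemma geometric_cauchy (u : nat -> R) (B : R) :
  (forall k, `|u k.+1 - u k| <= B / 2 ^+ k) ->
  exists l, forall k, `|l - u k| <= 2 * B / 2 ^+ k.
Proof.
move=> h.
pose a k := u k - 2 * B / 2 ^+ k; pose b k := u k + 2 * B / 2 ^+ k.
have hs k : 2 * B / 2 ^+ k.+1 = B / 2 ^+ k :> R.
  by rewrite exprS invfM mulrACA divff ?mul1r.
have aS k : a k <= a k.+1.
  by rewrite /a hs; have := h k; rewrite ler_norml => /andP[]; lra.
have bS k : b k.+1 <= b k.
  by rewrite /b hs; have := h k; rewrite ler_norml => /andP[]; lra.
have B0 : 0 <= B by have := h 0%N; rewrite expr0 divr1; apply: le_trans.
have ab k : a k <= b k.
  have : 0 <= 2 * B / 2 ^+ k by rewrite !mulr_ge0// invr_ge0 exprn_ge0.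
  by rewrite /a /b; lra.
have aD i j : a i <= a (i + j)%N.
  by elim: j => [|j ih]; rewrite ?addn0// addnS (le_trans ih).
have bD i j : b (i + j)%N <= b i.
  by elim: j => [|j ih]; rewrite ?addn0// addnS (le_trans _ ih).
have abij i j : a i <= b j.
  by apply: le_trans (aD i j) _; apply: le_trans (ab _) _; rewrite addnC.
exists (sup (range a)) => k; rewrite ler_distl; apply/andP; split.
  by apply: ub_le_sup; [exists (b 0%N) => _ [i _ <-]; exact: abij|exists k].
by apply: ge_sup; [exists (a 0%N), 0%N|move=> _ [i _ <-]; exact: abij].
Qed.

Lemma lipschitz_continuous (f : R -> R) (M : R) :
  (forall s t, `|f s - f t| <= M * `|s - t|) -> continuous f.
Proof.
move=> h t; apply/cvgrPdist_le => e e0.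
have M1 : 0 < `|M| + 1 by rewrite ltr_wpDl.
near=> s; apply: le_trans (h _ _) _.
apply: (@le_trans _ _ ((`|M| + 1) * `|t - s|)).
  by rewrite ler_wpM2r// (le_trans (ler_norm _))// lerDl.
rewrite -ler_pdivlMl//; near: s; apply/nbhs_ballP.
exists ((`|M| + 1)^-1 * e) => [|s /ltW//].
by rewrite /= mulr_gt0// invr_gt0.
Unshelve. all: by end_near. Qed.

(** Integration gains a factor 1/A in the norm weighted by exp(A |t|). With A = 2 L this makes the
    Picard map contract by 1/2 on the whole line. *)
Lemma der_exp_bound (f f' : R -> R) (A K : R) : 0 <= K -> f 0 = 0 ->
  (forall t, is_derive t (1:R) f (f' t)) ->
  (forall t, `|f' t| <= A * K * expR (A * `|t|)) ->
  forall t, `|f t| <= K * expR (A * `|t|).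
Proof.
move=> K0.
have pos (g g' : R -> R) : g 0 = 0 -> (forall t, is_derive t (1:R) g (g' t)) ->
    (forall t, `|g' t| <= A * K * expR (A * `|t|)) ->
    forall t, 0 <= t -> `|g t| <= K * expR (A * `|t|).
  move=> g0 hg h t t0.
  have hE x : 0 <= x <= t ->
      is_derive x (1:R) (fun s => K * expR (A * s)) (A * K * expR (A * x)).
    by move=> _; der; ring.
  have hN x : 0 <= x <= t -> - (A * K * expR (A * x)) <= g' x <= A * K * expR (A * x).
    by move=> /andP[x0 _]; have := h x; rewrite (ger0_norm x0) ler_norml.
  have h1 := der_le _ _ _ _ _ _ t0 (fun x _ => hg x) hE (fun x hx => proj2 (andP (hN x hx))).
  have h2 : - g t - - g 0 <= K * expR (A * t) - K * expR (A * 0).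
    apply: (der_le (fun s => - g s) _ (fun s => - g' s) _ _ _ t0 _ hE) => x hx.
    by case/andP: (hN x hx) => hx1 _; rewrite lerNl.
  have := K0; rewrite mulr0 expR0 g0 in h1 h2 => ?.
  by rewrite (ger0_norm t0) ler_norml; apply/andP; split; lra.
move=> f0 hf h t; have [t0|t0] := leP 0 t; first exact: pos hf _ _ _.
have hfl s : is_derive s (1:R) (fun s => f (- s)) (f' (- s) * -1).
  by apply: der_flip; exact: hf.
have := pos (fun s => f (- s)) _ _ hfl _ (- t).
rewrite opprK normrN oppr0; apply => //; last by lra.
by move=> s; rewrite mulrN1 normrN -(normrN s).
Qed.

End sequences.

Definition ode_sol {R : realType} (F : R -> R -> R) (W : R -> R) :=
  forall t, is_derive t (1:R) W (F t (W t)).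

Section ode.
Context {R : realType}.
Variables (F : R -> R -> R) (M L : R).
Hypothesis L0 : 0 < L.
Hypothesis FM : forall t w, `|F t w| <= M.
Hypothesis FL : forall t w v, `|F t w - F t v| <= L * `|w - v|.
(** Continuity is required along continuous curves, the form in which the Picard map uses it. *)
Hypothesis Fc : forall w : R -> R, continuous w -> continuous (fun t => F t (w t)).

Lemma ode_sol_continuous W : ode_sol F W -> continuous W.
Proof. by move=> h t; exact: der_continuous (h t). Qed.

Lemma der_lipschitz (f f' : R -> R) : (forall t, is_derive t (1:R) f (f' t)) ->
  (forall t, `|f' t| <= M) -> forall s t, `|f s - f t| <= M * `|s - t|.
Proof.
move=> hf hM s t; wlog st : s t / s <= t => [H|].
  by have [/H//|/ltW/H] := leP s t; rewrite distrC [`|t - s|]distrC.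
have hg (A x : R) : is_derive x (1:R) (fun y => A * y) A by der; ring.
have h1 := der_le _ _ _ _ _ _ st (fun x _ => hf x) (fun x _ => hg M x)
  (fun x _ => le_trans (ler_norm _) (hM x)).
have h2 : - M * t - - M * s <= f t - f s.
  apply: (der_le _ _ _ _ _ _ st (fun x _ => hg (- M) x) (fun x _ => hf x)) => x _.
  by have := hM x; rewrite ler_norml => /andP[].
rewrite distrC [`|s - t|]distrC (@ger0_norm _ (t - s)) ?subr_ge0// ler_norml.
by apply/andP; split; lra.
Qed.

Lemma picard c : exists W, W 0 = c /\ ode_sol F W.
Proof.
(* [P] is the Picard map, with an irrelevant value at discontinuous functions. *)
have /choice[P hP] : forall w : R -> R, exists w' : R -> R, continuous w ->
    w' 0 = c /\ forall t, is_derive t (1:R) w' (F t (w t)).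
  move=> w; have [cw|ncw] := pselect (continuous w); last by exists w.
  have [G [G0 hG]] := primitive _ (Fc w cw).
  exists (fun t => G t + c) => _; split; first by rewrite G0 add0r.
  by move=> t; der; [exact: hG|rewrite addr0].
pose u k := iter k P (fun=> c).
have uc k : continuous (u k).
  elim: k => [t|k ih]; first exact: cvg_cst.
  by move=> t; have [_ /(_ t)/der_continuous] := hP _ ih.
have u0 k : u k 0 = c by case: k => [//|k]; exact: (hP _ (uc k)).1.
have du k t : is_derive t (1:R) (u k.+1) (F t (u k t)) by exact: (hP _ (uc k)).2.
have M0 : 0 <= M := le_trans (normr_ge0 _) (FM 0 0).
(* Since 2 L C = M, the first step is at most C exp(2 L |t|); every later bound is half the one
   before. *)
pose C := M / (2 * L).
have C0 : 0 <= C by rewrite /C divr_ge0// mulr_ge0// ltW.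
have CL : 2 * L * C = M by rewrite /C mulrC divfK// mulf_neq0// gt_eqF.
have step k t : `|u k.+1 t - u k t| <= C / 2 ^+ k * expR (2 * L * `|t|).
  elim: k t => [|k ih].
    apply: (@der_exp_bound _ (fun s => u 1%N s + - u 0%N s) (fun t => F t c + - 0)) => //.
    - by rewrite expr0 divr1.
    - by rewrite !u0 subrr.
    - move=> t; rewrite subr0 expr0 divr1 CL; apply: le_trans (FM _ _) _.
      by rewrite ler_peMr// -expR0 ler_expR !mulr_ge0// ltW.
  apply: (@der_exp_bound _ (fun s => u k.+2 s + - u k.+1 s) (fun t => F t (u k.+1 t) + - F t (u k t))) => //.
  - by rewrite divr_ge0// exprn_ge0.
  - by rewrite !u0 subrr.
  - move=> t; apply: le_trans (FL _ _ _) _.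
    rewrite (_ : 2 * L * (C / 2 ^+ k.+1) = L * (C / 2 ^+ k)); last first.
      by rewrite exprS; field; rewrite expf_neq0.
    by rewrite -[X in _ <= X]mulrA ler_wpM2l ?ih// ltW.
have /choice[W hW] : forall t, exists l, forall k,
    `|l - u k t| <= 2 * (C * expR (2 * L * `|t|)) / 2 ^+ k.
  move=> t; apply: (geometric_cauchy (fun k => u k t)) => k.
  by rewrite mulrAC.
(* All iterates are Lipschitz with constant M, hence so is the limit, and [P] may be applied to
   it. *)
have Wc : continuous W.
  apply: (@lipschitz_continuous _ _ M) => s t.
  pose Z := 2 * (C * expR (2 * L * `|s|)) + 2 * (C * expR (2 * L * `|t|)).
  apply: (@le_of_geometric _ _ _ Z) => k.
  have uM : `|u k s - u k t| <= M * `|s - t|.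
    case: k => [|k]; last by apply: der_lipschitz (du k) _ _ _.
    by rewrite /= subrr normr0 mulr_ge0.
  rewrite (_ : W s - W t = (W s - u k s) + (u k s - u k t) - (W t - u k t)); last by ring.
  apply: le_trans (ler_normB _ _) _.
  have := ler_normD (W s - u k s) (u k s - u k t).
  by have := hW s k; have := hW t k; rewrite /Z mulrDl; lra.
have [V0 dV] := hP _ Wc.
suff E : W = P W by exists W; split=> [|t]; rewrite {1}E//; exact: dV.
apply/funext => t; apply/eqP; rewrite -subr_eq0 -normr_le0.
apply: (@le_of_geometric _ _ _ (2 * (C * expR (2 * L * `|t|)))) => k; rewrite add0r.
have h1 := hW t k.+1.
have h2 : `|P W t - u k.+1 t| <= C / 2 ^+ k * expR (2 * L * `|t|).
  apply: (@der_exp_bound _ (fun s => P W s + - u k.+1 s) (fun t => F t (W t) + - F t (u k t))) => //.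
  - by rewrite divr_ge0// exprn_ge0.
  - by rewrite V0 u0 subrr.
  - move=> s; apply: le_trans (FL _ _ _) _.
    rewrite (_ : 2 * L * _ * _ = L * (2 * (C * expR (2 * L * `|s|)) / 2 ^+ k)); last by ring.
    by rewrite ler_pM2l//; exact: hW.
rewrite (_ : W t - P W t = (W t - u k.+1 t) - (P W t - u k.+1 t)); last by ring.
apply: le_trans (ler_normB _ _) _; apply: le_trans (lerD h1 h2) _.
rewrite exprS le_eqVlt; apply/orP; left; apply/eqP; field.
by rewrite expf_neq0.
Qed.

Lemma ode_gronwall W V s t : ode_sol F W -> ode_sol F V ->
  (W s - V s) ^+ 2 <= (W t - V t) ^+ 2 * expR ((2 * L + 1) * `|s - t|).
Proof.
move=> hW hV.
have hD x : is_derive x (1:R) (fun y => W y + - V y) (F x (W x) + - F x (V x)).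
  by der; [exact: hW|exact: hV|].
have hb x : `|F x (W x) + - F x (V x)| <= 1 * (L * `|W x + - V x| + 0).
  by rewrite mul1r addr0; exact: FL.
have [st|st] := leP s t.
  have := @gronwall_bwd _ _ _ (fun y => y) (fun=> 1) L 0 s t st (ltW L0) (lexx 0)
    (fun x _ => hD x) (fun x _ => der_id x) (fun _ _ => ler01) (fun x _ => hb x).
  by rewrite expr0n !addr0 distrC ger0_norm// subr_ge0.
have := @gronwall_fwd _ _ _ (fun y => y) (fun=> 1) L 0 t s (ltW st) (ltW L0) (lexx 0)
  (fun x _ => hD x) (fun x _ => der_id x) (fun _ _ => ler01) (fun x _ => hb x).
by rewrite expr0n !addr0 ger0_norm// subr_ge0 ltW.
Qed.

Lemma ode_unique W V t : ode_sol F W -> ode_sol F V -> W t = V t -> W = V.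
Proof.
move=> hW hV e; apply/funext => s.
have := ode_gronwall W V s t hW hV; rewrite e subrr expr0n mul0r => h.
by apply/eqP; rewrite -subr_eq0 -sqrf_eq0 eq_le h sqr_ge0.
Qed.

(** A change of order would produce a common value, and uniqueness would then identify the two
    solutions. *)
Lemma ode_lt W V s t : ode_sol F W -> ode_sol F V -> W s < V s -> W t < V t.
Proof.
move=> hW hV h; rewrite ltNge; apply/negP => h'.
have cD x : {for x, continuous (fun y => V y + - W y)}.
  by apply: continuousD; [|apply: continuousN]; apply: ode_sol_continuous.
suff [c e] : exists c, V c + - W c = 0.
  have VW : V c = W c by lra.
  by move: h; rewrite (ode_unique V W c hV hW VW) ltxx.
have [st|/ltW st] := leP s t.
  have [|c _ hc] := @IVT_ge _ (fun y => V y + - W y) s t 0 st (fun x _ => cD x).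
    by apply/andP; split; lra.
  by exists c.
have [|c _ hc] := @IVT_le _ (fun y => V y + - W y) t s 0 st (fun x _ => cD x).
  by apply/andP; split; lra.
by exists c.
Qed.

Section periodic.
Variable T : R.
Hypothesis FT : forall t w, F (t + T) w = F t w.

Lemma ode_sol_shift W : ode_sol F W -> ode_sol F (fun t => W (t + T)).
Proof. by move=> hW t; have := der_shift W t T _ (hW (t + T)); rewrite FT. Qed.

(** The translate by a period is again a solution, so the comparison at time 0 decides the one at
    all times. *)
Lemma ode_trichotomy W : ode_sol F W ->
  [\/ forall t, W t < W (t + T), forall t, W (t + T) = W t |
      forall t, W (t + T) < W t].
Proof.
move=> hW; have hV := ode_sol_shift W hW.
have [h|h|h] := ltgtP (W 0) (W (0 + T)).
- by constructor 1 => t; exact: (ode_lt _ _ _ _ hW hV h).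
- by constructor 3 => t; exact: (ode_lt _ _ _ _ hV hW h).
- constructor 2 => t.
  by have /(congr1 (fun f => f t)) := ode_unique _ _ _ hW hV h.
Qed.

(** The return map of a scalar equation is increasing, so a value that returns after k periods
    returns after one. This handles closed orbits that might wind k times. *)
Lemma ode_periodic_of_iter W t (k : nat) : ode_sol F W -> (0 < k)%N ->
  W (t + k%:R * T) = W t -> forall s, W (s + T) = W s.
Proof.
move=> hW; case: k => // k _ h.
have iterT j : t + j.+1%:R * T = t + j%:R * T + T by rewrite -natr1; ring.
case: (ode_trichotomy W hW) => // hlt.
- have H j : W t < W (t + j.+1%:R * T).
    elim: j => [|j ih]; first by rewrite mul1r.
    by apply: lt_trans ih _; rewrite [X in _ < W X]iterT.
  by have := H k; rewrite h ltxx.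
- have H j : W (t + j.+1%:R * T) < W t.
    elim: j => [|j ih]; first by rewrite mul1r.
    by apply: lt_trans _ ih; rewrite [X in W X < _]iterT.
  by have := H k; rewrite h ltxx.
Qed.

(** Translation by a period raises W in at least one direction of time, so in that direction the
    minimum over a compact window is a lower bound. A lower bound on W is a positive distance from
    the origin in the plane. *)
Lemma ode_semibounded W t0 : 0 < T -> ode_sol F W -> exists c,
  (forall t, t0 <= t -> c <= W t) \/ (forall t, t <= t0 -> c <= W t).
Proof.
move=> T0 hW; have cW := ode_sol_continuous W hW.
have itT (t : R) (j : nat) : t + j.+1%:R * T = t + j%:R * T + T by rewrite -natr1; ring.
have [M0 _ hM] : exists2 M0, 0 < M0 & forall x, t0 - T <= x <= t0 + T -> `|W x| <= M0.
  by apply: bounded_on_itv => [|x _]; [lra|exact: cW].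
have hM' x : t0 - T <= x <= t0 + T -> - M0 <= W x.
  by move=> /hM; rewrite ler_norml => /andP[].
have fl x : 0 <= x -> exists j : nat, j%:R * T <= x < j%:R * T + T.
  move=> x0; exists (Num.truncn (x / T)).
  have := @truncn_itv _ (x / T) (divr_ge0 x0 (ltW T0)).
  by rewrite ler_pdivlMr// ltr_pdivrMr// -natr1 mulrDl mul1r.
exists (- M0); case: (ode_trichotomy W hW) => hT.
- left => t tt; have [j /andP[j1 j2]] := fl (t - t0) ltac:(lra).
  have H i s : W s <= W (s + i%:R * T).
    elim: i => [|i ih]; first by rewrite mul0r addr0.
    by rewrite itT; apply: le_trans ih (ltW (hT _)).
  by have := H j (t - j%:R * T); rewrite subrK; apply: le_trans; apply: hM'; apply/andP; split; lra.
- left => t tt; have [j /andP[j1 j2]] := fl (t - t0) ltac:(lra).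
  have H i s : W s <= W (s + i%:R * T).
    elim: i => [|i ih]; first by rewrite mul0r addr0.
    by rewrite itT hT.
  by have := H j (t - j%:R * T); rewrite subrK; apply: le_trans; apply: hM'; apply/andP; split; lra.
- right => t tt; have [j /andP[j1 j2]] := fl (t0 - t) ltac:(lra).
  have H i s : W (s + i%:R * T) <= W s.
    elim: i => [|i ih]; first by rewrite mul0r addr0.
    by rewrite itT; apply: le_trans (ltW (hT _)) ih.
  apply: le_trans (H j t); apply: hM'; apply/andP; split; lra.
Qed.

End periodic.

End ode.

Lemma picard_at {R : realType} (F : R -> R -> R) (M L : R) : 0 < L ->
  (forall t w, `|F t w| <= M) ->
  (forall t w v, `|F t w - F t v| <= L * `|w - v|) ->
  (forall w : R -> R, continuous w -> continuous (fun t => F t (w t))) ->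
  forall t0 c, exists W, W t0 = c /\ ode_sol F W.
Proof.
move=> L0 FM FL Fc t0 c.
have sc (a : R) : continuous (fun t : R => t + a).
  by move=> t; apply: continuousD; [exact: cvg_id|exact: cvg_cst].
have Fc' (w : R -> R) : continuous w -> continuous (fun t => F (t + t0) (w t)).
  move=> cw t.
  have cw' : continuous (fun s => w (s - t0)).
    by move=> s; apply: continuous_comp; [exact: sc|exact: cw].
  rewrite (_ : (fun t => F (t + t0) (w t)) =
    (fun s => F s (w (s - t0))) \o (fun s => s + t0)).
    exact: continuous_comp (sc t0 t) (Fc _ cw' (t + t0)).
  by apply/funext => s; rewrite /= addrK.
have [W [W0 hW]] := @picard R (fun t => F (t + t0)) M L L0
  (fun t => FM (t + t0)) (fun t => FL (t + t0)) Fc' c.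
exists (fun t => W (t - t0)); split; first by rewrite subrr.
by move=> t; have := der_shift W t (- t0) _ (hW _); rewrite subrK.
Qed.

(** * Isolated zeros of analytic functions given by power series *)

Section analytic.
Context {R : realType}.

Lemma horner_continuous (p : {poly R}) : continuous (horner p).
Proof. by move=> x; exact: der_continuous (is_derive_poly p x). Qed.

Lemma sum_continuous n (f : nat -> R -> R) :
  (forall i, (i < n)%N -> continuous (f i)) ->
  continuous (fun t => \sum_(i < n) f i t).
Proof.
elim: n => [|n ih] hf t.
  rewrite (_ : (fun t => _) = fun=> 0); first exact: cvg_cst.
  by apply/funext => s; rewrite big_ord0.
rewrite (_ : (fun t => _) = fun t => \sum_(i < n) f i t + f n t).
  apply: continuousD; last exact: hf.
  by apply: ih => i iN; apply: hf; exact: ltnW.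
by apply/funext => s; rewrite big_ord_recr.
Qed.

Lemma der_sum n (f : nat -> R -> R) (df : nat -> R) x :
  (forall i, (i < n)%N -> is_derive x (1:R) (f i) (df i)) ->
  is_derive x (1:R) (fun t => \sum_(i < n) f i t) (\sum_(i < n) df i).
Proof.
elim: n => [|n ih] hf.
  rewrite big_ord0 (_ : (fun t => _) = fun=> 0); first exact: der_cst.
  by apply/funext => s; rewrite big_ord0.
rewrite big_ord_recr/= (_ : (fun t => _) = fun t => \sum_(i < n) f i t + f n t).
  by der; [apply: ih => i iN; apply: hf; exact: ltnW|exact: hf|].
by apply/funext => s; rewrite big_ord_recr.
Qed.

(** If some approximating polynomial is nonzero, its lowest term dominates the remainder near 0. If
    all of them vanish, f is smaller than every term of a null sequence. *)
Lemma analytic_zero_dichotomy (f : R -> R) (e0 C K : R) : 0 < e0 -> 0 < C -> 0 < K ->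
  (forall N, exists p : {poly R}, (size p <= N.+1)%N /\
     forall e, `|e| <= e0 -> `|f e - p.[e]| <= C * (K * `|e|) ^+ N.+1) ->
  (exists2 d, 0 < d & forall e, 0 < `|e| < d -> f e != 0) \/
  (exists2 d, 0 < d & forall e, `|e| < d -> f e = 0).
Proof.
move=> e00 C0 K0 H.
have [[N [p [p0 sp hp]]]|allz] := pselect (exists N, exists p : {poly R},
    [/\ p != 0, (size p <= N.+1)%N &
     forall e, `|e| <= e0 -> `|f e - p.[e]| <= C * (K * `|e|) ^+ N.+1]).
- left; have [j [q + pE]] := multiplicity_XsubC p 0; rewrite p0 /= => q0.
  have q00 : 0 < `|q.[0]| by rewrite normr_gt0.
  have qn0 : q != 0 by apply: contraNneq q0 => ->; rewrite root0.
  (* The order of vanishing is at most the degree, so the remainder, of order N + 1, is smaller than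
     the lowest term. *)
  have jN : (j <= N)%N.
    move: sp; rewrite pE size_Mmonic ?monicXn ?monic_exp ?monicXsubC// size_exp_XsubC.
    have : (0 < size q)%N by rewrite size_poly_gt0.
    move: (size q) => [//|r] _; rewrite addnS/= ltnS => rj; exact: leq_trans (leq_addl r j) rj.
  have /cvgrPdist_lt/(_ (`|q.[0]| / 2)) := horner_continuous q 0.
  rewrite divr_gt0// => /(_ isT)/nbhs_ballP[d /= d0 hd].
  pose A := C * K ^+ N.+1; have A0 : 0 < A by rewrite mulr_gt0// exprn_gt0.
  (* Below [d] the cofactor exceeds |q(0)| / 2; the bound 1 reduces |e|^(N+1-j) to |e|, and the last
     bound makes A |e| less than |q(0)| / 2. *)
  pose d' := Num.min (Num.min d e0) (Num.min 1 (`|q.[0]| / 2 / A)).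
  have d'0 : 0 < d' by rewrite /d' !lt_min d0 e00 ltr01/= !divr_gt0.
  exists d' => // e /andP[en0]; rewrite /d' !lt_min => /andP[/andP[h1 h2] /andP[h3 h4]].
  apply/negP => /eqP fe0.
  have := hp e (ltW h2); rewrite fe0 sub0r normrN pE hornerM horner_exp hornerXsubC subr0.
  rewrite normrM normrX exprMn mulrA -/A.
  have hq : `|q.[0]| / 2 < `|q.[e]|.
    have /hd/= : ball 0 d e by rewrite /ball/= sub0r normrN.
    by have := ler_distD q.[e] q.[0] 0; rewrite !subr0; lra.
  apply/negP; rewrite -ltNge.
  have -> : N.+1 = (j + (N - j).+1)%N by rewrite addnS subnKC.
  rewrite exprD mulrCA [ltRHS]mulrC ltr_pM2l ?exprn_gt0//.
  apply: le_lt_trans hq; move: h4; rewrite ltr_pdivlMr// => /ltW; apply: le_trans.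
  rewrite mulrC ler_pM2r// exprS ler_piMr//.
  by rewrite exprn_ile1// ltW.
- right; pose d := Num.min e0 (2^-1 / K).
  exists d => [|e]; first by rewrite lt_min e00 divr_gt0// invr_gt0.
  rewrite lt_min => /andP[h1 h2].
  apply/eqP; rewrite -normr_le0; apply: (@le_of_geometric _ _ _ C) => k; rewrite add0r.
  have [p [sp hp]] := H k.
  have [p0|pn0] := eqVneq p 0; last by exfalso; apply: allz; exists k, p.
  have := hp e (ltW h1); rewrite p0 horner0 subr0 => /le_trans; apply.
  rewrite ler_pM2l// -exprVn.
  have h3 : K * `|e| <= 2^-1 by move: h2; rewrite ltr_pdivlMr// mulrC => /ltW.
  apply: (@le_trans _ _ (2^-1 ^+ k.+1)); first by apply: lerXn2r; rewrite ?nnegrE ?invr_ge0 ?mulr_ge0 ?(ltW K0).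
  by rewrite exprS ler_piMl ?exprn_ge0 ?invr_ge0// invf_le1 ?ler1n.
Qed.

(** Summable weights whose convolution square is bounded by a multiple of the weight itself.
    Together with D^k they majorise the coefficients, so that a quadratic recurrence closes up. *)
Definition sqweight (k : nat) : R := (k.+1%:R ^+ 2)^-1.

Lemma sqweight_ge0 k : 0 <= sqweight k.
Proof. by rewrite invr_ge0 exprn_ge0. Qed.

Lemma sqweight_sum n : \sum_(i < n) sqweight i <= 2.
Proof.
(* The subtracted term makes the bound telescope: 1/(x+1)^2 is at most 1/x - 1/(x+1). *)
suff H : \sum_(i < n.+1) sqweight i <= 2 - n.+1%:R^-1.
  rewrite big_ord_recr/= in H; have := sqweight_ge0 n.
  have h2 : 0 <= n.+1%:R^-1 :> R by rewrite invr_ge0.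
  by move: H h2; set s := \sum_(i < n) _; set u := _^-1; move: s u (sqweight n) => s u w H h2 w0; lra.
elim: n => [|n ih]; first by rewrite big_ord_recl big_ord0 /sqweight expr1n; lra.
rewrite big_ord_recr/=; apply: le_trans (lerD ih (lexx _)) _.
rewrite /sqweight -[n.+2%:R]natr1; have : 0 < n.+1%:R :> R by [].
move: (n.+1%:R : R) => x x0; rewrite -subr_ge0.
rewrite (_ : _ - _ = (x * (x + 1) ^+ 2)^-1); first by rewrite invr_ge0 mulr_ge0 ?exprn_ge0; lra.
by field; apply/andP; split; lra.
Qed.

(* From 1/(uv) = (1/u + 1/v)/(u + v) with u = i+1, v = j+1, u + v = k+2. *)
Lemma sqweight_conv k : \sum_(i < k.+1) sqweight i * sqweight (k - i) <= 8 * sqweight k.+1.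
Proof.
(* The square of 1/u + 1/v is at most twice the sum of the squares. Each of the two resulting sums
   is at most 2, whence 8 = 2 * 4. *)
apply: (@le_trans _ _ (\sum_(i < k.+1) 2 * sqweight k.+1 * (sqweight i + sqweight (k - i)))).
  apply: ler_sum => i _; rewrite /sqweight.
  have ik : (i <= k)%N by rewrite -ltnS.
  have -> : k.+2%:R = i.+1%:R + (k - i).+1%:R :> R by rewrite -natrD; congr (_%:R); rewrite addSn addnS subnKC.
  have : 0 < i.+1%:R :> R by []; have : 0 < (k - i).+1%:R :> R by [].
  move: (i.+1%:R : R) ((k - i).+1%:R : R) => u v v0 u0; rewrite -subr_ge0.
  rewrite (_ : _ - _ = ((u - v) / (u * v * (u + v))) ^+ 2); first exact: sqr_ge0.
  by field; apply/and3P; split; lra.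
rewrite -mulr_sumr big_split/= (reindex_inj rev_ord_inj)/=.
rewrite (eq_bigr (fun i : 'I_k.+1 => sqweight (k - i))); last by move=> i _; rewrite subSS.
have h := sqweight_sum k.+1.
have h2 : \sum_(i < k.+1) sqweight (k - i) <= 2.
  by rewrite (reindex_inj rev_ord_inj)/= (eq_bigr (fun i : 'I_k.+1 => sqweight i))// => i _; rewrite subSS subKn// -ltnS.
rewrite (_ : 8 = 2 * 4 :> R); last by ring.
rewrite -mulrA -[leRHS]mulrA ler_pM2l// mulrC ler_wpM2r ?sqweight_ge0//.
by apply: le_trans (lerD h2 h2) _; lra.
Qed.

(** * Expansion of a scalar equation in powers of a parameter *)

Variables (h k : R -> R) (B T : R).
Hypotheses (hc : continuous h) (kc : continuous k) (B0 : 0 < B) (T0 : 0 < T).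
Hypothesis hB : forall t, 0 <= t <= T -> `|h t| <= B.
Hypothesis kB : forall t, 0 <= t <= T -> `|k t| <= B.

(** Chosen so that D^(N+1) = 16 B D^N (1 + T): the summand 1 covers the derivative of the next
    coefficient, the summand T its primitive on [0, T]. *)
Let D := 16 * B * (1 + T).

Let D0 : 0 < D. Proof. by rewrite mulr_gt0 ?mulr_gt0 ?addr_gt0. Qed.

(** The two products contribute 2 B and the convolution of the weights contributes 8. *)
Lemma series_coef_bound (a b : nat -> R) n (u v : R) : `|u| <= B -> `|v| <= B ->
  (forall i, (i <= n)%N -> `|a i| <= D ^+ i * sqweight i) ->
  (forall i, (i <= n)%N -> `|b i| <= D ^+ i * sqweight i) ->
  `|\sum_(i < n.+1) (u * a i * a (n - i)%N - v * a i * b (n - i)%N)|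
    <= 16 * B * D ^+ n * sqweight n.+1.
Proof.
move=> uB vB ha hb; apply: le_trans (ler_norm_sum _ _ _) _.
apply: (@le_trans _ _ (\sum_(i < n.+1) 2 * B * D ^+ n * (sqweight i * sqweight (n - i)))); last first.
  rewrite -mulr_sumr; have := sqweight_conv n.
  have H : 0 < 2 * B * D ^+ n by rewrite !mulr_gt0// exprn_gt0.
  by rewrite -(ler_pM2l H) => /le_trans; apply; rewrite le_eqVlt; apply/orP; left; apply/eqP; ring.
apply: ler_sum => i _; have ik : (i <= n)%N by rewrite -ltnS.
have h1 := ha i ik; have h2 := ha _ (leq_subr i n); have h3 := hb _ (leq_subr i n).
have E : D ^+ n = D ^+ i * D ^+ (n - i) by rewrite -exprD subnKC.
have H (w a1 b1 : R) : `|w| <= B -> `|a1| <= D ^+ i * sqweight i -> `|b1| <= D ^+ (n - i) * sqweight (n - i) ->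
    `|w * a1 * b1| <= B * (D ^+ i * sqweight i) * (D ^+ (n - i) * sqweight (n - i)).
  by move=> *; rewrite !normrM !ler_pM// mulr_ge0.
apply: le_trans (ler_normB _ _) _.
apply: le_trans (lerD (H _ _ _ uB h1 h2) (H _ _ _ vB h1 h3)) _.
by rewrite E le_eqVlt; apply/orP; left; apply/eqP; ring.
Qed.

(* Coefficients of the power series in e of the solution of
   x' = e h x^2 / (1 + e k x), x(0) = 1, rewritten as x' = e (h x^2 - k x x'). *)
Lemma series_coefs N : exists x g : nat -> R -> R,
  [/\ forall i, (i <= N)%N -> x i 0 = (i == 0)%:R,
      forall i t, (i <= N)%N -> is_derive t (1:R) (x i) (g i t),
      forall i, (i <= N)%N -> continuous (g i),
      forall i t, (i <= N)%N -> 0 <= t <= T ->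
        `|x i t| <= D ^+ i * sqweight i /\ `|g i t| <= D ^+ i * sqweight i &
      forall t, g 0%N t = 0 /\ forall i, (i < N)%N -> g i.+1 t =
        \sum_(j < i.+1) (h t * x j t * x (i - j)%N t - k t * x j t * g (i - j)%N t)].
Proof.
elim: N => [|N [x [g [x0 dx cg bd rec]]]].
  exists (fun _ _ => 1), (fun _ _ => 0); split.
  - by move=> [].
  - by move=> i t _; exact: der_cst.
  - by move=> i _ t; exact: cvg_cst.
  - move=> [|//] t _ _; rewrite expr0 /sqweight expr1n invr1 mul1r normr1 normr0.
    by split => //; exact: ler01.
  - by [].
(* The factor e in front of the right-hand side lowers the order by one, so only known coefficients
   occur, even in the term with x'. *)
pose gN t := \sum_(j < N.+1) (h t * x j t * x (N - j)%N t - k t * x j t * g (N - j)%N t).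
have cx i : (i <= N)%N -> continuous (x i).
  by move=> iN t; apply: der_continuous (dx i t iN).
have cgN : continuous gN.
  pose G j t := h t * x j t * x (N - j)%N t - k t * x j t * g (N - j)%N t.
  apply: (sum_continuous N.+1 G) => j jN t.
  change {for t, continuous (G j)}; rewrite /G; cont;
    first [exact: hc|exact: kc|apply: cx|apply: cg] => //; exact: leq_subr.
(* The primitive vanishes at 0 because x(0) = 1 for every e. *)
have [xN [xN0 dxN]] := primitive _ cgN.
have gNB t : 0 <= t <= T -> `|gN t| <= 16 * B * D ^+ N * sqweight N.+1.
  move=> tT; apply: (series_coef_bound (fun i => x i t) (fun i => g i t)).
  - exact: hB.
  - exact: kB.
  - by move=> i iN; exact: (bd i t iN tT).1.
  - by move=> i iN; exact: (bd i t iN tT).2.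
pose c := 16 * B * D ^+ N * sqweight N.+1.
have c0 : 0 <= c by rewrite !mulr_ge0 ?exprn_ge0 ?sqweight_ge0// ltW.
have xNB t : 0 <= t <= T -> `|xN t| <= c * T.
  move=> /andP[t0 tT].
  have hh s : 0 <= s <= t -> 0 <= s <= T by move=> /andP[-> /le_trans->].
  have hE (A : R) s : 0 <= s <= t -> is_derive s (1:R) (fun y => A * y) A.
    by move=> _; der; ring.
  have hN s : 0 <= s <= t -> - c <= gN s <= c by move=> /hh/gNB; rewrite ler_norml.
  have h1 := der_le _ _ _ _ _ _ t0 (fun s _ => dxN s) (hE c) (fun s hs => proj2 (andP (hN s hs))).
  have h2 := der_le _ _ _ _ _ _ t0 (hE (- c)) (fun s _ => dxN s) (fun s hs => proj1 (andP (hN s hs))).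
  rewrite xN0 !mulr0 !subr0 in h1 h2.
  have h3 : c * t <= c * T by rewrite ler_wpM2l.
  by rewrite ler_norml; apply/andP; split; lra.
have DN : D ^+ N.+1 * sqweight N.+1 = c + c * T by rewrite /c exprS /D; ring.
have upd i (A : Type) (a b : A) : (i <= N)%N -> (if i == N.+1 then a else b) = b.
  by move=> iN; rewrite ltn_eqF.
have leN1 i : (i <= N.+1)%N -> i != N.+1 -> (i <= N)%N.
  by move=> iN ne; rewrite -ltnS ltn_neqAle ne.
exists (fun i => if i == N.+1 then xN else x i), (fun i => if i == N.+1 then gN else g i); split.
- by move=> i iN; case: eqP => [->//|/eqP ne]; apply: x0; exact: leN1.
- by move=> i t iN; case: eqP => [//|/eqP ne]; apply: dx; exact: leN1.
- by move=> i iN; case: eqP => [//|/eqP ne]; apply: cg; exact: leN1.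
- move=> i t iN tT; case: eqP => [->|/eqP ne]; last by apply: bd => //; exact: leN1.
  rewrite DN; split.
    by apply: le_trans (xNB t tT) _; rewrite lerDr.
  by apply: le_trans (gNB t tT) _; rewrite lerDl mulr_ge0// ltW.
- move=> t; split; first exact: (rec t).1.
  move=> i iN; under eq_bigr => j _.
    have jN : (j <= N)%N by rewrite -ltnS (leq_trans (ltn_ord j)).
    have ijN : (i - j <= N)%N by rewrite (leq_trans (leq_subr _ _)).
    rewrite !upd//; over.
  case: eqP => [[->]//|/eqP ne]; apply: (rec t).2.
  by rewrite ltn_neqAle -eqSS ne.
Qed.

(** The tail is summed by the weights, whose total is at most 2; the powers of D |e| beyond the N-th
    are simply bounded by 1. Hence D |e| = 1 is allowed. *)
Lemma poly_tail_bound (p : {poly R}) N (c e : R) : 0 <= c -> D * `|e| <= 1 ->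
  (forall l, `|p`_l| <= c * D ^+ l * sqweight l.+1) ->
  `|p.[e] - \sum_(l < N) p`_l * e ^+ l| <= 2 * c * (D * `|e|) ^+ N.
Proof.
move=> c0 De hp.
have De0 : 0 <= D * `|e| by rewrite mulr_ge0// ltW.
have -> : p.[e] = \sum_(l < N + size p) p`_l * e ^+ l.
  rewrite (@horner_coef_wide _ (N + size p)) ?leq_addl//.
rewrite big_split_ord/= [X in X - _]addrC addrK.
apply: le_trans (ler_norm_sum _ _ _) _.
apply: (@le_trans _ _ (\sum_(i < size p) c * (D * `|e|) ^+ N * sqweight (N + i).+1)).
  apply: ler_sum => i _; rewrite normrM normrX.
  apply: (@le_trans _ _ (c * D ^+ (N + i) * sqweight (N + i).+1 * `|e| ^+ (N + i))).
    by rewrite ler_wpM2r ?exprn_ge0.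
  rewrite [leLHS](_ : _ = c * (D * `|e|) ^+ (N + i) * sqweight (N + i).+1); last first.
    by rewrite [(D * _) ^+ _]exprMn; ring.
  rewrite ler_wpM2r ?sqweight_ge0// ler_wpM2l// exprD ler_piMr ?exprn_ge0// exprn_ile1//.
rewrite -mulr_sumr (_ : 2 * c * _ = c * (D * `|e|) ^+ N * 2); last by ring.
rewrite ler_wpM2l ?mulr_ge0 ?exprn_ge0//.
apply: le_trans _ (sqweight_sum (N.+1 + size p)); rewrite big_split_ord/= lerDr.
by apply: sumr_ge0 => i _; exact: sqweight_ge0.
Qed.

(** Here u is the exact value, v an approximate one, and y a slope that satisfies the equation at v
    up to the defect r. Both denominators are at least 1/2, which gives 5 = (5/4) * 2 * 2. *)
Lemma quotient_lipschitz (a b u v y r M : R) :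
  `|u| <= M -> `|v| <= M -> `|a| * M <= 2^-1 -> `|b| * M <= 2^-1 ->
  y * (1 + a * v) = b * v ^+ 2 - r ->
  `|b * u ^+ 2 / (1 + a * u) - y| <= 5 * `|u - v| + 2 * `|r|.
Proof.
move=> uM vM aM bM yE.
have half w : `|w| <= M -> 2^-1 <= 1 + a * w.
  move=> wM; have : `|a * w| <= 2^-1.
    by rewrite normrM; apply: le_trans aM; rewrite ler_wpM2l.
  by rewrite ler_norml => /andP[]; lra.
have hu := half u uM; have hv := half v vM.
have u0 : 1 + a * u != 0 by rewrite gt_eqF//; lra.
have v0 : 1 + a * v != 0 by rewrite gt_eqF//; lra.
have inv (w : R) : 2^-1 <= w -> `|w^-1| <= 2.
  move=> hw; have w0 : 0 < w by lra.
  by rewrite normfV gtr0_norm// -[leRHS]invrK lef_pV2 ?posrE ?invr_gt0.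
have -> : b * u ^+ 2 / (1 + a * u) - y = b * (u + v + a * u * v) * (u - v) /
    (1 + a * u) / (1 + a * v) + r / (1 + a * v).
  have -> : y = (b * v ^+ 2 - r) / (1 + a * v) by rewrite -yE mulfK.
  by field; rewrite u0 v0.
have M0 : 0 <= M := le_trans (normr_ge0 _) uM.
have h1 : `|b * (u + v + a * u * v)| <= 5 / 4.
  have h2 : `|u + v + a * u * v| <= 5 / 2 * M.
    have := ler_normD (u + v) (a * u * v); have := ler_normD u v.
    have h3 : `|a * u * v| <= 2^-1 * M.
      rewrite normrM ler_pM// normrM; apply: le_trans aM.
      by rewrite ler_wpM2l.
    by move=> h4 h5; lra.
  rewrite normrM; apply: (@le_trans _ _ (`|b| * (5 / 2 * M))); first by rewrite ler_wpM2l.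
  by lra.
apply: le_trans (ler_normD _ _) _; apply: lerD.
  apply: (@le_trans _ _ (5 / 4 * `|u - v| * 2 * 2)); last by lra.
  rewrite normrM ler_pM ?inv// normrM ler_pM ?inv// normrM ler_wpM2r//.
by rewrite normrM mulrC ler_wpM2r ?inv.
Qed.

(** The truncated expansion solves the equation up to a defect of order N + 1, and Gronwall carries
    this to time T. The condition 2 <= M lets M bound the truncations too, whose values are at most
    the sum of the weights. *)
Lemma series_approx (x : R -> R -> R) (M e0 : R) : 2 <= M ->
  e0 * B * M <= 2^-1 -> D * e0 <= 1 ->
  (forall e, `|e| <= e0 -> x e 0 = 1 /\ forall t, 0 <= t <= T ->
     is_derive t (1:R) (x e) (e * h t * x e t ^+ 2 / (1 + e * k t * x e t)) /\
     `|x e t| <= M) ->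
  exists2 C, 0 < C & forall N, exists p : {poly R}, (size p <= N.+1)%N /\
     forall e, `|e| <= e0 -> `|x e T - p.[e]| <= C * (D * `|e|) ^+ N.+1.
Proof.
move=> M2 e0M De0 hx.
(* 64 = 2 * 2 * 16 comes from the quotient, the tail and the coefficient bounds; 11 = 2 * 5 + 1 is
   the Gronwall rate; dividing by D turns |e| (D |e|)^N into (D |e|)^(N+1). *)
exists (64 * B / D * expR (11 * T)).
  by rewrite !mulr_gt0 ?expR_gt0// invr_gt0.
move=> N; have [c [g [c0 dc cg bd rec]]] := series_coefs N.
pose X t := \poly_(i < N.+1) c i t; pose Y t := \poly_(i < N.+1) g i t.
exists (X T); split; first exact: size_poly.
move=> e he; have [x0 /= hxe] := hx e he.
have e00 : 0 <= e0 := le_trans (normr_ge0 _) he.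
have De : D * `|e| <= 1 by apply: le_trans De0; rewrite ler_pM2l.
have De' : 0 <= D * `|e| by rewrite mulr_ge0// ltW.
have XE t : (X t).[e] = \sum_(i < N.+1) c i t * e ^+ i by rewrite horner_poly.
have YE t : (Y t).[e] = \sum_(i < N.+1) g i t * e ^+ i by rewrite horner_poly.
have dX t : is_derive t (1:R) (fun s => (X s).[e]) (Y t).[e].
  rewrite YE (_ : (fun s => _) = fun s => \sum_(i < N.+1) c i s * e ^+ i); last exact/funext.
  apply: (der_sum N.+1 (fun i s => c i s * e ^+ i) (fun i => g i t * e ^+ i)) => i iN.
  by der; [exact: dc|rewrite mulr0 addr0].
have X0 : (X 0).[e] = 1.
  rewrite XE big_ord_recl/= c0// mul1r expr0 big1 ?addr0// => i _.
  by rewrite c0 ?mul0r// /bump/= add1n ltn_ord.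
have XM t : 0 <= t <= T -> `|(X t).[e]| <= M.
  move=> tT; apply: le_trans M2; rewrite XE; apply: le_trans (ler_norm_sum _ _ _) _.
  apply: le_trans (sqweight_sum N.+1); apply: ler_sum => i _.
  have iN : (i <= N)%N by rewrite -ltnS.
  rewrite normrM normrX; apply: (@le_trans _ _ (D ^+ i * sqweight i * `|e| ^+ i)).
    by rewrite ler_wpM2r ?exprn_ge0//; exact: (bd i t iN tT).1.
  by rewrite mulrAC -exprMn ler_piMl ?sqweight_ge0// exprn_ile1.
pose E := 64 * B * `|e| * (D * `|e|) ^+ N.
have E0 : 0 <= E by rewrite !mulr_ge0 ?exprn_ge0// ltW.
(* The whole right-hand side, up to the factor e, as a polynomial in e. By the recurrence its first
   N coefficients are those of the derivative [Y], so the defect [r] is e times its tail. *)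
pose Z t := h t *: (X t * X t) - k t *: (X t * Y t).
have ZE t : (Z t).[e] = h t * (X t).[e] ^+ 2 - k t * ((X t).[e] * (Y t).[e]).
  by rewrite /Z hornerD hornerN !hornerZ !hornerM expr2.
have Zc t l : (Z t)`_l = \sum_(i < l.+1) (h t * (X t)`_i * (X t)`_(l - i) - k t * (X t)`_i * (Y t)`_(l - i)).
  rewrite coefB !coefZ !coefM !mulr_sumr -sumrB.
  by apply: eq_bigr => i _; rewrite !mulrA.
have ZB t l : 0 <= t <= T -> `|(Z t)`_l| <= 16 * B * D ^+ l * sqweight l.+1.
  move=> tT; rewrite Zc; apply: (series_coef_bound (fun i => (X t)`_i) (fun i => (Y t)`_i));
    [exact: hB|exact: kB|move=> i _..]; rewrite coef_poly; case: ifPn => iN;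
    rewrite ?normr0 ?mulr_ge0 ?exprn_ge0 ?sqweight_ge0 ?(ltW D0)//.
    exact: (bd i t iN tT).1.
  exact: (bd i t iN tT).2.
have Zg t l : (l < N)%N -> (Z t)`_l = g l.+1 t.
  move=> lN; rewrite Zc (rec t).2//; apply: eq_bigr => i _.
  have iN : (i < N.+1)%N by rewrite ltnS (leq_trans _ (ltnW lN))// -ltnS.
  have liN : (l - i < N.+1)%N by rewrite ltnS (leq_trans (leq_subr _ _))// ltnW.
  by rewrite !coef_poly iN liN.
pose r t := e * ((Z t).[e] - \sum_(l < N) (Z t)`_l * e ^+ l).
have rB t : 0 <= t <= T -> 2 * `|r t| <= E.
  move=> tT; have B16 : 0 <= 16 * B by rewrite mulr_ge0// ltW.
  have hz := @poly_tail_bound (Z t) N (16 * B) e B16 De (fun l => ZB t l tT).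
  rewrite /r normrM.
  have -> : E = 2 * (`|e| * (2 * (16 * B) * (D * `|e|) ^+ N)) by rewrite /E; ring.
  by rewrite ler_pM2l// ler_wpM2l.
have Yr t : (Y t).[e] * (1 + e * k t * (X t).[e]) = e * h t * (X t).[e] ^+ 2 - r t.
  have Y1 : (Y t).[e] = e * \sum_(l < N) (Z t)`_l * e ^+ l.
    rewrite YE big_ord_recl/= (rec t).1 mul0r add0r mulr_sumr.
    apply: eq_bigr => i _; rewrite Zg// /bump/= add1n exprS; ring.
  have -> : r t = e * (Z t).[e] - (Y t).[e] by rewrite Y1 /r mulrBr.
  by rewrite ZE; ring.
have de t : 0 <= t <= T -> is_derive t (1:R) (fun s => x e s + - (X s).[e])
    (e * h t * x e t ^+ 2 / (1 + e * k t * x e t) - (Y t).[e]).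
  by move=> tT; der; [exact: (hxe t tT).1|exact: dX|].
have eB t (w : R) : 0 <= t <= T -> `|w| <= B -> `|e * w| * M <= 2^-1.
  move=> tT wB; apply: le_trans e0M; rewrite normrM ler_wpM2r ?(le_trans _ M2)//.
  by rewrite ler_pM.
have db t : 0 <= t <= T -> `|e * h t * x e t ^+ 2 / (1 + e * k t * x e t) - (Y t).[e]|
    <= 1 * (5 * `|x e t + - (X t).[e]| + E).
  move=> tT; rewrite mul1r.
  apply: le_trans (quotient_lipschitz _ _ _ _ _ _ M _ _ _ _ (Yr t)) _.
  - exact: (hxe t tT).2.
  - exact: XM.
  - by apply: (eB t) => //; exact: kB.
  - by apply: (eB t) => //; exact: hB.
  - by rewrite lerD2l rB.
have hG := @gronwall_fwd _ _ _ (fun y => y) (fun=> 1) 5 E 0 T (ltW T0)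
  (ltac:(by []) : 0 <= 5) E0 de (fun x _ => der_id x) (fun _ _ => ler01) db.
move: hG.
rewrite x0 X0 subrr expr0n add0r subr0 (_ : 2 * 5 + 1 = 11); last by ring.
have -> : 64 * B / D * expR (11 * T) * (D * `|e|) ^+ N.+1 = E * expR (11 * T).
  by rewrite /E [_ ^+ N.+1]exprS; field; rewrite gt_eqF.
move=> hG.
have EE0 : 0 <= E * expR (11 * T) by apply: mulr_ge0 => //; exact: expR_ge0.
rewrite -(@ler_pXn2r _ 2) ?nnegrE//.
rewrite real_normK ?num_real// exprMn.
apply: (@le_trans _ _ (E ^+ 2 * expR (11 * T))).
  by apply: le_trans hG; rewrite lerDl sqr_ge0.
rewrite ler_wpM2l ?sqr_ge0// expr2 ler_peMl ?expR_ge0// -expR0 ler_expR.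
by rewrite mulr_ge0// ltW.
Qed.

End analytic.

(** * The periodic equation in the radial variable *)

Section periodic_functions.
Context {R : realType}.
Variables (T : R).
Hypothesis T0 : 0 < T.

Lemma periodic_nat {U : Type} (f : R -> U) : (forall t, f (t + T) = f t) ->
  forall (j : nat) t, f (t + j%:R * T) = f t.
Proof.
move=> fT; elim=> [|j ih] t; first by rewrite mul0r addr0.
by rewrite -natr1 mulrDl mul1r addrA fT.
Qed.

Lemma periodic_int {U : Type} (f : R -> U) : (forall t, f (t + T) = f t) ->
  forall (j : int) t, f (t + j%:~R * T) = f t.
Proof.
move=> fT [j|j] t; first exact: periodic_nat.
by rewrite NegzE mulrNz mulNr -[LHS](periodic_nat f fT j.+1) subrK.
Qed.

Lemma period_itv (t : R) : exists j : int, 0 <= t - j%:~R * T < T.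
Proof.
exists (Num.floor (t / T)); have /andP[h1 h2] := floor_itv (t / T).
rewrite subr_ge0 -ler_pdivlMr// h1/=.
by move: h2; rewrite ltr_pdivrMr// intrD mulrDl mul1r => h2; lra.
Qed.

Lemma periodic_bounded (f : R -> R) : continuous f -> (forall t, f (t + T) = f t) ->
  exists2 M, 0 < M & forall t, `|f t| <= M.
Proof.
move=> cf fT; have [M M0 hM] := bounded_on_itv f 0 T (ltW T0) (fun x _ => cf x).
exists M => // t; have [j /andP[j1 j2]] := period_itv t.
rewrite -[t](subrK (j%:~R * T)) (periodic_int f fT) hM// j1 ltW//.
Qed.

End periodic_functions.

Section scalar.
Context {R : realType}.
Variables (T : R) (An Am k : R -> R).
Hypothesis T0 : 0 < T.
Hypotheses (cAn : continuous An) (cAm : continuous Am) (ck : continuous k).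
Hypothesis AnT : forall t, An (t + T) = An t.
Hypothesis AmT : forall t, Am (t + T) = Am t.
Hypothesis kT : forall t, k (t + T) = k t.
Hypothesis k0 : forall t, 0 < k t.

Definition radial_field (t w : R) := Am t + (An t - Am t) * (k t / (k t + expR w)).

Notation F := radial_field.

Let kw (t w : R) : 0 < k t + expR w. Proof. by rewrite addr_gt0// expR_gt0. Qed.

Let kwn (t w : R) : k t + expR w != 0. Proof. by rewrite gt_eqF. Qed.

Lemma radial_field_continuous (w : R -> R) : continuous w -> continuous (fun t => F t (w t)).
Proof.
move=> cw t; change {for t, continuous (fun t => F t (w t))}; rewrite /radial_field; cont;
  by [exact: cAn|exact: cAm|exact: ck|exact: cw|exact: kwn].
Qed.

Lemma radial_field_periodic t w : F (t + T) w = F t w.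
Proof. by rewrite /radial_field AnT AmT kT. Qed.

(** The factor k / (k + e^w) lies in [0, 1] and its slope in w lies in [-1, 0], whatever the value
    of k > 0. *)
Lemma radial_field_bounds : exists2 L, 0 < L &
  [/\ forall t w, `|F t w| <= L, forall t w v, `|F t w - F t v| <= L * `|w - v| &
      forall t, `|An t - Am t| <= L].
Proof.
have [Mn Mn0 hMn] := periodic_bounded T T0 An cAn AnT.
have [Mm Mm0 hMm] := periodic_bounded T T0 Am cAm AmT.
have hg t : `|An t - Am t| <= Mn + Mm.
  by apply: le_trans (ler_normB _ _) _; rewrite lerD.
exists (Mn + Mm + Mm); first by rewrite !addr_gt0.
have q01 t w : 0 <= k t / (k t + expR w) <= 1.
  by rewrite divr_ge0 ?(ltW (k0 t)) ?(ltW (kw _ _))//= ler_pdivrMr// mul1r lerDl expR_ge0.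
have qL t w v : w <= v -> 0 <= k t / (k t + expR w) - k t / (k t + expR v) <= v - w.
  move=> wv.
  have dq x : is_derive x (1:R) (fun y => k t / (k t + expR y))
      (- (k t * expR x / (k t + expR x) ^+ 2)).
    by der; [exact: kwn|rewrite mul0r; field; exact: kwn].
  have id1 (x : R) : is_derive x (1:R) (fun y => - y) (- 1) by der.
  have dB x : 0 <= k t * expR x / (k t + expR x) ^+ 2 <= 1.
    have kt := k0 t; have ex := expR_gt0 x.
    have kx : 0 < k t * expR x by rewrite mulr_gt0.
    rewrite divr_ge0 ?sqr_ge0 ?(ltW kx)//= ler_pdivrMr ?exprn_gt0// mul1r.
    have := sqr_ge0 (k t); have := sqr_ge0 (expR x).
    by rewrite (_ : (k t + expR x) ^+ 2 = k t ^+ 2 + expR x ^+ 2 + k t * expR x + k t * expR x);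
      [move=> ? ?; lra|ring].
  have h1 := der_nonincreasing _ _ _ _ wv (fun x _ => dq x).
  have h2 := der_le _ _ _ _ _ _ wv (fun x _ => id1 x) (fun x _ => dq x).
  apply/andP; split; first by rewrite subr_ge0; apply: h1 => x _; rewrite oppr_le0; case/andP: (dB x).
  suff : - v - - w <= k t / (k t + expR v) - k t / (k t + expR w) by lra.
  by apply: h2 => x _; rewrite lerN2; case/andP: (dB x).
split.
- move=> t w; apply: le_trans (ler_normD _ _) _; rewrite addrC; apply: lerD => //.
  have /andP[q0 q1] := q01 t w.
  by rewrite normrM (ger0_norm q0) -[leRHS]mulr1 ler_pM.
- move=> t w v.
  have -> : F t w - F t v = (An t - Am t) * (k t / (k t + expR w) - k t / (k t + expR v)).
    by rewrite /radial_field; ring.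
  rewrite normrM ler_pM//; first by apply: le_trans (hg t) _; rewrite lerDl ltW.
  have [wv|/ltW wv] := leP w v.
    by have /andP[a b] := qL t w v wv; rewrite ger0_norm// distrC ger0_norm// subr_ge0.
  have /andP[a b] := qL t v w wv; rewrite distrC ger0_norm// ger0_norm// subr_ge0//.
- by move=> t; apply: le_trans (hg t) _; rewrite lerDl ltW.
Qed.

(** The explicit rates e^w here and e^(-w) in the next lemma make the limits of the displacement
    effective. *)
Lemma radial_field_near_An t w : `|F t w - An t| <= `|An t - Am t| / k t * expR w.
Proof.
have -> : F t w - An t = - ((An t - Am t) * (expR w / (k t + expR w))).
  by rewrite /radial_field; field; exact: kwn.
rewrite normrN normrM -mulrA ler_wpM2l// ger0_norm; last by rewrite divr_ge0 ?expR_ge0// ltW.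
by rewrite mulrC ler_wpM2r ?expR_ge0// lef_pV2 ?posrE// lerDl expR_ge0.
Qed.

Lemma radial_field_near_Am t w : `|F t w - Am t| <= `|An t - Am t| * k t * expR (- w).
Proof.
have -> : F t w - Am t = (An t - Am t) * (k t / (k t + expR w)) by rewrite /radial_field; ring.
rewrite normrM -mulrA ler_wpM2l// ger0_norm; last by rewrite divr_ge0// ltW.
by rewrite ler_pM2l// expRN lef_pV2 ?posrE ?expR_gt0// lerDr ltW.
Qed.

(** * Initial values near a given periodic solution *)

Section isolation.
Variable W : R -> R.
Hypotheses (hW : ode_sol F W) (WT : W T = W 0).

(** With m' = - c m, the substitution u = e m x cancels the linear term and leaves x' = e h x^2 / (1
    + e kk x) with h = - c (1 - d) m and kk = d m, the form treated by [series_approx]. *)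
Lemma fixed_point_dichotomy (Phi : R -> R -> R) :
  (forall c, Phi c 0 = c) -> (forall c, ode_sol F (Phi c)) ->
  (exists2 d, 0 < d & forall c, 0 < `|c - W 0| < d -> Phi c T != c) \/
  (exists2 d, 0 < d & forall c, `|c - W 0| < d -> Phi c T = c).
Proof.
move=> Phi0 hPhi.
have [L L0 [FL1 FL2 AL]] := radial_field_bounds.
have cW := ode_sol_continuous _ W hW.
pose rho t := expR (W t).
have rho0 t : 0 < rho t by exact: expR_gt0.
have kr0 t : 0 < k t + rho t by rewrite addr_gt0.
have kr t : k t + rho t != 0 by rewrite gt_eqF.
pose d t := rho t / (k t + rho t).
pose c t := (An t - Am t) * k t * rho t / (k t + rho t) ^+ 2.
have cc : continuous c.
  move=> t; change {for t, continuous c}; rewrite /c /rho; cont;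
    by [exact: cAn|exact: cAm|exact: ck|exact: cW|rewrite expf_neq0|exact: kr].
have cd : continuous d.
  by move=> t; change {for t, continuous d}; rewrite /d /rho; cont; [exact: cW|exact: kr|exact: ck|exact: cW].
have [C [C0 dC]] := primitive _ cc.
have cC : continuous C by move=> t; exact: der_continuous (dC t).
pose m t := expR (- C t).
have m0 t : 0 < m t by exact: expR_gt0.
have dm t : is_derive t (1:R) m (- c t * m t) by rewrite /m; der; [exact: dC|ring].
have cm : continuous m by move=> t; exact: der_continuous (dm t).
pose h t := - c t * (1 - d t) * m t; pose kk t := d t * m t.
have ch : continuous h.
  by move=> t; change {for t, continuous h}; rewrite /h; cont; [exact: cc|exact: cd|exact: cm].
have ckk : continuous kk.
  by move=> t; change {for t, continuous kk}; rewrite /kk; cont; [exact: cd|exact: cm].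
have [B1 B10 hB1] := bounded_on_itv h 0 T (ltW T0) (fun x _ => ch x).
have [B2 B20 hB2] := bounded_on_itv kk 0 T (ltW T0) (fun x _ => ckk x).
have [M1 M10 hM1] := bounded_on_itv (fun t => (m t)^-1) 0 T (ltW T0)
  (fun x _ => cont_inv _ _ (lt0r_neq0 (m0 x)) (cm x)).
pose B := B1 + B2; have B0 : 0 < B by rewrite addr_gt0.
(* The second summand bounds x = u / (e m): the exponential bounds u / e by Gronwall and [M1] bounds
   1 / m. *)
pose M := 2 + expR ((2 * L + 1) * T) * M1.
have M2 : 2 <= M by rewrite lerDl mulr_ge0 ?expR_ge0// ltW.
pose D := 16 * B * (1 + T).
have D0 : 0 < D by rewrite mulr_gt0 ?mulr_gt0// addr_gt0.
(* The bound 1/2 keeps 1 + e positive, so that its logarithm gives an initial value; the other two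
   are the smallness conditions of [series_approx]. *)
pose e0 := Num.min 2^-1 (Num.min (2^-1 / (B * M)) D^-1).
have BM0 : 0 < B * M by rewrite mulr_gt0//; apply: lt_le_trans M2.
have e00 : 0 < e0 by rewrite /e0 !lt_min divr_gt0 ?invr_gt0 ?ltr0n.
have e0M : e0 * B * M <= 2^-1.
  by rewrite -mulrA -ler_pdivlMr// /e0 !ge_min lexx orbT.
have De0 : D * e0 <= 1.
  by rewrite mulrC -ler_pdivlMr// div1r /e0 !ge_min lexx !orbT.
pose u e t := expR (Phi (W 0 + ln (1 + e)) t - W t) - 1.
have u0 e : `|e| <= e0 -> u e 0 = e.
  move=> he; rewrite /u Phi0 addrAC subrr add0r lnK ?posrE; first by rewrite addrAC subrr add0r.
  have : `|e| <= 2^-1 by apply: le_trans he _; rewrite ge_min lexx.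
  by rewrite ler_norml => /andP[]; lra.
have u1 e t : 0 < 1 + u e t by rewrite /u addrCA subrr addr0 expR_gt0.
have ku e t : 0 < k t + rho t * (1 + u e t) by rewrite addr_gt0// mulr_gt0.
have du1 e t : 0 < 1 + d t * u e t.
  have -> : 1 + d t * u e t = (k t + rho t * (1 + u e t)) / (k t + rho t).
    by rewrite /d; field.
  by rewrite divr_gt0.
have du e t : is_derive t (1:R) (u e) (- c t * u e t * (1 + u e t) / (1 + d t * u e t)).
  have hp := hPhi (W 0 + ln (1 + e)) t.
  rewrite /u; der; [exact: hp|exact: hW|].
  have -> : expR (Phi (W 0 + ln (1 + e)) t - W t) = 1 + u e t by rewrite /u addrCA subrr addr0.
  rewrite /radial_field (_ : expR (Phi _ t) = rho t * (1 + u e t)); last first.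
    by rewrite /u addrCA subrr addr0 -expRD addrCA subrr addr0.
  rewrite -/(rho t) /c /d; have := kr t; have := lt0r_neq0 (ku e t).
  move: (u e t) (rho t) (k t) (An t) (Am t) => uu r kt a a' n1 n2.
  have n3 : kt + r + r * uu != 0 by rewrite (_ : _ + _ = kt + r * (1 + uu))//; ring.
  by field; rewrite n2 (_ : 1 + uu - 1 = uu) ?n3//; ring.
have ub e t : `|e| <= e0 -> 0 <= t <= T -> `|u e t| <= `|e| * expR ((2 * L + 1) * T).
  move=> he /andP[t0 tT].
  have hb s : 0 <= s <= t -> `|- c s * u e s * (1 + u e s) / (1 + d s * u e s)| <= 1 * (L * `|u e s| + 0).
    move=> _; rewrite mul1r addr0.
    (* In this form the coefficient of u is An - Am times two fractions in [0, 1]; the bound is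
       linear in u without any smallness of u. *)
    have -> : - c s * u e s * (1 + u e s) / (1 + d s * u e s) =
       - ((An s - Am s) * (k s / (k s + rho s) * (rho s * (1 + u e s) / (k s + rho s * (1 + u e s)))) * u e s).
      rewrite /c /d; have := kr s; have := lt0r_neq0 (ku e s).
      move: (u e s) (rho s) (k s) (An s) (Am s) => uu r kt a a' n1 n2.
      have n3 : kt + r + r * uu != 0 by rewrite (_ : _ + _ = kt + r * (1 + uu))//; ring.
      by field; rewrite ?n1 ?n2 ?n3.
    rewrite normrN normrM ler_wpM2r// normrM -[leRHS]mulr1 ler_pM//.
    have q1 : 0 <= k s / (k s + rho s) <= 1.
      by rewrite divr_ge0 ?(ltW (k0 s)) ?(ltW (kr0 s))//= ler_pdivrMr// mul1r lerDl ltW.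
    have q2 : 0 <= rho s * (1 + u e s) / (k s + rho s * (1 + u e s)) <= 1.
      have r1 : 0 < rho s * (1 + u e s) by rewrite mulr_gt0.
      by rewrite divr_ge0 ?(ltW r1) ?(ltW (ku e s))//= ler_pdivrMr// mul1r lerDr ltW.
    case/andP: q1 => a1 a2; case/andP: q2 => b1 b2.
    have ab := mulr_ile1 a1 b1 a2 b2; by rewrite ger0_norm// mulr_ge0.
  have := @gronwall_fwd _ _ _ (fun y => y) (fun=> 1) L 0 0 t t0 (ltW L0) (lexx 0)
    (fun x _ => du e x) (fun x _ => der_id x) (fun _ _ => ler01) hb.
  rewrite expr0n !addr0 subr0 u0// => hG.
  have EE0 : 0 <= `|e| * expR ((2 * L + 1) * T) by rewrite mulr_ge0 ?expR_ge0.
  rewrite -(@ler_pXn2r _ 2) ?nnegrE// real_normK ?num_real//.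
  apply: le_trans hG _; rewrite exprMn real_normK ?num_real// ler_wpM2l ?sqr_ge0//.
  have L1 : 0 < 2 * L + 1 by rewrite addr_gt0// mulr_gt0.
  rewrite -[expR (_ * t)]mulr1 expr2 ler_pM ?expR_ge0// ?ler_expR ?ler_pM2l//.
  by rewrite -[leLHS]expR0 ler_expR mulr_ge0// ltW.
(* At e = 0 the quotient is replaced by the constant 1, which solves the limiting equation x' =
   0. *)
pose x e t := if e == 0 then 1 else u e t / (e * m t).
have mm0 : m 0 = 1 by rewrite /m C0 oppr0 expR0.
have hB t : 0 <= t <= T -> `|h t| <= B.
  by move=> /hB1 hh; apply: le_trans hh _; rewrite lerDl ltW.
have kB t : 0 <= t <= T -> `|kk t| <= B.
  by move=> /hB2 hh; apply: le_trans hh _; rewrite lerDr ltW.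
have hx e : `|e| <= e0 -> x e 0 = 1 /\ forall t, 0 <= t <= T ->
    is_derive t (1:R) (x e) (e * h t * x e t ^+ 2 / (1 + e * kk t * x e t)) /\ `|x e t| <= M.
  move=> he; rewrite /x; have [->|en0] := eqVneq e 0.
    split=> // t _; rewrite !mul0r; split; first exact: der_cst.
    by rewrite normr1; apply: le_trans M2; lra.
  split; first by rewrite u0// mm0 mulr1 divff.
  move=> t tT; split.
    have mn := lt0r_neq0 (m0 t); have en : e * m t != 0 by rewrite mulf_neq0.
    der; [exact: du|exact: en|exact: dm|].
    have un : u e t = e * m t * (u e t / (e * m t)) by field; rewrite en0 mn.
    have := lt0r_neq0 (du1 e t); rewrite /h /kk.
    move: (u e t) (c t) (d t) (m t) en mn => uu cc' dd mt en mn n1.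
    have n2 : e * mt + e * dd * mt * uu != 0.
      by rewrite (_ : _ + _ = e * mt * (1 + dd * uu)) ?mulf_neq0//; ring.
    by field; rewrite ?en0 ?mn ?n1 ?n2.
  rewrite normrM normfV normrM invfM mulrA.
  apply: (@le_trans _ _ (expR ((2 * L + 1) * T) * M1)); last by rewrite /M lerDr.
  rewrite ler_pM//; last by rewrite -normfV; exact: hM1.
  by rewrite ler_pdivrMr ?normr_gt0// mulrC ub.
have [C1 C10 happ] := @series_approx R h kk B T ch ckk B0 T0 hB kB x M e0 M2 e0M De0 hx.
(* For nonzero e the return condition u(T) = e reads x(T) = 1 / m(T). *)
pose f e := x e T - (m T)^-1.
have fE e : `|e| <= e0 -> e != 0 -> (f e == 0) = (Phi (W 0 + ln (1 + e)) T == W 0 + ln (1 + e)).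
  move=> he en0; have mn := lt0r_neq0 (m0 T).
  have e1 : 0 < 1 + e by have := u1 e 0; rewrite u0.
  rewrite /f /x (negPf en0) subr_eq0 invfM mulrA -[X in _ == X]mul1r (inj_eq (mulIf _)) ?invr_eq0//.
  rewrite -[X in _ == X](divff en0) (inj_eq (mulIf _)) ?invr_eq0// /u WT subr_eq.
  rewrite (_ : e + 1 = expR (ln (1 + e))); last by rewrite lnK ?posrE// addrC.
  by rewrite (inj_eq (@expR_inj R)) subr_eq [ln _ + _]addrC.
have fc s : `|expR (s - W 0) - 1| <= e0 -> s != W 0 ->
    (f (expR (s - W 0) - 1) == 0) = (Phi s T == s).
  move=> hs sn; rewrite fE//; first by rewrite addrCA subrr addr0 expRK addrC subrK.
  apply: contra_neq sn => h0; apply/eqP; rewrite -subr_eq0; apply/eqP.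
  by apply: (@expR_inj R); rewrite expR0; apply/eqP; rewrite -subr_eq0 h0.
have near1 r : 0 < r -> exists2 d', 0 < d' & forall s, `|s - W 0| < d' -> `|expR (s - W 0) - 1| < r.
  move=> r0; have /cvgrPdist_lt/(_ r r0)/nbhs_ballP[d' /= d'0 hd] := @continuous_expR R 0.
  exists d' => // s hs; have := hd (s - W 0); rewrite /= expR0 distrC; apply.
  by rewrite /ball/= sub0r normrN.
have [|[d1 d10 hd1]|[d1 d10 hd1]] := @analytic_zero_dichotomy R f e0 C1 D e00 C10 D0.
- move=> N; have [p [sp hp]] := happ N.
  exists (p - ((m T)^-1)%:P); split.
    apply: leq_trans (size_polyD _ _) _; rewrite geq_max sp size_polyN.
    by apply: leq_trans (size_polyC_leq1 _) _.
  move=> e he; rewrite hornerD hornerN hornerC /f opprD addrACA subrr addr0.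
  exact: hp.
- left; have r0 : 0 < Num.min d1 e0 by rewrite lt_min d10.
  have [d2 d20 hd2] := near1 _ r0; exists d2 => // s /andP[s0 s1].
  have sn : s != W 0 by rewrite -subr_eq0 -normr_gt0.
  have := hd2 s s1; rewrite lt_min => /andP[s2 s3].
  rewrite -fc ?ltW//; apply: hd1; rewrite s2 andbT normr_gt0 subr_eq0.
  by rewrite -expR0 (inj_eq (@expR_inj R)) subr_eq0.
- right; have r0 : 0 < Num.min d1 e0 by rewrite lt_min d10.
  have [d2 d20 hd2] := near1 _ r0; exists d2 => // s s1.
  (* The value e = 0 says nothing about returning; there the periodicity of [W] itself is used. *)
  have [->|sn] := eqVneq s (W 0).
    by rewrite -[RHS]WT; congr (_ T); apply: (ode_unique _ _ L0 FL2 _ _ 0) => //; rewrite Phi0.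
  have := hd2 s s1; rewrite lt_min => /andP[s2 s3].
  by apply/eqP; rewrite -fc ?ltW//; apply/eqP/hd1.
Qed.

End isolation.

Lemma displacement_bound (P : R -> R) (A : R -> R) (W : R -> R) (e : R) :
  (forall t, is_derive t (1:R) P (A t)) -> ode_sol F W ->
  (forall t, 0 <= t <= T -> `|F t (W t) - A t| <= e) ->
  `|(W T - W 0) - (P T - P 0)| <= e * T.
Proof.
move=> dP hW he.
have dd t : is_derive t (1:R) (fun s => W s + - P s) (F t (W t) + - A t).
  by der; [exact: hW|exact: dP|].
have hE (a t : R) : is_derive t (1:R) (fun y => a * y) a by der; ring.
have h1 := der_le _ _ _ _ _ _ (ltW T0) (fun t _ => dd t) (fun t _ => hE e t).
have h2 := der_le _ _ _ _ _ _ (ltW T0) (fun t _ => hE (- e) t) (fun t _ => dd t).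
have {}h1 : W T - P T - (W 0 - P 0) <= e * T - e * 0.
  by apply: h1 => t /he; rewrite ler_norml => /andP[].
have {}h2 : - e * T - - e * 0 <= W T - P T - (W 0 - P 0).
  by apply: h2 => t /he; rewrite ler_norml => /andP[].
by rewrite ler_norml; apply/andP; split; lra.
Qed.

Lemma isolated_periodic_solution (Pn Pm : R -> R) :
  (forall t, is_derive t (1:R) Pn (An t)) -> (forall t, is_derive t (1:R) Pm (Am t)) ->
  (Pn T - Pn 0) * (Pm T - Pm 0) < 0 ->
  exists W, [/\ ode_sol F W, forall t, W (t + T) = W t &
    exists2 d, 0 < d & forall V, ode_sol F V -> (forall t, V (t + T) = V t) ->
      `|V 0 - W 0| < d -> V = W].
Proof.
move=> dPn dPm hI.
have [L L0 [FL1 FL2 AL]] := radial_field_bounds.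
have /choice[Phi hPhi] := picard F L L L0 FL1 FL2 radial_field_continuous.
have Phi0 c : Phi c 0 = c := (hPhi c).1.
have dPhi c : ode_sol F (Phi c) := (hPhi c).2.
have hT c : Phi c T = c -> forall t, Phi c (t + T) = Phi c t.
  move=> hc t; have := ode_unique F L L0 FL2 _ _ 0 (ode_sol_shift F T radial_field_periodic _ (dPhi c)) (dPhi c).
  by rewrite add0r hc Phi0 => /(_ erefl)/(congr1 (fun f => f t)).
have near0 c t : 0 <= t <= T -> `|Phi c t - c| <= L * T.
  move=> /andP[t0 tT]; have := der_lipschitz L (Phi c) _ (dPhi c) (fun s => FL1 s _) t 0.
  rewrite Phi0 subr0 (ger0_norm t0) => /le_trans; apply.
  by rewrite ler_pM2l.
pose In := Pn T - Pn 0; pose Im := Pm T - Pm 0.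
have In0 : 0 < `|In| by rewrite normr_gt0; apply: contraTneq hI => e; rewrite -/In e mul0r ltxx.
have Im0 : 0 < `|Im| by rewrite normr_gt0; apply: contraTneq hI => e; rewrite -/Im e mulr0 ltxx.
have [Mk Mk0 hMk] := periodic_bounded T T0 k ck kT.
have [Mi Mi0 hMi] := periodic_bounded T T0 (fun t => (k t)^-1)
  (fun t => cont_inv k t (lt0r_neq0 (k0 t)) (ck t)) (fun t => congr1 _ (kT t)).
(* The factor exp(L T) accounts for the motion of a solution, by at most L T, during the period. *)
pose Kn := L * Mi * expR (L * T) * T; pose Km := L * Mk * expR (L * T) * T.
have Kn0 : 0 < Kn by rewrite !mulr_gt0 ?expR_gt0.
have Km0 : 0 < Km by rewrite !mulr_gt0 ?expR_gt0.
(* At these values the error bounds Kn e^c and Km e^(-c) are half of |In| and |Im|. Up to [cn] the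
   displacement thus has the sign of [In], which also bounds its zeros from below. *)
pose cn := ln (`|In| / 2 / Kn); pose cm := - ln (`|Im| / 2 / Km).
have hcn c : c <= cn -> `|(Phi c T - c) - In| < `|In|.
  move=> hc; have := displacement_bound Pn An (Phi c) (L * Mi * (expR (L * T) * expR c)) dPn (dPhi c).
  rewrite Phi0 -/In => /(_ _)/le_lt_trans; apply; last first.
    rewrite (_ : _ * T = Kn * expR c); last by rewrite /Kn; ring.
    apply: (@le_lt_trans _ _ (Kn * expR cn)); first by rewrite ler_pM2l// ler_expR.
    by rewrite /cn lnK ?posrE ?divr_gt0// mulrC divfK ?gt_eqF//; lra.
  move=> t tT; apply: le_trans (radial_field_near_An _ _) _.
  rewrite ler_pM ?expR_ge0 ?divr_ge0 ?(ltW (k0 t))//.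
    by rewrite ler_pM ?invr_ge0 ?(ltW (k0 t))//; apply: le_trans (hMi t); exact: ler_norm.
  by rewrite -expRD ler_expR; have := near0 c t tT; rewrite ler_norml => /andP[]; lra.
have hcm c : cm <= c -> `|(Phi c T - c) - Im| < `|Im|.
  move=> hc; have := displacement_bound Pm Am (Phi c) (L * Mk * (expR (L * T) * expR (- c))) dPm (dPhi c).
  rewrite Phi0 -/Im => /(_ _)/le_lt_trans; apply; last first.
    rewrite (_ : _ * T = Km * expR (- c)); last by rewrite /Km; ring.
    apply: (@le_lt_trans _ _ (Km * expR (- cm))); first by rewrite ler_pM2l// ler_expR lerN2.
    by rewrite /cm opprK lnK ?posrE ?divr_gt0// mulrC divfK ?gt_eqF//; lra.
  move=> t tT; apply: le_trans (radial_field_near_Am _ _) _.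
  rewrite ler_pM ?expR_ge0 ?mulr_ge0 ?(ltW (k0 t))//.
    by rewrite ler_pM ?(ltW (k0 t))//; apply: le_trans (hMk t); exact: ler_norm.
  by rewrite -expRD ler_expR; have := near0 c t tT; rewrite ler_norml => /andP[]; lra.
pose Del c := Phi c T + - c.
have cDel : continuous Del.
  have cP : continuous (fun c => Phi c T).
    apply: (@lipschitz_continuous _ _ (expR ((2 * L + 1) * T))) => s t.
    have := ode_gronwall F L L0 FL2 (Phi s) (Phi t) T 0 (dPhi s) (dPhi t).
    rewrite !Phi0 subr0 (gtr0_norm T0) => h.
    have E1 : 1 <= expR ((2 * L + 1) * T).
      by rewrite -[leLHS]expR0 ler_expR mulr_ge0 ?ltW// addr_gt0// mulr_gt0.
    rewrite -(@ler_pXn2r _ 2) ?nnegrE ?mulr_ge0 ?expR_ge0// exprMn !real_normK ?num_real//.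
    apply: le_trans h _; rewrite mulrC ler_wpM2r ?sqr_ge0//.
    by rewrite expr2 ler_peMl ?expR_ge0.
  by move=> c; change {for c, continuous Del}; rewrite /Del; cont; exact: cP.
have [z hz] : exists z, Del z = 0.
  have hn := hcn cn (lexx _); have hm := hcm cm (lexx _).
  have sg (x y : R) : `|x - y| < `|y| -> (0 < y -> 0 < x) /\ (y < 0 -> x < 0).
    rewrite ltr_norml => /andP[h1 h2]; split=> y0; move: h1 h2.
      by rewrite (gtr0_norm y0); lra.
    by rewrite (ltr0_norm y0); lra.
  have [np nn] := sg _ _ hn; have [mp mn] := sg _ _ hm.
  have cases : (Del cn < 0 < Del cm) \/ (Del cm < 0 < Del cn).
    have : In != 0 by rewrite -normr_gt0.
    have : Im != 0 by rewrite -normr_gt0.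
    rewrite !neq_lt => /orP[m0|m0] /orP[n0|n0].
    - by move: hI; rewrite -/In -/Im ltNge mulr_le0// ltW.
    - by right; rewrite /Del mn// np.
    - by left; rewrite /Del nn// mp.
    - by move: hI; rewrite -/In -/Im ltNge mulr_ge0// ltW.
  have [le|/ltW le] := leP cn cm; case: cases => /andP[/ltW c1 /ltW c2].
  - have [|z _ hz] := @IVT_le _ Del cn cm 0 le (fun x _ => cDel x); first by rewrite c1.
    by exists z.
  - have [|z _ hz] := @IVT_ge _ Del cn cm 0 le (fun x _ => cDel x); first by rewrite c1.
    by exists z.
  - have [|z _ hz] := @IVT_ge _ Del cm cn 0 le (fun x _ => cDel x); first by rewrite c1.
    by exists z.
  - have [|z _ hz] := @IVT_le _ Del cm cn 0 le (fun x _ => cDel x); first by rewrite c1.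
    by exists z.
pose S := [set c | Del c = 0].
have lbS c : S c -> cn <= c.
  move=> Sc; rewrite leNgt; apply/negP => /ltW/hcn.
  have -> : Phi c T - c = 0 := Sc.
  by rewrite sub0r normrN ltxx.
have hS : has_inf S by split; [exists z|exists cn => c /lbS].
pose c0 := inf S.
have Sc0 : Del c0 = 0.
  (* A nonzero displacement at the infimum would stay nonzero nearby, where zeros exist by the
     definition of the infimum. *)
  apply/eqP/negPn/negP => D0.
  have D0' : 0 < `|Del c0| by rewrite normr_gt0.
  have /cvgrPdist_lt/(_ _ D0')/nbhs_ballP[d /= d0 hd] := cDel c0.
  have [c Sc hc] := inf_adherent d0 hS.
  have c0c : c0 <= c by apply: (ge_inf hS.2).
  have := hd c; rewrite /ball/= (_ : Del c = 0)// subr0 ltxx => h; suff : false by []; apply: h.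
  by rewrite ltr_norml; apply/andP; split; rewrite -/c0 in hc; lra.
have PT : Phi c0 T = c0 by apply/eqP; rewrite -subr_eq0; apply/eqP.
exists (Phi c0); split; [exact: dPhi|exact: hT|].
have WT0 : Phi c0 T = Phi c0 0 by rewrite PT Phi0.
have [[d d0 hd]|[d d0 hd]] := fixed_point_dichotomy (Phi c0) (dPhi c0) WT0 Phi Phi0 dPhi.
- exists d => // V hV VT Vd.
  have E : V = Phi (V 0) by apply: (ode_unique F L L0 FL2 _ _ 0) => //; rewrite Phi0.
  have [V0|V0] := eqVneq (V 0) c0; first by rewrite E V0.
  rewrite Phi0 in Vd hd; have := hd (V 0).
  rewrite normr_gt0 subr_eq0 V0 Vd => /(_ isT)/eqP[].
  by rewrite -E; have := VT 0; rewrite add0r.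
- exfalso; have : S (c0 - d / 2).
    rewrite /S/= /Del hd ?subrr// Phi0 addrAC subrr add0r normrN gtr0_norm; lra.
  by move=> /(ge_inf hS.2); rewrite -/c0; lra.
Qed.

End scalar.

(** * Weighted polar coordinates *)

Section angles.
Context {R : realType}.
Implicit Types a b t : R.

Lemma pi2_gt0 : 0 < 2 * pi :> R. Proof. by rewrite mulr_gt0// pi_gt0. Qed.

Lemma cos_period t : cos (t + 2 * pi) = cos t.
Proof. by rewrite mulr_natl cosD2pi. Qed.

Lemma sin_period t : sin (t + 2 * pi) = sin t.
Proof. by rewrite mulr_natl sinD2pi. Qed.

Lemma cos_eq1 t : 0 <= t < 2 * pi -> cos t = 1 -> t = 0.
Proof.
move=> /andP[t0 t2] ct; have := @pi_gt0 R => p0.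
have [tp|tp] := leP t pi.
  by apply: (@cos_inj R); rewrite ?in_itv/= ?t0 ?lexx ?tp ?(ltW p0)// cos0.
have : 2 * pi - t = 0.
  apply: (@cos_inj R); rewrite ?in_itv/= ?lexx ?(ltW p0)//.
    by apply/andP; split; lra.
  by rewrite cos0 addrC cos_period cosN.
by lra.
Qed.

Lemma angle_unique a b : cos a = cos b -> sin a = sin b ->
  exists j : int, a = b + j%:~R * (2 * pi).
Proof.
move=> hc hs; have [j hj] := period_itv (2 * pi) pi2_gt0 (a - b).
exists j; suff : a - b - j%:~R * (2 * pi) = 0 by lra.
apply: cos_eq1 => //.
rewrite -mulNr -mulrNz (periodic_int (2 * pi) cos cos_period) cosB hc hs -!expr2.
exact: cos2Dsin2.
Qed.

Lemma angle_exists (x y : R) : x ^+ 2 + y ^+ 2 = 1 ->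
  exists t, x = cos t /\ y = sin t.
Proof.
move=> h; have x1 : -1 <= x <= 1.
  by rewrite -ler_norml -(@ler_pXn2r _ 2) ?nnegrE// real_normK ?num_real// expr1n -h lerDl sqr_ge0.
have s : sin (acos x) = `|y|.
  by rewrite sin_acos// -h addrAC subrr add0r sqrtr_sqr.
have [y0|y0] := leP 0 y.
  by exists (acos x); rewrite acosK ?in_itv// s ger0_norm.
by exists (- acos x); rewrite cosN sinN acosK ?in_itv// s ltr0_norm// opprK.
Qed.

End angles.

Section plane.
Context {R : realType}.

Lemma cont_fst (z : R * R) : {for z, continuous (fun x : R * R => x.1)}.
Proof. exact: cvg_fst. Qed.

Lemma cont_snd (z : R * R) : {for z, continuous (fun x : R * R => x.2)}.
Proof. exact: cvg_snd. Qed.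

Lemma cont_pair (U : topologicalType) (f g : U -> R) (x : U) : {for x, continuous f} ->
  {for x, continuous g} -> {for x, continuous (fun u => (f u, g u))}.
Proof. by move=> hf hg; exact: cvg_pair hf hg. Qed.

End plane.

Ltac cont2 := lazymatch goal with
| |- {for _, continuous (fun t => (@?f t, @?g t))} => refine (cont_pair _ f g _ _ _); cont
end.

Section polar.
Context {R : realType}.
Variables (p q : nat).
Hypotheses (hp : (0 < p)%N) (hq : (0 < q)%N).
Implicit Types (l t : R).

(** The radius enters through its logarithm, so that l ranges over the whole line and the image is
    the plane without the origin. *)
Definition polar l t : R * R := (expR l ^+ p * cos t, expR l ^+ q * sin t).

Definition sqnorm (z : R * R) : R := z.1 ^+ 2 + z.2 ^+ 2.

Lemma sqnorm_eq0 z : (sqnorm z == 0) = (z == (0, 0)).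
Proof. by case: z => x y; rewrite /sqnorm/= paddr_eq0 ?sqr_ge0// !sqrf_eq0. Qed.

Lemma sqnorm_gt0 z : (0 < sqnorm z) = (z != (0, 0)).
Proof. by rewrite -sqnorm_eq0 lt_def addr_ge0 ?sqr_ge0 ?andbT. Qed.

Lemma exp_pow_ge (k : nat) l : (0 < k)%N -> 0 <= l -> expR l <= expR l ^+ k.
Proof.
by move=> k0 l0; rewrite -expRM_natl ler_expR ler_peMl// ler1n.
Qed.

Lemma exp_pow_le (k : nat) l : (0 < k)%N -> l <= 0 -> expR l ^+ k <= expR l.
Proof.
by move=> k0 l0; rewrite -expRM_natl ler_expR -lerN2 -mulrN ler_peMl ?ler1n// oppr_ge0.
Qed.

Lemma radius_exists (x y : R) : (x, y) != (0, 0) ->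
  exists l, (x / expR l ^+ p) ^+ 2 + (y / expR l ^+ q) ^+ 2 = 1.
Proof.
rewrite -sqnorm_gt0 /sqnorm/=; set s := _ + _ => s0.
pose H l := (x * (expR l ^+ p)^-1) ^+ 2 + (y * (expR l ^+ q)^-1) ^+ 2.
have ex0 k l : expR l ^+ k != 0 by rewrite expf_neq0// gt_eqF// expR_gt0.
have cH l : {for l, continuous H}.
  by rewrite /H; cont; exact: ex0.
(* The radius s / (1 + s) is at most 1 and 1 + s is at least 1, so powers compare with first powers:
   H is at least s / r^2 >= 1 at the first radius and at most s / r^2 <= 1 at the second. *)
pose l1 := ln (s / (1 + s)); pose l2 := ln (1 + s).
have s1 : 0 < 1 + s by rewrite addr_gt0.
have e1 : expR l1 = s / (1 + s) by rewrite lnK// posrE divr_gt0.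
have e2 : expR l2 = 1 + s by rewrite lnK// posrE.
have l10 : l1 <= 0.
  by rewrite -(@ler_expR R) expR0 e1 ler_pdivrMr// mul1r lerDr.
have l20 : 0 <= l2 by rewrite -(@ler_expR R) expR0 e2 lerDl ltW.
have sq (z u v : R) : 0 < u -> u <= v -> (z / v) ^+ 2 <= z ^+ 2 / u ^+ 2.
  move=> u0 uv; have v0 := lt_le_trans u0 uv.
  rewrite exprMn exprVn ler_wpM2l ?sqr_ge0// lef_pV2 ?posrE ?exprn_gt0//.
  by rewrite ler_pXn2r ?nnegrE// ltW.
have sq' (z u v : R) : 0 < u -> u <= v -> z ^+ 2 / v ^+ 2 <= (z / u) ^+ 2.
  move=> u0 uv; have v0 := lt_le_trans u0 uv.
  rewrite exprMn exprVn ler_wpM2l ?sqr_ge0// lef_pV2 ?posrE ?exprn_gt0//.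
  by rewrite ler_pXn2r ?nnegrE// ltW.
have [||l _ hl] := @IVT_ge R H l1 l2 1 _ (fun l _ => cH l) => //.
- exact: le_trans l20.
- apply/andP; split.
    rewrite /H; apply: (@le_trans _ _ (x ^+ 2 / expR l2 ^+ 2 + y ^+ 2 / expR l2 ^+ 2)).
      by apply: lerD; apply: sq; rewrite ?expR_gt0 ?exp_pow_ge.
    rewrite -mulrDl -/s e2 ler_pdivrMr ?exprn_gt0// mul1r.
    have := mulr_gt0 s0 s0; rewrite (_ : (1 + s) ^+ 2 = 1 + s + s + s * s); last by ring.
    by move=> ?; lra.
  rewrite /H; apply: (@le_trans _ _ (x ^+ 2 / expR l1 ^+ 2 + y ^+ 2 / expR l1 ^+ 2)).
    rewrite -mulrDl -/s e1 ler_pdivlMr ?exprn_gt0 ?divr_gt0// mul1r.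
    rewrite exprMn exprVn ler_pdivrMr ?exprn_gt0//.
    rewrite (_ : s * (1 + s) ^+ 2 = s ^+ 2 + (s + s ^+ 2 + s * s ^+ 2)); last by ring.
    by have := sqr_ge0 s; have := mulr_ge0 (ltW s0) (sqr_ge0 s); move=> ? ?; lra.
  by apply: lerD; apply: sq'; rewrite ?exprn_gt0 ?expR_gt0 ?exp_pow_le.
by exists l.
Qed.

Lemma polar_exists z : z != (0, 0) -> exists l t, z = polar l t.
Proof.
case: z => x y /radius_exists[l /angle_exists[t [hx hy]]]; exists l, t.
have ex0 k : expR l ^+ k != 0 by rewrite expf_neq0// gt_eqF// expR_gt0.
by rewrite /polar -hx -hy ![expR l ^+ _ * _]mulrC !divfK.
Qed.

(** If l' < l, then cos t and sin t arise from cos t' and sin t' by factors of modulus less than 1,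
    and both pairs cannot lie on the unit circle. *)
Lemma polar_radius_unique l t l' t' : polar l t = polar l' t' -> l <= l'.
Proof.
move=> [h1 h2]; rewrite leNgt; apply/negP => ll.
have ex k s : 0 < expR s ^+ k :> R by rewrite exprn_gt0// expR_gt0.
have k1 k : (0 < k)%N -> 0 < (expR l' ^+ k / expR l ^+ k) ^+ 2 < 1.
  move=> k0; rewrite exprn_gt0 ?divr_gt0//= expr_lt1 ?ltW ?divr_gt0//.
  by rewrite ltr_pdivrMr// mul1r -!expRM_natl ltr_expR ltr_pM2l// ltr0n.
have /andP[p1 p2] := k1 p hp; have /andP[q1 q2] := k1 q hq.
have e1 : cos t ^+ 2 = (expR l' ^+ p / expR l ^+ p) ^+ 2 * cos t' ^+ 2.
  by rewrite -exprMn mulrAC -h1 mulrAC divff ?mul1r// gt_eqF.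
have e2 : sin t ^+ 2 = (expR l' ^+ q / expR l ^+ q) ^+ 2 * sin t' ^+ 2.
  by rewrite -exprMn mulrAC -h2 mulrAC divff ?mul1r// gt_eqF.
have := cos2Dsin2 t; have := cos2Dsin2 t'; have := sqr_ge0 (cos t'); have := sqr_ge0 (sin t').
rewrite e1 e2; move: (cos t' ^+ 2) (sin t' ^+ 2) p2 q2 => u v.
move: ((_ / _) ^+ 2) ((_ / _) ^+ 2) => b a a1 b1 v0 u0 uv h.
have h3 : 0 <= (1 - a) * u by rewrite mulr_ge0// subr_ge0 ltW.
have h4 : 0 <= (1 - b) * v by rewrite mulr_ge0// subr_ge0 ltW.
have : (1 - a) * u = 0 by lra.
have : (1 - b) * v = 0 by lra.
move=> /eqP + /eqP; rewrite !mulf_eq0 !subr_eq0 (gt_eqF a1) (gt_eqF b1)/=.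
by move=> /eqP v1 /eqP u1; lra.
Qed.

Lemma polar_unique l t l' t' : polar l t = polar l' t' ->
  l = l' /\ exists j : int, t = t' + j%:~R * (2 * pi).
Proof.
move=> e; have ll : l = l'.
  by apply/le_anti; rewrite (polar_radius_unique _ _ _ _ e) (polar_radius_unique _ _ _ _ (esym e)).
split=> //; move: e; rewrite ll /polar => -[h1 h2].
have ex k : expR l' ^+ k != 0 by rewrite expf_neq0// gt_eqF// expR_gt0.
by apply: angle_unique; [exact: (mulfI (ex p))|exact: (mulfI (ex q))].
Qed.

Lemma polar_neq0 l t : polar l t != (0, 0).
Proof.
apply/eqP => -[/eqP h1 /eqP h2].
have ex k : expR l ^+ k == 0 = false by apply/negbTE; rewrite expf_neq0// gt_eqF// expR_gt0.
move: h1 h2; rewrite !mulf_eq0 !ex/= => /eqP c /eqP s.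
by have := cos2Dsin2 t; rewrite c s !expr0n addr0 => /eqP; rewrite eq_sym oner_eq0.
Qed.

Lemma polar_periodic l t (j : int) : polar l (t + j%:~R * (2 * pi)) = polar l t.
Proof.
by rewrite /polar (periodic_int (2 * pi) cos cos_period) (periodic_int (2 * pi) sin sin_period).
Qed.

(** The constant a b / (a + b) is a positive lower bound for min(a, b), hence for every mean of a
    and b with weights cos^2 and sin^2. *)
Lemma sqnorm_polar_ge c l t : c <= l ->
  expR c ^+ p ^+ 2 * expR c ^+ q ^+ 2 / (expR c ^+ p ^+ 2 + expR c ^+ q ^+ 2) <= sqnorm (polar l t).
Proof.
move=> cl.
have ex k s : 0 < expR s ^+ k ^+ 2 :> R by rewrite !exprn_gt0// expR_gt0.
have mon k : expR c ^+ k ^+ 2 <= expR l ^+ k ^+ 2.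
  rewrite (@ler_pXn2r _ 2) ?nnegrE ?exprn_ge0 ?expR_ge0//.
  by rewrite -!expRM_natl ler_expR ler_wpM2l.
rewrite ler_pdivrMr ?addr_gt0// /sqnorm/= !exprMn.
have := cos2Dsin2 t; have := sqr_ge0 (cos t); have := sqr_ge0 (sin t).
move: (cos t ^+ 2) (sin t ^+ 2) (mon p) (mon q) (ex p c) (ex q c).
move: (expR c ^+ p ^+ 2) (expR c ^+ q ^+ 2) (expR l ^+ p ^+ 2) (expR l ^+ q ^+ 2).
move=> a b a' b' u v aa bb a0 b0 v0 u0 uv.
apply: (@le_trans _ _ ((a * u + b * v) * (a + b))); last first.
  by rewrite ler_wpM2r ?addr_ge0 ?(ltW a0) ?(ltW b0)// lerD// ler_wpM2r.
rewrite (_ : a * b = a * b * (u + v)); last by rewrite uv mulr1.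
rewrite -subr_ge0 (_ : _ - _ = a ^+ 2 * u + b ^+ 2 * v); last by ring.
by have := mulr_ge0 (sqr_ge0 a) u0; have := mulr_ge0 (sqr_ge0 b) v0; move=> ? ?; lra.
Qed.

Lemma sqnorm_continuous (z : R * R) : {for z, continuous sqnorm}.
Proof. by rewrite /sqnorm; cont; [exact: cont_fst|exact: cont_snd]. Qed.

(** A crude bound that confines l on bounded sets of the plane. *)
Lemma sqnorm_polar_ge_radius l t : l <= sqnorm (polar l t).
Proof.
have [l0|l0] := leP 0 l; last first.
  by apply: le_trans (ltW l0) _; rewrite addr_ge0 ?sqr_ge0.
have e1 : 1 + l <= expR l by exact: expR_ge1Dx.
have sq (k : nat) : (0 < k)%N -> expR l ^+ 2 <= expR l ^+ k ^+ 2.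
  by move=> k0; rewrite (@ler_pXn2r _ 2) ?nnegrE ?exprn_ge0 ?expR_ge0// exp_pow_ge.
apply: (@le_trans _ _ (expR l ^+ 2)).
  apply: (@le_trans _ _ (expR l)); first by lra.
  by rewrite expr2 ler_peMl ?expR_ge0//; lra.
rewrite /sqnorm/= !exprMn -[leLHS]mulr1 -(cos2Dsin2 t) mulrDr.
by apply: lerD; rewrite ler_wpM2r ?sqr_ge0// sq.
Qed.

(** * Regions bounded by a closed curve that is a graph over the angle *)

Section star_domain.
Variable r : R -> R.
Hypotheses (cr : continuous r) (r2pi : forall t, r (t + 2 * pi) = r t).

Definition star_inside : set (R * R) :=
  [set z | z = (0, 0) \/ exists l t, l <= r t /\ z = polar l t].

Definition star_outside : set (R * R) :=
  [set z | exists l t, r t <= l /\ z = polar l t].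

Let box : set (R * R) := `[0, 1] `*` `[0, 2 * pi].

Let box_compact : compact box.
Proof. by apply: compact_setX; exact: segment_compact. Qed.

Lemma star_inside_compact : compact star_inside.
Proof.
(* The first coordinate is the radius as a fraction of the boundary radius; its value 0 gives the
   origin because p and q are positive. *)
pose f (z : R * R) := ((z.1 * expR (r z.2)) ^+ p * cos z.2, (z.1 * expR (r z.2)) ^+ q * sin z.2).
rewrite (_ : star_inside = f @` box).
  apply: continuous_compact => //; apply: continuous_subspaceT => z.
  have cr2 : {for z, continuous (fun x : R * R => r x.2)}.
    exact: (continuous_comp (cont_snd z) (cr z.2)).
  change {for z, continuous f}; rewrite /f.
  by cont2; first [exact: cr2|exact: cont_fst|exact: cont_snd].
apply/seteqP; split=> [z [->|[l [t [lr ->]]]]|z [[s t]/= [/= s01 _] <-]].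
- exists (0, 0); last by rewrite /f/= !mul0r !expr0n !gtn_eqF// !mul0r.
  by split; rewrite /= in_itv/= lexx ?ler01// mulr_ge0 ?pi_ge0.
- have [j hj] := period_itv (2 * pi) (@pi2_gt0 R) t.
  have rj : r (t - j%:~R * (2 * pi)) = r t.
    by rewrite -mulNr -mulrNz (periodic_int (2 * pi) r r2pi).
  exists (expR (l - r t), t - j%:~R * (2 * pi)).
    split; rewrite /= in_itv/=.
      by rewrite expR_ge0/= -[leRHS]expR0 ler_expR subr_le0.
    by case/andP: hj => -> /ltW ->.
  rewrite /f/= rj -expRD subrK -/(polar _ _).
  by rewrite -mulNr -mulrNz polar_periodic.
- move: s01; rewrite in_itv/= => /andP[s0 s1].
  have [->|sn0] := eqVneq s 0.
    by left; rewrite /f/= !mul0r !expr0n !gtn_eqF// !mul0r.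
  have sp : 0 < s by rewrite lt_def sn0.
  right; exists (ln s + r t), t; split; last by rewrite /polar expRD lnK.
  by rewrite gerDr -ler_expR expR0 lnK.
Qed.

Lemma star_inside_closed : closed star_inside.
Proof. by apply: compact_closed; [exact: norm_hausdorff|exact: star_inside_compact]. Qed.

(** The region is unbounded, but near z only points with l < K matter. Their excess l - r(t) is at
    most K + M, so locally the region is the image of a compact box. *)
Lemma star_outside_closed : closed star_outside.
Proof.
have [M M0 hM] := periodic_bounded (2 * pi) (@pi2_gt0 R) r cr r2pi.
rewrite -openC openE => z nz; rewrite /interior.
pose K := sqnorm z + 1; pose De := K + M.
have K0 : 0 < K by rewrite ltr_wpDl// addr_ge0 ?sqr_ge0.
have De0 : 0 < De by rewrite addr_gt0.
pose f (w : R * R) := polar (r w.2 + w.1 * De) w.2.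
have cC : closed (f @` box).
  apply: compact_closed; first exact: norm_hausdorff.
  apply: continuous_compact => //; apply: continuous_subspaceT => w.
  have cr2 : {for w, continuous (fun x : R * R => r x.2)}.
    exact: (continuous_comp (cont_snd w) (cr w.2)).
  change {for w, continuous f}; rewrite /f /polar.
  by cont2; first [exact: cr2|exact: cont_fst|exact: cont_snd].
have nC : nbhs z (~` (f @` box)).
  apply: open_nbhs_nbhs; split; first by rewrite openC.
  by move=> [[s t] [/= + _] fz]; rewrite in_itv/= => /andP[s0 s1]; apply: nz;
    exists (r t + s * De), t; split; rewrite ?lerDl ?mulr_ge0// ltW.
have nK : nbhs z [set w | sqnorm w < K].
  have /cvgrPdist_lt/(_ 1 ltr01) := sqnorm_continuous z.
  by apply: filterS => w /=; rewrite distrC ltr_norml /K => /andP[_]; lra.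
apply: filterS2 nC nK => w wC /= wK [l [t [rl wE]]]; apply: wC.
have lK : l < K by apply: le_lt_trans wK; rewrite wE sqnorm_polar_ge_radius.
have [j hj] := period_itv (2 * pi) (@pi2_gt0 R) t.
have rj : r (t - j%:~R * (2 * pi)) = r t.
  by rewrite -mulNr -mulrNz (periodic_int (2 * pi) r r2pi).
exists ((l - r t) / De, t - j%:~R * (2 * pi)).
  split; rewrite /= in_itv/=.
    rewrite divr_ge0 ?subr_ge0 ?(ltW De0)//= ler_pdivrMr// mul1r /De.
    by have := hM t; rewrite ler_norml => /andP[]; lra.
  by case/andP: hj => -> /ltW ->.
rewrite /f/= rj divfK ?gt_eqF// addrC subrK wE.
by rewrite -mulNr -mulrNz polar_periodic.
Qed.

Lemma polar_shift_eq l t l' t' : polar l t = polar l' t' -> l = l' /\ r t = r t'.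
Proof.
move=> /polar_unique[-> [j ->]]; split => //.
by rewrite (periodic_int (2 * pi) r r2pi).
Qed.

Lemma polar_star_inside l t : star_inside (polar l t) <-> l <= r t.
Proof.
split=> [[/eqP|[l' [t' [h /polar_shift_eq[-> ->]]]]]//|h]; first by rewrite (negPf (polar_neq0 _ _)).
by right; exists l, t.
Qed.

Lemma polar_star_outside l t : star_outside (polar l t) <-> r t <= l.
Proof.
split=> [[l' [t' [h /polar_shift_eq[-> ->]]]]//|h].
by exists l, t.
Qed.

(** Off the curve, lying inside is both a closed condition and, as the negation of lying outside, an
    open one. The connected component of the origin therefore stays inside a compact set. *)
Lemma star_surrounds : surrounds_origin (range (fun t => polar (r t) t)).
Proof.
set G := range _.
have nG : ~ G (0, 0) by move=> [t _ /eqP]; rewrite (negPf (polar_neq0 _ _)).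
split=> //.
have GP z : G z <-> star_inside z /\ star_outside z.
  split=> [[t _ <-]|[zi [l [t [rl zE]]]]].
    by rewrite polar_star_inside polar_star_outside lexx.
  move: zi; rewrite zE polar_star_inside => lr.
  by exists t => //; congr polar; apply/le_anti/andP.
set C := connected_component _ _.
have CG : C `<=` ~` G by move=> z [A [_ AG _]] /AG.
have [C0|nC0] := pselect (C (0, 0)); last first.
  suff -> : C = set0 by apply: compact_bounded; exact: compact0.
  by apply/seteqP; split=> // z [A [A0 AG cA] Az]; apply: nC0; exists A.
suff CI : C `<=` star_inside.
  have [M [Mr hM]] := compact_bounded star_inside_compact.
  by exists M; split=> // x /hM h z /CI; exact: h.
have nin z : star_inside z \/ star_outside z.
  have [->|/polar_exists[l [t ->]]] := eqVneq z (0, 0); first by left; left.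
  by rewrite polar_star_inside polar_star_outside; apply/orP; exact: le_total.
have <- : C `&` star_inside = C.
  apply: (@component_connected _ (~` G) (0, 0)).
  - by exists (0, 0); split=> //; left.
  - exists (~` star_outside); first by rewrite openC; exact: star_outside_closed.
    apply/seteqP; split=> z [Cz zz]; split=> //.
      by move=> zo; apply: (CG z Cz); apply/GP.
    by case: (nin z).
  - by exists star_inside => //; exact: star_inside_closed.
by move=> z [].
Qed.

End star_domain.

End polar.

(** * Lifting a plane curve to weighted polar coordinates *)

Section lift.
Context {R : realType}.
Variables (p q : nat).
Hypotheses (hp : (0 < p)%N) (hq : (0 < q)%N).

(** It equals 1 exactly when e^l is the weighted radius of (x, y). Exponentials replace powers to
    make the monotonicity and the derivative in l immediate. *)
Definition wnorm (x y l : R) : R := x ^+ 2 * expR (- (2 * p%:R) * l) + y ^+ 2 * expR (- (2 * q%:R) * l).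

Lemma wnormE x y l : wnorm x y l = (x / expR l ^+ p) ^+ 2 + (y / expR l ^+ q) ^+ 2.
Proof.
rewrite /wnorm !exprMn !exprVn -!exprM -!expRM_natl -!expRN !natrM.
by congr (_ * expR _ + _ * expR _); ring.
Qed.

Lemma wnorm_decr x y l l' : (x, y) != (0, 0) -> l < l' -> wnorm x y l' < wnorm x y l.
Proof.
rewrite -sqnorm_gt0 /sqnorm/= => z0 ll.
have mon (k : nat) : (0 < k)%N -> expR (- (2 * k%:R) * l') < expR (- (2 * k%:R) * l) :> R.
  by move=> k0; rewrite ltr_expR ltr_nM2l// oppr_lt0 mulr_gt0// ltr0n.
rewrite /wnorm; have [x0|x0] := eqVneq x 0.
  have y0 : 0 < y ^+ 2 by move: z0; rewrite x0 expr0n add0r.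
  by rewrite x0 !expr0n !mul0r !add0r ltr_pM2l// mon.
have x2 : 0 < x ^+ 2 by rewrite lt_def sqrf_eq0 x0 sqr_ge0.
by apply: ltr_leD; [rewrite ltr_pM2l// mon|rewrite ler_wpM2l ?sqr_ge0// ltW// mon].
Qed.

Variables (x y x' y' : R -> R).
Hypotheses (dx : forall t, is_derive t (1:R) x (x' t)).
Hypotheses (dy : forall t, is_derive t (1:R) y (y' t)).

Let cx t : {for t, continuous x}. Proof. exact: der_continuous (dx t). Qed.
Let cy t : {for t, continuous y}. Proof. exact: der_continuous (dy t). Qed.

Lemma curve_near_neq0 t : (x t, y t) != (0, 0) -> \forall s \near t, (x s, y s) != (0, 0).
Proof.
rewrite -sqnorm_gt0 => h.
have c : {for t, continuous (fun s => sqnorm (x s, y s))}.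
  by rewrite /sqnorm/=; cont; [exact: cx|exact: cy].
have /cvgrPdist_lt/(_ _ h) := c; apply: filterS => s.
by rewrite -sqnorm_gt0 ltr_norml => /andP[_]; lra.
Qed.

(** Any choice of logarithmic radius along the curve, arbitrary at times when the curve is at the
    origin. *)
Variable rad : R -> R.
Hypothesis radE : forall t, (x t, y t) != (0, 0) -> wnorm (x t) (y t) (rad t) = 1.

Let radius_lt t l : (x t, y t) != (0, 0) -> wnorm (x t) (y t) l < 1 -> rad t < l.
Proof.
move=> h hl; rewrite ltNge; apply/negP; rewrite le_eqVlt => /predU1P[e|lt].
  by move: hl; rewrite e radE// ltxx.
by have := lt_trans (wnorm_decr _ _ _ _ h lt) hl; rewrite radE// ltxx.
Qed.

Let radius_gt t l : (x t, y t) != (0, 0) -> 1 < wnorm (x t) (y t) l -> l < rad t.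
Proof.
move=> h hl; rewrite ltNge; apply/negP; rewrite le_eqVlt => /predU1P[e|lt].
  by move: hl; rewrite -e radE// ltxx.
by have := lt_trans hl (wnorm_decr _ _ _ _ h lt); rewrite radE// ltxx.
Qed.

(** By strict monotonicity [wnorm] is above 1 at rad(t) - e and below 1 at rad(t) + e; both
    inequalities persist at nearby times and trap the radius. *)
Lemma radius_continuous t : (x t, y t) != (0, 0) -> {for t, continuous rad}.
Proof.
move=> h; have cw l : {for t, continuous (fun s => wnorm (x s) (y s) l)}.
  by rewrite /wnorm; cont; [exact: cx|exact: cy].
apply/cvgrPdist_lt => e e0; near=> s; rewrite distrC ltr_distl; apply/andP.
have hs : (x s, y s) != (0, 0) by near: s; exact: curve_near_neq0.
split.
  apply: radius_gt => //; near: s.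
  have h1 : 0 < wnorm (x t) (y t) (rad t - e) - 1.
    by rewrite subr_gt0 -[ltLHS](radE t h); apply: wnorm_decr => //; rewrite gtrBl.
  have /cvgrPdist_lt/(_ _ h1) := cw (rad t - e).
  by apply: filterS => s; rewrite ltr_norml => /andP[_]; lra.
apply: radius_lt => //; near: s.
have h1 : 0 < 1 - wnorm (x t) (y t) (rad t + e).
  by rewrite subr_gt0 -[ltRHS](radE t h); apply: wnorm_decr => //; rewrite ltrDl.
have /cvgrPdist_lt/(_ _ h1) := cw (rad t + e).
by apply: filterS => s; rewrite ltr_norml => /andP[]; lra.
Unshelve. all: by end_near. Qed.

Let xi t := x t * expR (- p%:R * rad t).
Let eta t := y t * expR (- q%:R * rad t).
Let xh t := x' t * expR (- p%:R * rad t).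
Let yh t := y' t * expR (- q%:R * rad t).
Let De t := p%:R * xi t ^+ 2 + q%:R * eta t ^+ 2.

Let xi_eta t : (x t, y t) != (0, 0) -> xi t ^+ 2 + eta t ^+ 2 = 1.
Proof.
move=> h; rewrite -(radE t h) /wnorm /xi /eta !exprMn -!expRM_natl.
by congr (_ * expR _ + _ * expR _); ring.
Qed.

Lemma weighted_sum_gt0 (u v : R) : u ^+ 2 + v ^+ 2 = 1 -> 0 < p%:R * u ^+ 2 + q%:R * v ^+ 2.
Proof.
move=> h; apply: (@lt_le_trans _ _ 1) => //; rewrite -[leLHS]h.
by apply: lerD; apply: ler_peMl; rewrite ?sqr_ge0 ?ler1n.
Qed.

(** Implicit differentiation with Carathéodory slopes: subtracting the defining equations at s and t
    gives num(s) (s - t) = den(s) (rad s - rad t), with both factors continuous at t and den(t)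
    nonzero. *)
Lemma radius_derive t : (x t, y t) != (0, 0) ->
  is_derive t (1:R) rad ((xi t * xh t + eta t * yh t) / De t).
Proof.
move=> h; set dl := _ / _; set l1 := rad t.
have D0 : De t != 0 by rewrite gt_eqF// weighted_sum_gt0// xi_eta.
have [A [AE cA At]] : exists A, [/\ forall s, x s ^+ 2 - x t ^+ 2 = A s * (s - t),
    {for t, continuous A} & A t = 2 * x t * x' t].
  by apply/is_derive1_caratheodory; der; [exact: dx|rewrite expr1].
have [B [BE cB Bt]] : exists B, [/\ forall s, y s ^+ 2 - y t ^+ 2 = B s * (s - t),
    {for t, continuous B} & B t = 2 * y t * y' t].
  by apply/is_derive1_caratheodory; der; [exact: dy|rewrite expr1].
have car (k : R) : exists U, [/\ forall l, expR (k * l) - expR (k * l1) = U l * (l - l1),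
    {for l1, continuous U} & U l1 = k * expR (k * l1)].
  by apply/is_derive1_caratheodory; der; ring.
have [U [UE cU U1]] := car (- (2 * p%:R)).
have [V [VE cV V1]] := car (- (2 * q%:R)).
pose u s := expR (- (2 * p%:R) * rad s); pose v s := expR (- (2 * q%:R) * rad s).
pose num s := A s * u s + B s * v s.
pose den s := - (x t ^+ 2 * U (rad s) + y t ^+ 2 * V (rad s)).
have crad := radius_continuous t h.
have cnum : {for t, continuous num}.
  by rewrite /num /u /v; cont; first [exact: cA|exact: cB|exact: crad].
have cden : {for t, continuous den}.
  rewrite /den; cont.
    exact: (continuous_comp crad cU).
  exact: (continuous_comp crad cV).
have xiE : xi t ^+ 2 = x t ^+ 2 * u t.
  by rewrite /xi /u exprMn -expRM_natl; congr (_ * expR _); ring.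
have etaE : eta t ^+ 2 = y t ^+ 2 * v t.
  by rewrite /eta /v exprMn -expRM_natl; congr (_ * expR _); ring.
have dent : den t = 2 * De t by rewrite /den -/l1 U1 V1 /De xiE etaE /u /v -/l1; ring.
have numt : num t = 2 * (xi t * xh t + eta t * yh t).
  rewrite /num At Bt /xi /xh /eta /yh /u /v.
  have e2 (k : R) : expR (- (2 * k) * rad t) = expR (- k * rad t) * expR (- k * rad t).
    by rewrite -expRD; congr expR; ring.
  by rewrite !e2; ring.
have den0 : den t != 0 by rewrite dent mulf_neq0.
have key s : (x s, y s) != (0, 0) -> num s * (s - t) = den s * (rad s - l1).
  move=> hs; have e1 := radE s hs; have e2 := radE t h.
  have hU := UE (rad s); have hV := VE (rad s); have hA := AE s; have hB := BE s.
  have : wnorm (x s) (y s) (rad s) - wnorm (x t) (y t) (rad t) = 0 by rewrite e1 e2 subrr.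
  rewrite /wnorm -/(u s) -/(v s) -/l1 => e3.
  have -> : num s * (s - t) = (x s ^+ 2 - x t ^+ 2) * u s + (y s ^+ 2 - y t ^+ 2) * v s.
    by rewrite hA hB /num; ring.
  have -> : den s * (rad s - l1) = - (x t ^+ 2 * (u s - expR (- (2 * p%:R) * l1))
      + y t ^+ 2 * (v s - expR (- (2 * q%:R) * l1))).
    by rewrite /u /v hU hV /den; ring.
  by move: e3; move: (u s) (v s) (expR _) (expR _) => *; lra.
apply/is_derive1_caratheodory.
exists (fun s => if s == t then dl else (rad s - l1) / (s - t)); split; last by rewrite eqxx.
- move=> s; case: eqP => [->|/eqP st]; first by rewrite !subrr mulr0.
  by rewrite divfK// subr_eq0.
have cq : {for t, continuous (fun s => num s / den s)}.
  by cont; [exact: cnum|exact: den0|exact: cden].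
have Et : num t / den t = dl.
  by rewrite numt dent /dl; field.
rewrite /prop_for/continuous_at eqxx -Et; apply: cvg_trans cq; apply: near_eq_cvg.
near=> s; case: eqP => [->//|/eqP st].
have hs : (x s, y s) != (0, 0) by near: s; exact: curve_near_neq0.
have ds : den s != 0.
  near: s; have dp : 0 < `|den t| by rewrite normr_gt0.
  have /cvgrPdist_lt/(_ _ dp) := cden; apply: filterS => s; apply: contraTneq => ->.
  by rewrite subr0 ltxx.
have st0 : s - t != 0 by rewrite subr_eq0.
apply/eqP; rewrite eqr_div//; apply/eqP.
by rewrite key// mulrC.
Unshelve. all: by end_near. Qed.

Hypotheses (cx' : continuous x') (cy' : continuous y').

(** The angle is defined as a primitive of the expected angular speed. The unit vectors (xi, eta)
    and (cos phi, sin phi) then rotate at the same speed, so their inner and cross products keep the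
    initial values 1 and 0, and the vectors coincide. *)
Lemma polar_lift_aux a b t0 l0 th0 : a <= t0 <= b ->
  (forall t, a <= t <= b -> (x t, y t) != (0, 0)) ->
  (x t0, y t0) = polar p q l0 th0 ->
  exists phi, [/\ phi t0 = th0, rad t0 = l0,
    forall t, a <= t <= b -> (x t, y t) = polar p q (rad t) (phi t) &
    forall t, a <= t <= b ->
      is_derive t (1:R) phi ((p%:R * xi t * yh t - q%:R * eta t * xh t) / De t)].
Proof.
move=> /andP[at0 t0b] nz e0; have ab := le_trans at0 t0b.
have t0ab : a <= t0 <= b by rewrite at0.
have D0 t : a <= t <= b -> De t != 0.
  by move=> /nz h; rewrite gt_eqF// weighted_sum_gt0// xi_eta.
pose w t := (p%:R * xi t * yh t - q%:R * eta t * xh t) / De t.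
have cw t : a <= t <= b -> {for t, continuous w}.
  move=> tab; have cr := radius_continuous t (nz t tab).
  by rewrite /w /De /yh /xh /xi /eta; cont;
    first [exact: cx|exact: cy|exact: cx'|exact: cy'|exact: cr|exact: D0].
have [Psi dPsi] := primitive_itv w a b ab cw.
pose phi t := Psi t + (th0 - Psi t0).
have dphi t : a <= t <= b -> is_derive t (1:R) phi (w t).
  by move=> tab; rewrite /phi; der; [exact: dPsi|rewrite addr0].
have phi0 : phi t0 = th0 by rewrite /phi addrC subrK.
have [r0 xi0 eta0] : [/\ rad t0 = l0, xi t0 = cos th0 & eta t0 = sin th0].
  have hx : x t0 = expR l0 ^+ p * cos th0 by case: e0.
  have hy : y t0 = expR l0 ^+ q * sin th0 by case: e0.
  have r0 : rad t0 = l0.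
    have h1 : wnorm (x t0) (y t0) l0 = 1.
      have ex k : expR l0 ^+ k != 0 by rewrite expf_neq0// gt_eqF// expR_gt0.
      by rewrite wnormE hx hy ![expR l0 ^+ _ * _]mulrC !mulfK// cos2Dsin2.
    apply/eqP; rewrite eq_le !leNgt; apply/andP; split; apply/negP => lt;
      have := wnorm_decr _ _ _ _ (nz t0 t0ab) lt; by rewrite h1 radE ?nz// ltxx.
  by split=> //; rewrite /xi /eta r0 ?hx ?hy mulrAC -expRM_natl -expRD mulNr subrr expR0 mul1r.
exists phi; split=> // t tab.
have drad s : a <= s <= b -> is_derive s (1:R) rad ((xi s * xh s + eta s * yh s) / De s).
  by move=> sab; apply: radius_derive; exact: nz.
pose A s := xi s * cos (phi s) + eta s * sin (phi s).
pose B s := eta s * cos (phi s) - xi s * sin (phi s).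
have dxi s : a <= s <= b -> is_derive s (1:R) xi (- eta s * w s).
  move=> sab; rewrite /xi; der; [exact: dx|exact: drad|].
  rewrite -/(xh s) /w; move: (D0 s sab); rewrite /De => D0s.
  rewrite (_ : x s * (expR _ * _) = xi s * (- p%:R * ((xi s * xh s + eta s * yh s) / De s))); last by rewrite /xi; ring.
  by rewrite /De; field.
have deta s : a <= s <= b -> is_derive s (1:R) eta (xi s * w s).
  move=> sab; rewrite /eta; der; [exact: dy|exact: drad|].
  rewrite -/(yh s) /w; move: (D0 s sab); rewrite /De => D0s.
  rewrite (_ : y s * (expR _ * _) = eta s * (- q%:R * ((xi s * xh s + eta s * yh s) / De s))); last by rewrite /eta; ring.
  by rewrite /De; field.
have dA s : a <= s <= b -> is_derive s (1:R) A 0.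
  by move=> sab; rewrite /A; der; [exact: dxi|exact: dphi|exact: deta|exact: dphi|ring].
have dB s : a <= s <= b -> is_derive s (1:R) B 0.
  by move=> sab; rewrite /B; der; [exact: deta|exact: dphi|exact: dxi|exact: dphi|ring].
have cst (f : R -> R) : (forall s, a <= s <= b -> is_derive s (1:R) f 0) -> f t = f t0.
  move=> df; case/andP: (tab) => at_ tb; have [tt|/ltW tt] := leP t t0.
    by apply: der_eq0_cst => // s /andP[s1 s2]; apply: df; rewrite (le_trans at_)// (le_trans s2).
  by apply/esym/der_eq0_cst => // s /andP[s1 s2]; apply: df; rewrite (le_trans at0)// (le_trans s2).
have At : xi t * cos (phi t) + eta t * sin (phi t) = 1.
  by rewrite -/(A t) (cst A dA) /A phi0 xi0 eta0 -!expr2 cos2Dsin2.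
have Bt : eta t * cos (phi t) - xi t * sin (phi t) = 0.
  by rewrite -/(B t) (cst B dB) /B phi0 xi0 eta0 mulrC subrr.
have cs := cos2Dsin2 (phi t).
have xit : xi t = cos (phi t).
  rewrite -[LHS]mulr1 -cs.
  transitivity ((xi t * cos (phi t) + eta t * sin (phi t)) * cos (phi t)
    - (eta t * cos (phi t) - xi t * sin (phi t)) * sin (phi t)); first by ring.
  by rewrite At Bt mul1r mul0r subr0.
have etat : eta t = sin (phi t).
  rewrite -[LHS]mulr1 -cs.
  transitivity ((xi t * cos (phi t) + eta t * sin (phi t)) * sin (phi t)
    + (eta t * cos (phi t) - xi t * sin (phi t)) * cos (phi t)); first by ring.
  by rewrite At Bt mul1r mul0r addr0.
rewrite /polar -xit -etat /xi /eta -!expRM_natl.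
by congr (_, _); rewrite mulrCA -expRD mulNr subrr expR0 mulr1.
Qed.

End lift.

Lemma polar_lift {R : realType} (p q : nat) (x y x' y' : R -> R) a b t0 l0 th0 :
  (0 < p)%N -> (0 < q)%N ->
  (forall t, is_derive t (1:R) x (x' t)) -> (forall t, is_derive t (1:R) y (y' t)) ->
  continuous x' -> continuous y' -> a <= t0 <= b ->
  (forall t, a <= t <= b -> (x t, y t) != (0, 0)) ->
  (x t0, y t0) = polar p q l0 th0 ->
  exists l phi : R -> R, [/\ l t0 = l0, phi t0 = th0,
    forall t, a <= t <= b -> (x t, y t) = polar p q (l t) (phi t) &
    forall t, a <= t <= b ->
      let c := cos (phi t) in let s := sin (phi t) in
      let xh := x' t / expR (l t) ^+ p in let yh := y' t / expR (l t) ^+ q in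
      let D := p%:R * c ^+ 2 + q%:R * s ^+ 2 in
      is_derive t (1:R) l ((c * xh + s * yh) / D) /\
      is_derive t (1:R) phi ((p%:R * c * yh - q%:R * s * xh) / D)].
Proof.
move=> hp hq dx dy cx' cy' t0ab nz e0.
have /choice[rad hrad] : forall t, exists l, (x t, y t) != (0, 0) ->
    (x t / expR l ^+ p) ^+ 2 + (y t / expR l ^+ q) ^+ 2 = 1.
  move=> t; have [h|h] := eqVneq (x t, y t) (0, 0); first by exists 0.
  by have [l hl] := radius_exists p q hp hq (x t) (y t) h; exists l.
have radE t : (x t, y t) != (0, 0) -> wnorm p q (x t) (y t) (rad t) = 1.
  by move=> h; rewrite wnormE hrad.
have [phi [h1 h2 h3 h4]] := @polar_lift_aux R p q hp hq x y x' y' dx dy rad radE cx' cy' a b t0 l0 th0 t0ab nz e0.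
exists rad, phi; split=> // t tab c s xh yh D.
have eN (k : nat) : expR (- k%:R * rad t) = (expR (rad t) ^+ k)^-1.
  by rewrite mulNr expRN expRM_natl.
have [hx hy] : x t = expR (rad t) ^+ p * c /\ y t = expR (rad t) ^+ q * s.
  by split; case: (h3 t tab).
have ex k : expR (rad t) ^+ k != 0 by rewrite expf_neq0// gt_eqF// expR_gt0.
have xiE : x t * expR (- p%:R * rad t) = c by rewrite eN hx mulrC mulKf.
have etaE : y t * expR (- q%:R * rad t) = s by rewrite eN hy mulrC mulKf.
split.
  have := @radius_derive R p q hp hq x y x' y' dx dy rad radE t (nz t tab).
  by rewrite xiE etaE !eN.
by have := h4 t tab; rewrite xiE etaE !eN.
Qed.

(** * The planar system *)

Section continuation.
Context {R : realType}.

(** A bootstrap: up to the first time at which f is not positive, f is at least e, which contradicts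
    continuity there. It lets an orbit be lifted only as long as it avoids the origin. *)
Lemma gt0_forward (f : R -> R) (t0 e : R) : continuous f -> 0 < e -> 0 < f t0 ->
  (forall t, t0 <= t -> (forall s, t0 <= s <= t -> 0 < f s) -> e <= f t) ->
  forall t, t0 <= t -> 0 < f t.
Proof.
move=> cf e0 f0 H t1 t01; rewrite ltNge; apply/negP => ft1.
pose S := [set t | t0 <= t /\ f t <= 0].
have hS : has_inf S by split; [exists t1|exists t0 => t []].
pose s := inf S.
have s0 : t0 <= s by apply: lb_le_inf => [|t []//]; exists t1.
have below t : t0 <= t -> t < s -> 0 < f t.
  move=> t0t ts; rewrite ltNge; apply/negP => ft.
  by have := ge_inf hS.2 (conj t0t ft : S t); rewrite leNgt ts.
have ebelow t : t0 <= t -> t < s -> e <= f t.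
  move=> t0t ts; apply: H => // u /andP[u0 ut].
  by apply: below => //; exact: le_lt_trans ts.
have [fs|fs] := leP (f s) 0.
  have s0' : t0 < s by rewrite lt_def s0 andbT; apply: contraTneq fs => ->; rewrite -ltNge.
  have /cvgrPdist_lt/(_ _ e0)/nbhs_ballP[d /= d0 hd] := cf s.
  pose t := Num.max t0 (s - d / 2).
  have ts : t < s by rewrite gt_max s0'/= gtrBl divr_gt0.
  have t0t : t0 <= t by rewrite le_max lexx.
  have sdt : s - d / 2 <= t by rewrite le_max lexx orbT.
  have := hd t; rewrite /ball/= => /(_ _).
  have -> : `|s - t| < d by rewrite gtr0_norm ?subr_gt0//; lra.
  by move=> /(_ isT); rewrite ltr_norml => /andP[+ _]; have := ebelow t t0t ts; lra.
have /cvgrPdist_lt/(_ _ fs)/nbhs_ballP[d /= d0 hd] := cf s.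
have [t [t0t ft] ts] := inf_adherent d0 hS.
have st : s <= t by apply: (ge_inf hS.2).
have := hd t; rewrite /ball/= => /(_ _).
have -> : `|s - t| < d by rewrite distrC ger0_norm ?subr_ge0//; rewrite -/s in ts; lra.
by move=> /(_ isT); rewrite ltr_norml => /andP[_]; lra.
Qed.

Lemma gt0_backward (f : R -> R) (t0 e : R) : continuous f -> 0 < e -> 0 < f t0 ->
  (forall t, t <= t0 -> (forall s, t <= s <= t0 -> 0 < f s) -> e <= f t) ->
  forall t, t <= t0 -> 0 < f t.
Proof.
move=> cf e0 f0 H t tt0; rewrite -[t]opprK.
apply: (@gt0_forward (fun s => f (- s)) (- t0) e); rewrite ?opprK// ?lerN2//.
  move=> s; apply: continuous_comp; last exact: cf.
  exact/continuousN/cvg_id.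
move=> s s0 Hs; apply: H => [|u /andP[u1 u2]]; first by rewrite lerNl.
by rewrite -[u]opprK; apply: Hs; apply/andP; split; lra.
Qed.

Lemma increasing_of_pos_derive (phi : R -> R) (a b : R) : (forall t : R, a <= t <= b -> exists2 w, 0 < w & is_derive t (1:R) phi w) ->
  forall s t : R, a <= s -> s < t -> t <= b -> phi s < phi t.
Proof.
move=> h s t as_ st tb.
have /choice[w hw] : forall u, exists w, a <= u <= b -> 0 < w /\ is_derive u (1:R) phi w.
  move=> u; have [ub|nub] := pselect (a <= u <= b); last by exists 0.
  by have [w w0 hw] := h u ub; exists w.
have sub u : s <= u <= t -> a <= u <= b.
  by move=> /andP[u1 u2]; rewrite (le_trans as_)// (le_trans u2).
by apply: (der_increasing phi w) => // u /sub/hw[].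
Qed.

End continuation.

Lemma on_circle_fst_continuous {R : realType} (Y : R * R -> R * R) (t : R) : continuous Y ->
  {for t, continuous (fun t => (Y (cos t, sin t)).1)}.
Proof.
move=> cY; have cc : {for t, continuous (fun t : R => (cos t, sin t))} by cont2.
exact: (continuous_comp (continuous_comp cc (cY _)) (cont_fst _)).
Qed.

Lemma on_circle_snd_continuous {R : realType} (Y : R * R -> R * R) (t : R) : continuous Y ->
  {for t, continuous (fun t => (Y (cos t, sin t)).2)}.
Proof.
move=> cY; have cc : {for t, continuous (fun t : R => (cos t, sin t))} by cont2.
exact: (continuous_comp (continuous_comp cc (cY _)) (cont_snd _)).
Qed.

Lemma bfun_continuous {R : realType} (p q : nat) (Y : R * R -> R * R) :
  continuous Y -> continuous (bfun p q Y).
Proof.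
move=> cY t; change {for t, continuous (bfun p q Y)}; rewrite /bfun; cont;
  first [exact: on_circle_fst_continuous|exact: on_circle_snd_continuous].
Qed.

Lemma afun_continuous {R : realType} (m n : nat) (Y : R * R -> R * R) :
  continuous Y -> continuous (afun m n Y).
Proof.
move=> cY t; change {for t, continuous (afun m n Y)}; rewrite /afun; cont;
  first [exact: on_circle_fst_continuous|exact: on_circle_snd_continuous].
Qed.

(** * Orbits of the planar system as graphs over the angle *)

Section dynamics.
Context {R : realType}.
Variables (p q m n : nat).
Hypotheses (hp : (0 < p)%N) (hq : (0 < q)%N) (hmn : (n < m)%N).
Variables (Xn Xm : R * R -> R * R).
Hypotheses (cXn : continuous Xn) (cXm : continuous Xm).
Hypotheses (qhn : quasi_homogeneous p q n Xn) (qhm : quasi_homogeneous p q m Xm).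
(** The angle increases along orbits; the case of two negative functions is reduced to this one by
    reversing time. *)
Hypothesis bn0 : forall t : R, 0 < bfun p q Xn t.
Hypothesis bm0 : forall t : R, 0 < bfun p q Xm t.

Let X z := Xn z + Xm z.
Let d : R := (m - n)%:R.
Let d0 : 0 < d. Proof. by rewrite ltr0n subn_gt0. Qed.
Let An t := afun m n Xn t / bfun p q Xn t.
Let Am t := afun m n Xm t / bfun p q Xm t.
Let kk t := bfun p q Xn t / bfun p q Xm t.
Let F := radial_field An Am kk.

Let aT (Y : R * R -> R * R) t : afun m n Y (t + 2 * pi) = afun m n Y t.
Proof. by rewrite /afun cos_period sin_period. Qed.

Let bT (Y : R * R -> R * R) t : bfun p q Y (t + 2 * pi) = bfun p q Y t.
Proof. by rewrite /bfun cos_period sin_period. Qed.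

Lemma An_continuous : continuous An.
Proof.
move=> t; change {for t, continuous An}; rewrite /An; cont;
  [exact: afun_continuous|by rewrite gt_eqF|exact: bfun_continuous].
Qed.

Lemma Am_continuous : continuous Am.
Proof.
move=> t; change {for t, continuous Am}; rewrite /Am; cont;
  [exact: afun_continuous|by rewrite gt_eqF|exact: bfun_continuous].
Qed.

Lemma kk_continuous : continuous kk.
Proof.
move=> t; change {for t, continuous kk}; rewrite /kk; cont;
  [exact: bfun_continuous|by rewrite gt_eqF|exact: bfun_continuous].
Qed.

Let AnT t : An (t + 2 * pi) = An t. Proof. by rewrite /An aT bT. Qed.
Let AmT t : Am (t + 2 * pi) = Am t. Proof. by rewrite /Am aT bT. Qed.
Let kkT t : kk (t + 2 * pi) = kk t. Proof. by rewrite /kk !bT. Qed.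
Let kk0 t : 0 < kk t. Proof. by rewrite divr_gt0. Qed.

Let xh l t := (X (polar p q l t)).1 / expR l ^+ p.
Let yh l t := (X (polar p q l t)).2 / expR l ^+ q.
Let De (t : R) := p%:R * cos t ^+ 2 + q%:R * sin t ^+ 2.
Let De0 t : 0 < De t. Proof. by apply: weighted_sum_gt0 => //; exact: cos2Dsin2. Qed.
(** The angular speed of the field, in the form delivered by [polar_lift]. *)
Let Om l t := (p%:R * cos t * yh l t - q%:R * sin t * xh l t) / De t.

Let pow_split (l : R) (k s : nat) : (0 < k)%N ->
  expR l ^+ (k + s - 1) / expR l ^+ k = expR l ^+ s / expR l.
Proof.
move=> k0; have ex j : expR l ^+ j != 0 by rewrite expf_neq0// gt_eqF// expR_gt0.
have ex1 : expR l != 0 by rewrite gt_eqF// expR_gt0.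
apply/eqP; rewrite eqr_div//; apply/eqP.
by rewrite -exprSr -exprD subn1 prednK ?addn_gt0 ?k0// addnC.
Qed.

Let xhE l t : xh l t = expR l ^+ n / expR l *
  ((Xn (cos t, sin t)).1 + expR l ^+ (m - n) * (Xm (cos t, sin t)).1).
Proof.
rewrite /xh /X /polar/= (qhn _ _ _).1 (qhm _ _ _).1 mulrDl [X in X + _]mulrAC [X in _ + X]mulrAC !pow_split//.
by rewrite -{1}(subnKC (ltnW hmn)) exprD; ring.
Qed.

Let yhE l t : yh l t = expR l ^+ n / expR l *
  ((Xn (cos t, sin t)).2 + expR l ^+ (m - n) * (Xm (cos t, sin t)).2).
Proof.
rewrite /yh /X /polar/= (qhn _ _ _).2 (qhm _ _ _).2 mulrDl [X in X + _]mulrAC [X in _ + X]mulrAC !pow_split//.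
by rewrite -{1}(subnKC (ltnW hmn)) exprD; ring.
Qed.

Let OmE l t : Om l t = expR l ^+ n / expR l *
  (bfun p q Xn t + expR l ^+ (m - n) * bfun p q Xm t) / De t.
Proof. by rewrite /Om xhE yhE /bfun; congr (_ / _); ring. Qed.

Let Om0 l t : 0 < Om l t.
Proof.
rewrite OmE divr_gt0// mulr_gt0//; first by rewrite divr_gt0 ?exprn_gt0 ?expR_gt0.
by rewrite addr_gt0// mulr_gt0// exprn_gt0 ?expR_gt0.
Qed.

(** The chain rule behind the scalar equation. Radial and angular speed share the factor r^(n-1) /
    De; their ratio depends on r only through r^(m-n) = e^w. *)
Lemma radial_rate l t : (cos t * xh l t + sin t * yh l t) / De t = F t (d * l) / d * Om l t.
Proof.
rewrite OmE xhE yhE /F /radial_field /An /Am /kk expRM_natl.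
have an1 Y : afun m n Y t = d * (cos t * (Y (cos t, sin t)).1 + sin t * (Y (cos t, sin t)).2).
  by rewrite /afun /d natrB// ltnW.
rewrite !an1.
have := bn0 t; have := bm0 t; have := De0 t; have := d0.
have : 0 < expR l by exact: expR_gt0.
have : 0 < expR l ^+ (m - n) by rewrite exprn_gt0// expR_gt0.
move: (expR l) (expR l ^+ (m - n)) (expR l ^+ n) (bfun p q Xn t) (bfun p q Xm t) (De t) (d).
move=> lam rho mu b1 b2 D dd rho0 lam0 dd0 D0 b20 b10.
have h1 : b1 + rho * b2 != 0 by rewrite gt_eqF// addr_gt0// mulr_gt0.
have [n1 n2 n3 n4 n5] := And5 (lt0r_neq0 lam0) (lt0r_neq0 dd0) (lt0r_neq0 D0) (lt0r_neq0 b20) (lt0r_neq0 b10).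
by field; rewrite n1 n2 n3 n4 n5 h1.
Qed.

Let F_bounds := radial_field_bounds (2 * pi) An Am kk (@pi2_gt0 R) An_continuous Am_continuous AnT AmT kk0.

Let cF := radial_field_continuous An Am kk An_continuous Am_continuous kk_continuous kk0.

Let FT : forall t w, F (t + 2 * pi) w = F t w := radial_field_periodic (2 * pi) An Am kk AnT AmT kkT.

Definition curve (W : R -> R) t := polar p q (W t / d) t.

Lemma solution_continuous g : solution X g -> continuous g.
Proof.
move=> hg t; have [h1 h2] := hg t.
have := cont_pair _ _ _ _ (der_continuous _ _ _ h1) (der_continuous _ _ _ h2).
by rewrite (_ : (fun u => _) = g)//; apply/funext => u; case: (g u).
Qed.

Lemma X_continuous : continuous X.
Proof. by move=> z; apply: continuousD; [exact: cXn|exact: cXm]. Qed.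

(** Stands in for uniqueness in the plane. The discrepancy d l - W(phi) of a lifted solution has
    derivative at most phi' L times itself in modulus, and Gronwall with the angle as clock keeps it
    at 0. *)
Lemma solution_follows_curve g W a b t0 th0 : solution X g -> ode_sol F W -> a <= t0 <= b ->
  (forall t, a <= t <= b -> g t != (0, 0)) -> g t0 = curve W th0 ->
  exists phi, [/\ phi t0 = th0, forall t, a <= t <= b -> g t = curve W (phi t) &
    forall t, a <= t <= b -> exists2 w, 0 < w & is_derive t (1:R) phi w].
Proof.
move=> hg hW t0ab nz g0; have cg := solution_continuous g hg.
have cXg : continuous (X \o g).
  by move=> t; apply: continuous_comp; [exact: cg|exact: X_continuous].
have [l [phi [hl0 hphi0 hgl hd]]] := @polar_lift R p q (fun t => (g t).1) (fun t => (g t).2)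
  (fun t => (X (g t)).1) (fun t => (X (g t)).2) a b t0 (W th0 / d) th0 hp hq
  (fun t => (hg t).1) (fun t => (hg t).2)
  (fun t => continuous_comp (cXg t) (cont_fst _))
  (fun t => continuous_comp (cXg t) (cont_snd _)) t0ab
  (fun t tab => ltac:(by rewrite -surjective_pairing; exact: nz))
  ltac:(by rewrite -surjective_pairing).
have gl t : a <= t <= b -> g t = polar p q (l t) (phi t).
  by move=> tab; rewrite -hgl// -surjective_pairing.
have dphi t : a <= t <= b -> is_derive t (1:R) phi (Om (l t) (phi t)).
  by move=> tab; have /= [_] := hd t tab; rewrite gl.
have dl t : a <= t <= b -> is_derive t (1:R) l (F (phi t) (d * l t) / d * Om (l t) (phi t)).
  by move=> tab; have /= [+ _] := hd t tab; rewrite gl// -radial_rate.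
have [L L0 [FL1 FL2 _]] := F_bounds.
pose D t := d * l t + - W (phi t).
have dn0 : d != 0 by rewrite gt_eqF.
have dD t : a <= t <= b -> is_derive t (1:R) D
    (Om (l t) (phi t) * (F (phi t) (d * l t) - F (phi t) (W (phi t)))).
  move=> tab; rewrite /D; der; [exact: dl|exact: (der_comp W phi _ _ _ (hW _) (dphi t tab))|].
  by field.
have bD t : `|Om (l t) (phi t) * (F (phi t) (d * l t) - F (phi t) (W (phi t)))|
    <= Om (l t) (phi t) * (L * `|D t| + 0).
  by rewrite addr0 normrM gtr0_norm// ler_pM2l// FL2.
have D00 : D t0 = 0 by rewrite /D hl0 hphi0 mulrC divfK// subrr.
have D0 t : a <= t <= b -> D t = 0.
  move=> /andP[at_ tb]; case/andP: t0ab => at0 t0b.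
  suff : D t ^+ 2 <= 0 by move=> h; apply/eqP; rewrite -sqrf_eq0 eq_le h sqr_ge0.
  have [tt|/ltW tt] := leP t t0.
    have sub s : t <= s <= t0 -> a <= s <= b.
      by move=> /andP[s1 s2]; rewrite (le_trans at_)// (le_trans s2).
    have := @gronwall_bwd _ D _ phi _ L 0 t t0 tt (ltW L0) (lexx 0) (fun s hs => dD s (sub s hs))
      (fun s hs => dphi s (sub s hs)) (fun s _ => ltW (Om0 _ _)) (fun s _ => bD s).
    by rewrite D00 expr0n !addr0 mul0r.
  have sub s : t0 <= s <= t -> a <= s <= b.
    by move=> /andP[s1 s2]; rewrite (le_trans at0)// (le_trans s2).
  have := @gronwall_fwd _ D _ phi _ L 0 t0 t tt (ltW L0) (lexx 0) (fun s hs => dD s (sub s hs))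
    (fun s hs => dphi s (sub s hs)) (fun s _ => ltW (Om0 _ _)) (fun s _ => bD s).
  by rewrite D00 expr0n !addr0 mul0r.
exists phi; split=> // t tab; last by exists (Om (l t) (phi t)); [exact: Om0|exact: dphi].
rewrite gl// /curve; congr polar.
by have := D0 t tab; rewrite /D => h; apply: (mulfI dn0); rewrite mulrCA divff// mulr1; lra.
Qed.

(* W is bounded below in one direction of t, so a solution following it stays
   away from the origin in that direction of time, hence always by periodicity. *)
Lemma periodic_solution_neq0 g W t0 th0 T : solution X g -> ode_sol F W ->
  0 < T -> (forall t, g (t + T) = g t) -> g t0 = curve W th0 ->
  forall t, g t != (0, 0).
Proof.
move=> hg hW T0 gT g0.
have [L L0 [FL1 FL2 _]] := F_bounds.
have cg := solution_continuous g hg.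
have cN : continuous (fun t => sqnorm (g t)).
  by move=> t; exact: (continuous_comp (cg t) (sqnorm_continuous (g t))).
have N0 : 0 < sqnorm (g t0) by rewrite sqnorm_gt0 g0 polar_neq0.
have [c hc] := ode_semibounded F L L0 FL2 (2 * pi) FT W th0 (@pi2_gt0 R) hW.
pose k := expR (c / d) ^+ p ^+ 2 * expR (c / d) ^+ q ^+ 2 /
  (expR (c / d) ^+ p ^+ 2 + expR (c / d) ^+ q ^+ 2).
have k0 : 0 < k.
  by rewrite /k divr_gt0 ?mulr_gt0 ?addr_gt0 ?exprn_gt0 ?expR_gt0.
have kN th : c <= W th -> k <= sqnorm (curve W th).
  by move=> cW; apply: sqnorm_polar_ge; rewrite ler_pM2r// invr_gt0.
have gz (j : int) t : g (t + j%:~R * T) = g t by exact: (periodic_int T g gT).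
(* Whole periods carry any time to the side of [t0] on which W is bounded below along the orbit; the
   angle increases with time, so the side is the same for both. *)
have all : forall t, exists j : int, 0 < sqnorm (g (t + j%:~R * T)).
  case: hc => hc t.
  - have H : forall t, t0 <= t -> 0 < sqnorm (g t).
      apply: (@gt0_forward _ _ t0 k) => // s ts hs.
      have nz u : t0 <= u <= s -> g u != (0, 0) by move=> /hs; rewrite sqnorm_gt0.
      have [|phi [p0 hphi dphi]] := solution_follows_curve g W t0 s t0 th0 hg hW _ nz g0; first by rewrite lexx.
      rewrite hphi ?ts ?lexx//; apply/kN/hc; rewrite -p0.
      move: ts; rewrite le_eqVlt => /predU1P[->//|ts].
      by apply/ltW/(increasing_of_pos_derive phi t0 s dphi).
    exists (- Num.floor ((t - t0) / T)); apply: H.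
    rewrite rmorphN mulNr lerBrDr -lerBrDl -ler_pdivlMr//.
    exact: floor_le.
  - have H : forall t, t <= t0 -> 0 < sqnorm (g t).
      apply: (@gt0_backward _ _ t0 k) => // s ts hs.
      have nz u : s <= u <= t0 -> g u != (0, 0) by move=> /hs; rewrite sqnorm_gt0.
      have [|phi [p0 hphi dphi]] := solution_follows_curve g W s t0 t0 th0 hg hW _ nz g0; first by rewrite ts lexx.
      rewrite hphi ?ts ?lexx//; apply/kN/hc; rewrite -p0.
      move: ts; rewrite le_eqVlt => /predU1P[->//|ts].
      by apply/ltW/(increasing_of_pos_derive phi s t0 dphi).
    exists (Num.floor ((t0 - t) / T)); apply: H.
    rewrite -lerBrDl -ler_pdivlMr//.
    exact: floor_le.
by move=> t; have [j] := all t; rewrite gz sqnorm_gt0.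
Qed.

Lemma curve_shift W th (j : int) : (forall t, W (t + 2 * pi) = W t) ->
  curve W (th + j%:~R * (2 * pi)) = curve W th.
Proof. by move=> WT; rewrite /curve polar_periodic (periodic_int (2 * pi) W WT). Qed.

(** Over one period in time the angle grows by a positive number j of full turns, so W returns after
    j turns and hence, by monotonicity of the return map, after one. *)
Lemma periodic_orbit_meets G W z th0 : periodic_orbit X G -> ode_sol F W ->
  G z -> z = curve W th0 -> (forall t, W (t + 2 * pi) = W t) /\ G = range (curve W).
Proof.
move=> [g [hg [T T0 gT] _ ->]] hW [t0 _ g0] zE; rewrite zE in g0.
have [L L0 [FL1 FL2 _]] := F_bounds.
have nz := periodic_solution_neq0 g W t0 th0 T hg hW T0 gT g0.
have [|phi [p0 hphi dphi]] := solution_follows_curve g W t0 (t0 + T) t0 th0 hg hW _ (fun t _ => nz t) g0.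
  by rewrite lexx lerDl ltW.
have t0T : t0 <= t0 + T by rewrite lerDl ltW.
have lt1 : th0 < phi (t0 + T).
  by rewrite -p0; apply: (increasing_of_pos_derive phi t0 (t0 + T) dphi) => //; rewrite ltrDl.
have : curve W (phi (t0 + T)) = curve W th0.
  by rewrite -hphi ?t0T ?lexx// gT g0.
move=> /(polar_unique p q hp hq)[We [j phiE]].
have {}We : W (phi (t0 + T)) = W th0.
  by have := congr1 (fun u => u * d) We; rewrite !divfK// gt_eqF.
have j0 : 0 < j.
  by move: lt1; rewrite phiE ltrDl pmulr_lgt0 ?pi2_gt0// ltr0z.
have WT : forall t, W (t + 2 * pi) = W t.
  move: phiE; case: j j0 => // k k0 phiE.
  apply: (@ode_periodic_of_iter _ F L L0 FL2 (2 * pi) FT W th0 k) => //.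
  by rewrite -We phiE.
split=> //; apply/seteqP; split=> [_ [t _ <-]|_ [th _ <-]].
- have [|psi [q0 hpsi _]] := solution_follows_curve g W (Num.min t0 t) (Num.max t0 t) t0 th0 hg hW _ (fun t _ => nz t) g0.
    by rewrite ge_min le_max lexx.
  by exists (psi t) => //; rewrite hpsi// ge_min le_max lexx !orbT.
(* Every angle has a representative within one turn of [th0], and the lifted angle runs through at
   least one full turn. *)
- have [i /andP[i0 i1]] := period_itv (2 * pi) (@pi2_gt0 R) (th - th0).
  have cphi t : t0 <= t <= t0 + T -> {for t, continuous phi}.
    by move=> /dphi[w _ hw]; exact: der_continuous hw.
  have j1 : 2 * pi <= j%:~R * (2 * pi) :> R.
    by rewrite ler_peMl ?ler1z// ltW// pi2_gt0.
  have [|t tt phit] := IVT_le phi t0 (t0 + T) (th - i%:~R * (2 * pi)) t0T cphi.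
    by rewrite p0 phiE; apply/andP; split; lra.
  exists t => //; rewrite hphi// phit.
  by rewrite -mulNr -mulrNz curve_shift.
Qed.

(** Time as a function of the angle is a primitive of the inverse angular speed; its inverse
    function parametrises the curve as a solution. *)
Lemma curve_periodic_orbit W : ode_sol F W -> (forall t, W (t + 2 * pi) = W t) ->
  periodic_orbit X (range (curve W)).
Proof.
move=> hW WT; have cW := ode_sol_continuous F W hW.
pose B t := Om (W t / d) t.
have B0 t : 0 < B t by exact: Om0.
have dn0 : d != 0 by rewrite gt_eqF.
have cX1 t : {for t, continuous (fun t => X (curve W t))}.
  have cc : {for t, continuous (curve W)}.
    by rewrite /curve /polar; cont2; exact: cW.
  exact: (continuous_comp cc (X_continuous _)).
have cB : continuous B.
  move=> t; change {for t, continuous B}.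
  have c1 := continuous_comp (cX1 t) (cont_fst _).
  have c2 := continuous_comp (cX1 t) (cont_snd _).
  have ex k : expR (W t / d) ^+ k != 0 by rewrite expf_neq0// gt_eqF// expR_gt0.
  rewrite /B /Om /xh /yh /De; cont;
    first [exact: c1|exact: c2|exact: cW|exact: ex|exact: (lt0r_neq0 (De0 t))].
have BT t : B (t + 2 * pi) = B t.
  rewrite /B /Om /xh /yh /De /polar WT cos_period sin_period//.
(* The upper bound on the angular speed makes [tau] grow at least linearly, hence reach every real
   value. *)
have [M M0 hM] := periodic_bounded (2 * pi) (@pi2_gt0 R) B cB BT.
have [tau [tau0 dtau]] := primitive (fun t => (B t)^-1)
  (fun t => cont_inv B t (lt0r_neq0 (B0 t)) (cB t)).
have ctau : continuous tau by move=> t; exact: der_continuous (dtau t).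
have tau_lt s t : s < t -> tau s < tau t.
  by move=> st; apply: (der_increasing tau _ s t st (fun u _ => dtau u)) => u _; rewrite invr_gt0.
have tau_ge s t : s <= t -> (t - s) / M <= tau t - tau s.
  move=> st; have hE (u : R) : is_derive u (1:R) (fun y => M^-1 * y) M^-1 by der; ring.
  have := der_le _ _ _ _ _ _ st (fun u _ => hE u) (fun u _ => dtau u).
  rewrite -mulrBr mulrC; apply => u _.
  by rewrite lef_pV2 ?posrE//; apply: le_trans (hM u); exact: ler_norm.
have tau_inj : injective tau.
  by move=> s t e; case: (ltgtP s t) => // /tau_lt; rewrite e ltxx.
have /choice[phi hphi] : forall t, exists th, tau th = t.
  move=> t; pose th := M * `|t|.
  have th0 : 0 <= th by rewrite mulr_ge0// ltW.
  have h1 := tau_ge 0 th th0; have h2 := tau_ge (- th) 0 ltac:(lra).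
  have [||c _ hc] := IVT_le tau (- th) th t _ (fun u _ => ctau u).
  - by lra.
  - move: h1 h2; rewrite tau0 !subr0 !sub0r opprK /th mulrAC divff ?gt_eqF// mul1r => h1 h2.
    by have := ler_norm t; have := ler_norm (- t); rewrite normrN; move=> ? ?; apply/andP; split; lra.
  - by exists c.
have phiK t : phi (tau t) = t by apply: tau_inj; rewrite hphi.
have dphi t : is_derive t (1:R) phi (B (phi t)).
  have := @is_derive_inverse R tau phi (B (phi t))^-1 (phi t) _ _ (dtau (phi t)).
  rewrite hphi invrK; apply.
  - by near=> u; exact: phiK.
  - by near=> u; exact: ctau.
  - by rewrite invr_eq0 gt_eqF.
pose T := tau (2 * pi) - tau 0.
have T0 : 0 < T by rewrite subr_gt0; apply: tau_lt; exact: pi2_gt0.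
have tauT t : tau (t + 2 * pi) = tau t + T.
  have dd s : is_derive s (1:R) (fun s => tau (s + 2 * pi) + - tau s) 0.
    by der; [exact: (der_shift tau s (2 * pi) _ (dtau _))|exact: dtau|rewrite BT subrr].
  have := @is_derive_0_is_cst R _ t 0 dd; rewrite /= add0r /T; lra.
have phiT t : phi (t + T) = phi t + 2 * pi.
  by apply: tau_inj; rewrite tauT !hphi.
exists (fun t => curve W (phi t)); split.
- move=> t.
  have dWphi := der_comp W phi t _ _ (hW (phi t)) (dphi t).
  have De1 := lt0r_neq0 (De0 (phi t)).
  have Wd : d * (W (phi t) / d) = W (phi t) by rewrite mulrC divfK.
  have rr := radial_rate (W (phi t) / d) (phi t); rewrite Wd -/(B (phi t)) in rr.
  have BE : B (phi t) = Om (W (phi t) / d) (phi t) by [].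
  have pw (k : nat) : (fun u => expR (W (phi u) / d) ^+ k) = (fun u => expR (k%:R * (W (phi u) * d^-1))).
    by apply/funext => u; rewrite expRM_natl.
  have ex k : expR (W (phi t) / d) ^+ k != 0 by rewrite expf_neq0// gt_eqF// expR_gt0.
  have rate : (F (phi t) (W (phi t)) * B (phi t)) / d =
      (cos (phi t) * xh (W (phi t) / d) (phi t) + sin (phi t) * yh (W (phi t) / d) (phi t)) / De (phi t).
    by rewrite rr; ring.
  split.
  + change (is_derive t (1:R) (fun u => (curve W (phi u)).1) (X (curve W (phi t))).1).
    have -> : (fun u => (curve W (phi u)).1) = fun u => expR (p%:R * (W (phi u) * d^-1)) * cos (phi u).
      by apply/funext => u; rewrite expRM_natl.
    der; [exact: dWphi|exact: dphi|].
    transitivity (xh (W (phi t) / d) (phi t) * expR (W (phi t) / d) ^+ p); last by rewrite /xh divfK.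
    rewrite mulr0 addr0 rate BE /Om -(expRM_natl p).
    move: De1; rewrite /De => De1; by field; rewrite De1 -/d dn0.
  + change (is_derive t (1:R) (fun u => (curve W (phi u)).2) (X (curve W (phi t))).2).
    have -> : (fun u => (curve W (phi u)).2) = fun u => expR (q%:R * (W (phi u) * d^-1)) * sin (phi u).
      by apply/funext => u; rewrite expRM_natl.
    der; [exact: dWphi|exact: dphi|].
    transitivity (yh (W (phi t) / d) (phi t) * expR (W (phi t) / d) ^+ q); last by rewrite /yh divfK.
    rewrite mulr0 addr0 rate BE /Om -(expRM_natl q).
    move: De1; rewrite /De => De1; by field; rewrite De1 -/d dn0.
- exists T => // t; rewrite phiT.
  by have := curve_shift W (phi t) 1 WT; rewrite mul1r.
(* The orbit is not constant: its points at the angles 0 and pi lie on opposite half-axes. *)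
- apply: contrapT => /forallNP H.
  have h0 : curve W (phi (tau 0)) = curve W (phi 0) by apply/eqP/negPn/negP => /eqP/H.
  have hpi : curve W (phi (tau pi)) = curve W (phi 0) by apply/eqP/negPn/negP => /eqP/H.
  have : curve W 0 = curve W pi by rewrite -[in LHS](phiK 0) h0 -hpi phiK.
  rewrite /curve /polar cos0 cospi mulr1 mulrN1 => -[+ _].
  have := expR_gt0 (W 0 / d); have := expR_gt0 (W pi / d).
  move=> /(exprn_gt0 p) h1 /(exprn_gt0 p) h2 e.
  by move: h2; rewrite e oppr_gt0 ltNge ltW.
- apply/seteqP; split=> [_ [t _ <-]|_ [t _ <-]]; last by exists (phi t).
  by exists (tau t) => //; rewrite phiK.
Unshelve. all: by end_near. Qed.

(** The isolating neighbourhood is an open strip around the curve in logarithmic radius. A periodic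
    orbit that meets it is the graph of a periodic scalar solution, which Gronwall keeps close
    enough to W to coincide with it. *)
Lemma limit_cycle_exists :
  (\int[lebesgue_measure]_(t in `[0, 2 * pi]) (afun m n Xn t / bfun p q Xn t)) *
  (\int[lebesgue_measure]_(t in `[0, 2 * pi]) (afun m n Xm t / bfun p q Xm t)) < 0 ->
  exists G, limit_cycle X G /\ surrounds_origin G.
Proof.
have [Pn [_ dPn]] := primitive An An_continuous.
have [Pm [_ dPm]] := primitive Am Am_continuous.
rewrite (Rintegral_FTC _ _ _ _ (@pi2_gt0 R) An_continuous dPn).
rewrite (Rintegral_FTC _ _ _ _ (@pi2_gt0 R) Am_continuous dPm) => hI.
have [W [hW WT [d1 d10 iso]]] := isolated_periodic_solution (2 * pi) An Am kk (@pi2_gt0 R)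
  An_continuous Am_continuous kk_continuous AnT AmT kkT kk0 Pn Pm dPn dPm hI.
have cW := ode_sol_continuous F W hW.
have [L L0 [FL1 FL2 _]] := F_bounds.
have dn0 : d != 0 by rewrite gt_eqF.
pose r t := W t / d.
have cr (e : R) : continuous (fun t => r t + e).
  by move=> t; change {for t, continuous (fun t => r t + e)}; rewrite /r; cont; exact: cW.
have rT (e : R) t : r (t + 2 * pi) + e = r t + e by rewrite /r WT.
pose E := expR ((2 * L + 1) * (2 * pi)) : R.
have L1 : 0 < 2 * L + 1 by rewrite addr_gt0// mulr_gt0.
have E1 : 1 <= E by rewrite -[leLHS]expR0 ler_expR mulr_ge0 ?(ltW L1)// ltW// pi2_gt0.
have E0 : 0 < E by exact: expR_gt0.
(* Isolation is known at angle 0. A distance of at most d e in w grows over at most one turn to at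
   most d e E = d1 / 2. *)
pose e := d1 / (2 * d * E).
have e0 : 0 < e by rewrite divr_gt0// !mulr_gt0.
exists (range (curve W)); split; last first.
  apply: (@star_surrounds R p q hp hq r); last by move=> t; rewrite /r WT.
  by have := cr 0; rewrite (_ : (fun t => r t + 0) = r)//; apply/funext => t; rewrite addr0.
split; first exact: curve_periodic_orbit.
exists (~` star_inside p q (fun t => r t + - e) `&` ~` star_outside p q (fun t => r t + e)); split.
- apply: openI; rewrite openC.
    exact: (star_inside_closed p q hp hq _ (cr (- e)) (rT (- e))).
  exact: (star_outside_closed p q hp hq _ (cr e) (rT e)).
- move=> _ [t _ <-]; split; rewrite /curve -/(r t).
    by move=> /(polar_star_inside p q hp hq _ (rT (- e))); lra.
  by move=> /(polar_star_outside p q hp hq _ (rT e)); lra.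
- move=> G' hG' [z [Gz [zi zo]]].
  have zn0 : z != (0, 0) by apply/eqP => z0; apply: zi; left.
  have [l [t zE]] := polar_exists p q hp hq z zn0.
  have [j hj] := period_itv (2 * pi) (@pi2_gt0 R) t.
  (* The angle is reduced to [0, 2 pi), so that comparison at angle 0 costs at most the factor
     [E]. *)
  pose th := t - j%:~R * (2 * pi).
  have {}zE : z = polar p q l th by rewrite /th -mulNr -mulrNz polar_periodic.
  have lr1 : r th - e < l.
    by rewrite ltNge; apply/negP => h; apply: zi; rewrite zE; right; exists l, th.
  have lr2 : l < r th + e.
    by rewrite ltNge; apply/negP => h; apply: zo; rewrite zE; exists l, th.
  have [V [Vth hV]] := picard_at F L L L0 FL1 FL2 cF th (d * l).
  have zV : z = curve V th by rewrite zE /curve Vth [d * l]mulrC mulfK.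
  have [VT GE] := periodic_orbit_meets G' V z th hG' hV Gz zV.
  rewrite GE (iso V hV VT)//.
  have hG := ode_gronwall F L L0 FL2 V W 0 th hV hW.
  have h1 : (V th - W th) ^+ 2 <= (d * e) ^+ 2.
    have -> : V th - W th = d * (l - r th) by rewrite Vth /r mulrBr [d * (_ / _)]mulrC divfK.
    have de0 : 0 <= d * e by apply: mulr_ge0; exact: ltW.
    rewrite -[leLHS]real_normK ?num_real//.
    suff h : `|d * (l - r th)| <= d * e by rewrite (@ler_pXn2r _ 2) ?nnegrE.
    by rewrite normrM gtr0_norm// ler_pM2l// ler_norml; apply/andP; split; lra.
  have h2 : expR ((2 * L + 1) * `|0 - th|) <= E.
    rewrite ler_expR ler_pM2l// sub0r normrN.
    by case/andP: hj => th0 th1; rewrite ger0_norm// ltW.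
  have h3 : (V 0 - W 0) ^+ 2 <= (d1 / 2) ^+ 2.
    apply: le_trans hG _; apply: (@le_trans _ _ ((d * e) ^+ 2 * E)).
      exact: (ler_pM (sqr_ge0 _) (expR_ge0 _) h1 h2).
    have -> : d1 / 2 = d * e * E by rewrite /e; field; rewrite dn0 gt_eqF.
    by rewrite [leRHS]exprMn ler_wpM2l ?sqr_ge0// expr2 ler_peMl// ltW.
  rewrite -(@ltr_pXn2r _ 2) ?nnegrE ?(ltW d10)// real_normK ?num_real//.
  apply: le_lt_trans h3 _; rewrite ltr_pXn2r ?nnegrE ?divr_ge0 ?(ltW d10)//.
  by rewrite ltr_pdivrMr//; lra.
Qed.

End dynamics.

Lemma periodic_orbit_opp {R : realType} (X : R * R -> R * R) G :
  periodic_orbit (fun z => - X z) G -> periodic_orbit X G.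
Proof.
move=> [g [hg [T T0 gT] [t gt] ->]]; exists (fun s => g (- s)); split.
- move=> s; have [h1 h2] := hg (- s).
  by split; (apply: der_eq; [exact: (der_flip (fun u => _) s _ _)|rewrite /= mulrN1 opprK]).
- by exists T => // s; rewrite -[in RHS](subrK T (- s)) gT opprD.
- by exists (- t); rewrite opprK oppr0.
- apply/seteqP; split=> [_ [s _ <-]|_ [s _ <-]]; last by exists (- s).
  by exists (- s); rewrite // opprK.
Qed.

Theorem proposition1p3 (R : realType) (p q m n : nat)
    (hp : (1 <= p)%N) (hq : (1 <= q)%N) (hmn : (n < m)%N)
    (Xn Xm : R * R -> R * R)
    (cXn : continuous Xn) (cXm : continuous Xm)
    (qhn : quasi_homogeneous p q n Xn) (qhm : quasi_homogeneous p q m Xm)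
    (hb : forall t : R, 0 < bfun p q Xn t * bfun p q Xm t)
    (hint :
      (\int[lebesgue_measure]_(t in `[0, 2 * pi]) (afun m n Xn t / bfun p q Xn t)) *
      (\int[lebesgue_measure]_(t in `[0, 2 * pi]) (afun m n Xm t / bfun p q Xm t))
      < 0) :
  exists G : set (R * R),
    limit_cycle (fun z => Xn z + Xm z) G /\ surrounds_origin G.
Proof.
have nz t : bfun p q Xn t != 0.
  by apply: contraTneq (hb t) => ->; rewrite mul0r ltxx.
(* A continuous function without zeros has constant sign. *)
have [bn|bn] : (forall t, 0 < bfun p q Xn t) \/ (forall t, bfun p q Xn t < 0).
- have cb := bfun_continuous p q Xn cXn.
  have [b0|b0|/eqP] := ltgtP 0 (bfun p q Xn 0); last by rewrite eq_sym (negPf (nz 0)).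
    left=> t; rewrite ltNge; apply/negP => bt; have [t0|/ltW t0] := leP 0 t.
      have [|s _ /eqP] := IVT_ge _ 0 t 0 t0 (fun x _ => cb x); first by rewrite bt ltW.
      by rewrite (negPf (nz s)).
    have [|s _ /eqP] := IVT_le _ t 0 0 t0 (fun x _ => cb x); first by rewrite bt ltW.
    by rewrite (negPf (nz s)).
  right=> t; rewrite ltNge; apply/negP => bt; have [t0|/ltW t0] := leP 0 t.
    have [|s _ /eqP] := IVT_le _ 0 t 0 t0 (fun x _ => cb x); first by rewrite bt ltW.
    by rewrite (negPf (nz s)).
  have [|s _ /eqP] := IVT_ge _ t 0 0 t0 (fun x _ => cb x); first by rewrite bt ltW.
  by rewrite (negPf (nz s)).
- apply: (limit_cycle_exists p q m n) => // t.
  by have := hb t; rewrite pmulr_rgt0.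
(* Reversing time changes the sign of all a_i and b_i; the quotients a_i / b_i and the periodic
   orbits, as sets, stay the same. *)
pose Yn z := - Xn z; pose Ym z := - Xm z.
have aN (Y : R * R -> R * R) t : afun m n (fun z => - Y z) t = - afun m n Y t by rewrite /afun/=; ring.
have bN (Y : R * R -> R * R) t : bfun p q (fun z => - Y z) t = - bfun p q Y t by rewrite /bfun/=; ring.
have qN s (Y : R * R -> R * R) : quasi_homogeneous p q s Y -> quasi_homogeneous p q s (fun z => - Y z).
  by move=> hY l x y; have [h1 h2] := hY l x y; rewrite /= h1 h2 !mulrN.
have cN (Y : R * R -> R * R) : continuous Y -> continuous (fun z => - Y z).
  by move=> cY z; apply: continuousN; exact: cY.
have rN (Y : R * R -> R * R) : (fun t => afun m n (fun z => - Y z) t / bfun p q (fun z => - Y z) t) =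
    (fun t => afun m n Y t / bfun p q Y t).
  by apply/funext => t; rewrite aN bN invrN mulrNN.
have [|||G [[Gp [U [oU GU hU]]] Gs]] :=
  limit_cycle_exists p q m n hp hq hmn Yn Ym (cN _ cXn) (cN _ cXm) (qN _ _ qhn) (qN _ _ qhm).
- by move=> t; rewrite bN oppr_gt0.
- by move=> t; rewrite bN oppr_gt0; have := hb t; rewrite nmulr_rgt0.
- by rewrite !rN.
have XE : (fun z => Yn z + Ym z) = (fun z => - (Xn z + Xm z)).
  by apply/funext => z; rewrite opprD.
rewrite XE in Gp hU; exists G; split=> //; split; first exact: periodic_orbit_opp.
exists U; split=> // G' hG'; apply: hU; apply: periodic_orbit_opp.
by rewrite (_ : (fun z => - - (Xn z + Xm z)) = fun z => Xn z + Xm z)//; apply/funext => z; rewrite opprK.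
Qed.
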